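(* Let $h:\mathbb C^2\to[0,\infty)$, $h\not\equiv0$, be a logarithmically plurisubharmonic homogeneous function, let $D_h=\{z\in\mathbb C^2:h(z)<1\}$, and let $Q\in\mathbb C[z_1,z_2]$, $Q\not\equiv 0$, be a homogeneous polynomial of degree $d\ge 0$. Then $Q\in L_h^2(D_h)$ if and only if $$m(Q,[v])>\nu(\log h,[v])\,(\deg Q+2)-1\quad\text{for every }[v]\in\mathbb P^1.$$
   Context: $h$ homogeneous means $h(\lambda z)=|\lambda|h(z)$ for $\lambda\in\mathbb C$, $z\in\mathbb C^2$; logarithmically plurisubharmonic means that $\log h$ is plurisubharmonic. $L_h^2(D):=L^2(D)\cap\mathcal O(D)$ (Lebesgue measure). $\mathbb P^1$ is the complex projective line, with points $[v]$, $v=(v_1,v_2)\in\mathbb C^2\setminus\{0\}$. For a subharmonic function $u\not\equiv-\infty$ on a domain in $\mathbb C$ and a point $z_0$ of the domain, the Lelong number is $\nu(u,z_0):=\lim_{r\to0^+}\frac{\max_{|\lambda|=r}u(z_0+\lambda)}{\log r}=\lim_{r\to 0^+}\frac{\frac1{2\pi}\int_0^{2\pi}u(z_0+re^{it})\,dt}{\log r}$. For $[v]\in\mathbb P^1$ put $\nu(\log h,[v]):=\nu(\log h(\cdot,v_2),v_1)$ if $v_2\ne0$, and $\nu(\log h,[v]):=\nu(\log h(v_1,\cdot),v_2)$ if $v_1\neq 0$; this is well defined (independent of the representative of $[v]$ and of which non-zero coordinate is used). $m(Q,[v])$ is the multiplicity of the zero of $Q$ at $[v]$: the multiplicity of the zero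 of the one-variable polynomial $\lambda\mapsto Q(v_1,\lambda)$ at $\lambda=v_2$ if $v_1\ne0$, or of $\lambda\mapsto Q(\lambda,v_2)$ at $\lambda=v_1$ if $v_2\ne0$ (it is $0$ if $Q(v)\neq 0$). *)

(* Defs.v *)
From HB Require Import structures.
(* The notations of mpoly clash with those of MathComp-Analysis; loading it
   first keeps [symmetric] and the like meaning what they do in ssrbool. *)
From mathcomp Require Import -(notations) mpoly.
From mathcomp Require Import all_boot all_order all_algebra.
From mathcomp Require Import generic_quotient.
From mathcomp Require Import all_classical all_reals all_analysis.
From mathcomp Require Import complex.

Set Implicit Arguments.
Unset Strict Implicit.
Unset Printing Implicit Defensive.

Import Order.TTheory GRing.Theory Num.Theory.
Import numFieldNormedType.Exports.

Local Open Scope classical_set_scope.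
Local Open Scope ring_scope.
Local Open Scope complex_scope.
Local Open Scope quotient_scope.

(* [R[i]^o] rather than [R[i]]: the library's topology and norm on a
   numFieldType are attached to its regular algebra. *)
Notation C1 R := (R[i]^o).
Notation C2 R := (R[i]^o * R[i]^o)%type.

Definition cmod (R : realType) (z : R[i]) : R := Normc.normc z.

Definition cis (R : realType) (t : R) : R[i] := cos t +i* sin t.

Definition upper_semicontinuous (R : realType) (X : topologicalType)
    (u : X -> \bar R) : Prop :=
  lower_semicontinuous (\- u)%E.

(* Subharmonic functions on the whole plane.  The function identically -oo is
   allowed.  The circle mean is well defined, possibly -oo, since u is bounded
   above on circles. *)
Definition subharmonic (R : realType) (u : C1 R -> \bar R) : Prop :=
  [/\ forall z, (u z < +oo)%E,
      upper_semicontinuous u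
    & forall (a : C1 R) (r : R), 0 < r ->
        (u a <= ((2 * pi)^-1)%:E *
                \int[lebesgue_measure]_(t in `[0%R, (2 * pi)%R])
                  u (a + r%:C * cis t)%R)%E].

Definition plurisubharmonic (R : realType) (u : C2 R -> \bar R) : Prop :=
  [/\ forall z, (u z < +oo)%E,
      upper_semicontinuous u
    & forall a b : C2 R, subharmonic (fun l : C1 R => u (a + l *: b))].

(* [lne] is the extended logarithm, with value -oo at 0. *)
Definition logh (R : realType) (h : C2 R -> R) (z : C2 R) : \bar R :=
  lne (h z)%:E.

Definition homogeneous (R : realType) (h : C2 R -> R) : Prop :=
  forall (l : R[i]) (z : C2 R), h (l *: z) = cmod l * h z.

(* The supremum over the circle is attained when u is upper semicontinuous. *)
Definition lelong (R : realType) (u : C1 R -> \bar R) (z0 : C1 R) : \bar R :=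
  lim ((ereal_sup [set u (z0 + l)%R | l in [set l : C1 R | cmod l = r]] *
        ((ln r)^-1)%:E)%E @[r --> 0^'+]).

Definition nzvec (R : realType) := {v : C2 R | v != 0}.

Definition proj_rel (R : realType) (v w : nzvec R) : bool :=
  `[< exists2 c : R[i], c != 0 & val w = c *: val v >].

Lemma proj_rel_refl (R : realType) : reflexive (@proj_rel R).
Proof. by move=> v; apply/asboolP; exists 1; rewrite ?oner_neq0 ?scale1r. Qed.

Lemma proj_rel_sym (R : realType) : symmetric (@proj_rel R).
Proof.
suff sub (v w : nzvec R) : proj_rel v w -> proj_rel w v.
  by move=> v w; apply/idP/idP; apply: sub.
move=> /asboolP[c c0 wE]; apply/asboolP; exists c^-1; rewrite ?invr_eq0//.
by rewrite wE scalerA mulVf// scale1r.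
Qed.

Lemma proj_rel_trans (R : realType) : transitive (@proj_rel R).
Proof.
move=> w v x /asboolP[c c0 wE] /asboolP[e e0 xE]; apply/asboolP.
by exists (e * c); rewrite ?mulf_neq0// xE wE scalerA.
Qed.

Canonical proj_equiv (R : realType) :=
  EquivRel (@proj_rel R) (@proj_rel_refl R) (@proj_rel_sym R)
    (@proj_rel_trans R).

Definition P1 (R : realType) := {eq_quot (@proj_equiv R)}.

Definition homcoord (R : realType) (p : P1 R) : C2 R := val (repr p).

(* In lelongP1 and multP1 the values depend neither on the representative
   [homcoord p] nor on which of its nonzero coordinates is kept fixed, for
   u = logh h and Q homogeneous. *)
Definition lelongP1 (R : realType) (u : C2 R -> \bar R) (p : P1 R) : \bar R :=
  let v := homcoord p in
  if v.2 != 0 then lelong (fun l => u (l, v.2)) v.1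
  else lelong (fun l => u (v.1, l)) v.2.

Definition pair_val (T : Type) (x y : T) (i : 'I_2) : T :=
  if i == ord0 then x else y.

Definition polyfun (R : realType) (Q : mpoly 2 R[i]) (z : C2 R) : R[i] :=
  meval (pair_val z.1 z.2) Q.

(* Q(a, b) as a one-variable polynomial, for a, b in C[X]. *)
Definition polysub (R : realType) (Q : mpoly 2 R[i])
    (a b : {poly R[i]}) : {poly R[i]} :=
  mmap polyC (pair_val a b) Q.

Definition multP1 (R : realType) (Q : mpoly 2 R[i]) (p : P1 R) : nat :=
  let v := homcoord p in
  if v.2 != 0 then mup v.1 (polysub Q 'X v.2%:P)
  else mup v.2 (polysub Q v.1%:P 'X).

Notation R2 R := (measurableTypeR R * measurableTypeR R)%type.

(* The library's sigma-finite instance on [\x] is shadowed by its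
   subprobability instance, so it is redeclared for this product. *)
Definition lebesgueR2 (R : realType) : set (R2 R) -> \bar R :=
  (@lebesgue_measure R \x @lebesgue_measure R)%E.

HB.instance Definition _ (R : realType) := Measure.on (@lebesgueR2 R).

Lemma lebesgueR2_sigma_finite (R : realType) :
  sigma_finite [set: R2 R] (@lebesgueR2 R).
Proof.
have /sigma_finiteP[F [TF ndF Foo]] := sigma_finiteT (@lebesgue_measure R).
exists (fun n => F n `*` F n).
  rewrite -setXTT TF predeqE => -[x y]; split.
    move=> [/= [n _ Fnx] [k _ Fky]]; exists (maxn n k) => //; split.
    - by move: x Fnx; exact/subsetPset/ndF/leq_maxl.
    - by move: y Fky; exact/subsetPset/ndF/leq_maxr.
  by move=> [n _ []/= ? ?]; split; exists n.
move=> k; have [? ?] := Foo k.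
split; first exact: measurableX.
by rewrite /lebesgueR2 product_measure1E// lte_mul_pinfty// ge0_fin_numE.
Qed.

HB.instance Definition _ (R : realType) :=
  Measure_isSigmaFinite.Build _ _ _ (@lebesgueR2 R)
    (@lebesgueR2_sigma_finite R).

Definition ofR4 (R : realType) (x : R2 R * R2 R) : C2 R :=
  (x.1.1 +i* x.1.2, x.2.1 +i* x.2.2).

Definition L2 (R : realType) (D : set (C2 R)) (f : C2 R -> R[i]) : Prop :=
  [/\ measurable_fun (@ofR4 R @^-1` D) (fun x => complex.Re (f (ofR4 x))),
      measurable_fun (@ofR4 R @^-1` D) (fun x => complex.Im (f (ofR4 x)))
    & (\int[@lebesgueR2 R \x @lebesgueR2 R]_(x in @ofR4 R @^-1` D)
         ((cmod (f (ofR4 x))) ^+ 2)%:E < +oo)%E].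

(* Complex (Frechet) differentiability: the scalar field of the domain and of
   the codomain is R[i]. *)
Definition holomorphic (R : realType) (D : set (C2 R)) (f : C2 R -> C1 R)
    : Prop :=
  forall z, D z -> differentiable f z.

Definition L2h (R : realType) (D : set (C2 R)) (f : C2 R -> R[i]) : Prop :=
  L2 D f /\ holomorphic D f.

Definition unit_domain (R : realType) (h : C2 R -> R) : set (C2 R) :=
  [set z | h z < 1].

(* Main.v *)
(* Slicing the domain by the complex lines through the origin turns the L^2 norm
   of Q into a multiple of the integral of |Q(l, 1)|^2 h(l, 1)^(-2(d + 2)) over
   l in C, so by compactness of the projective line everything is local: for H
   log-subharmonic with Lelong number nu at 0, the function |z|^(2m) H^(-p) is
   integrable near 0 if and only if p nu < 2m + 2.  If this fails, H <= C |z|^nu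
   makes the integral diverge.  If it holds, put V = H |z|^(-(nu - eps)), which
   is log-subharmonic away from 0.  As log max_{|z| <= r} H is convex in log r
   with slope nu at -oo, the maxima of V over comparable discs of size about |z|
   centred at z differ by factors e^(O(eps)), and circle means bound the mean of
   log (max V / V).  A dyadic John-Nirenberg argument then bounds the mean of
   V^(-p) near z by a multiple of (max V)^(-p), and averaging over z concludes;
   no Riesz decomposition is needed. *)
From HB Require Import structures.
Require Import Defs.
From mathcomp Require Import -(notations) mpoly.
From mathcomp Require Import all_boot all_order all_algebra.
From mathcomp Require Import generic_quotient.
From mathcomp Require Import all_classical all_reals all_analysis.
From mathcomp Require Import complex measurable_realfun.
From mathcomp Require Import ring lra.
Set Implicit Arguments.
Unset Strict Implicit.
Unset Printing Implicit Defensive.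
Import Order.TTheory GRing.Theory Num.Theory.
Import numFieldNormedType.Exports.
Local Open Scope classical_set_scope.
Local Open Scope ring_scope.
Local Open Scope complex_scope.

(** * Integration in the plane *)

(** Negative powers of a log-subharmonic function are under control only when the exponent is small
    against the oscillation of its logarithm. The exponent is given here, so the oscillation is made
    small instead: on squares centred at z of size about |z|, dividing H by |z|^(nu - eps) leaves a
    logarithm whose oscillation is O(eps), and eps is taken small against 1 / p. The exponent nu -
    eps is used rather than nu because the quotient then tends to 0 at the origin. It stays upper
    semicontinuous there, and its disc maxima remain log-convex even for discs containing the
    origin, which the doubling estimate uses. The price is a factor |z|^(-p eps), absorbed by the
    strictness of the inequality. Throughout, functions are nonnegative reals rather than
    logarithms, and the sub-mean inequality is tested against continuous majorants, so integrability
    of a logarithm never has to be known beforehand. *)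

Section real_affine.
Context {R : realType}.
Notation mu := (@lebesgue_measure R).

Lemma measurable_affine (a b : R) :
  measurable_fun setT (fun x : measurableTypeR R => a * x + b : measurableTypeR R).
Proof. by apply: measurable_funD => //; apply: measurable_funM. Qed.

(** By uniqueness of Lebesgue measure, half-open intervals suffice. For [a < 0] the preimage of such
    an interval is open at the other end, which does not affect its length. *)
Lemma pushforward_affine (a b : R) (A : set (measurableTypeR R)) :
  a != 0 -> measurable A ->
  mu A = (`|a|%:E *
   mu ((fun x : measurableTypeR R => a * x + b : measurableTypeR R)%R @^-1` A))%E.
Proof.
move=> a0 mA; pose phi (x : measurableTypeR R) : measurableTypeR R := a * x + b.
pose mphi := measurable_affine a b.
pose phi' : {mfun measurableTypeR R >-> measurableTypeR R} :=
  HB.pack phi (isMeasurableFun.Build _ _ _ _ phi mphi).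
have a_gt0 : 0 < `|a| by rewrite normr_gt0.
pose k : {nonneg R} := NngNum (ltW a_gt0).
rewrite (@lebesgue_measure_unique _ (mscale k (pushforward mu phi')))//.
move=> _ [[x y]] _ <-; change (mu `]x, y]%classic =
  (`|a|%:E * mu (phi @^-1` `]x, y]%classic))%E).
have [xy|yx] := ltP x y; last first.
  by rewrite set_itv_ge ?bnd_simp -?leNgt// ?preimage_set0 ?measure0 ?mule0//.
have [agt0|alt0|/eqP] := ltgtP a 0; last by rewrite (negbTE a0).
- have -> : (phi @^-1` `]x, y] = `[(y - b) / a, (x - b) / a[)%classic.
    apply/seteqP; split => z /=; rewrite /phi !in_itv/= ltr_ndivlMr//.
      by rewrite ler_ndivrMr// mulrC => /andP[? ?]; apply/andP; split; lra.
    by rewrite ler_ndivrMr// mulrC => /andP[? ?]; apply/andP; split; lra.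
  rewrite !lebesgue_measure_itv/= !lte_fin xy.
  rewrite ltr_nM2r ?invr_lt0// ltrD2r xy -!EFinB -EFinM; congr EFin.
  by rewrite (ltr0_norm agt0); field.
- have -> : (phi @^-1` `]x, y] = `](x - b) / a, (y - b) / a])%classic.
    apply/seteqP; split => z /=; rewrite /phi !in_itv/= ltr_pdivrMr//.
      by rewrite ler_pdivlMr// mulrC => /andP[? ?]; apply/andP; split; lra.
    by rewrite ler_pdivlMr// mulrC => /andP[? ?]; apply/andP; split; lra.
  rewrite !lebesgue_measure_itv/= !lte_fin xy.
  rewrite ltr_pM2r ?invr_gt0// ltrD2r xy -!EFinB -EFinM; congr EFin.
  by rewrite (gtr0_norm alt0); field.
Qed.

Lemma ge0_integral_affine (a b : R) (f : measurableTypeR R -> \bar R) :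
  a != 0 -> measurable_fun setT f -> (forall x, 0 <= f x)%E ->
  (\int[mu]_x f x = `|a|%:E * \int[mu]_x f (a * x + b)%R)%E.
Proof.
move=> a0 mf f0; pose phi (x : measurableTypeR R) : measurableTypeR R := a * x + b.
pose mphi := measurable_affine a b.
pose nu : {measure set (measurableTypeR R) -> \bar R} :=
  measure_function_pushforward__canonical__measure_function_Measure mu mphi.
have a_gt0 : 0 < `|a| by rewrite normr_gt0.
pose k : {nonneg R} := NngNum (ltW a_gt0).
transitivity (\int[mscale k nu]_x f x)%E.
  by apply: eq_measure_integral => /= A mA _; exact: pushforward_affine.
rewrite ge0_integral_mscale//=; congr (_ * _)%E.
by rewrite (ge0_integral_pushforward mphi)//= preimage_setT.
Qed.
End real_affine.

Section plane.
Context {R : realType}.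
Notation mu := (@lebesgue_measure R).
Notation mu2 := (@lebesgueR2 R).
Implicit Types f : R2 R -> \bar R.

Definition cplx (x : R2 R) : R[i] := x.1 +i* x.2.
Definition uncplx (z : R[i]) : R2 R := (complex.Re z, complex.Im z).

Lemma cplxK : cancel cplx uncplx. Proof. by case. Qed.
Lemma uncplxK : cancel uncplx cplx. Proof. by case. Qed.

Lemma integral_R2 f : measurable_fun setT f -> (forall x, 0 <= f x)%E ->
  (\int[mu2]_x f x = \int[mu]_y \int[mu]_x f (x, y))%E.
Proof. by move=> mf f0; rewrite /lebesgueR2 fubini_tonelli2. Qed.

(** Multiplication by any [w], hence a rotation composed with the dilation of ratio [cmod w],
    written on pairs of reals because the product measure lives there. *)
Definition rot (w : R[i]) (x : R2 R) : R2 R := uncplx (w * cplx x).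

Lemma rotE a b x : rot (a +i* b) x = (a * x.1 - b * x.2, a * x.2 + b * x.1).
Proof. by []. Qed.

Lemma measurable_rot (w : R[i]) : measurable_fun setT (rot w).
Proof.
case: w => a b; apply/measurable_fun_pairP; split => /=.
  rewrite (_ : fst \o _ = (fun x : R2 R => a * x.1 - b * x.2))//.
  by apply: measurable_funB; apply: measurable_funM.
rewrite (_ : snd \o _ = (fun x : R2 R => a * x.2 + b * x.1))//.
by apply: measurable_funD; apply: measurable_funM.
Qed.

Lemma measurable_affine2 (a b c d e g : R) : measurable_fun setT
  (fun x : R2 R => (a * x.1 + b * x.2 + c, d * x.1 + e * x.2 + g) : R2 R).
Proof.
by apply/measurable_fun_pairP; split => /=;
  apply: measurable_funD => //; apply: measurable_funD; apply: measurable_funM.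
Qed.

(** Complex multiplication is factored into one-dimensional affine substitutions made under Tonelli.
    If [a != 0], the second variable is scaled by [N / a] and the first by [a], each with a shear,
    and the ratios multiply to [N = cmod w ^+ 2]. If [a = 0], the coordinates are exchanged and
    scaled by [- b] and [b]. *)
Lemma ge0_integral_rot (w : R[i]) f : w != 0 -> measurable_fun setT f ->
  (forall x, 0 <= f x)%E ->
  (\int[mu2]_x f x = (cmod w ^+ 2)%:E * \int[mu2]_x f (rot w x))%E.
Proof.
case: w => a b w0 mf f0.
have -> : cmod (a +i* b) ^+ 2 = a ^+ 2 + b ^+ 2.
  by rewrite /cmod /= sqr_sqrtr// addr_ge0// sqr_ge0.
have mfaff c d e g k l : measurable_fun setT (fun x : R2 R =>
    f (c * x.1 + d * x.2 + e, g * x.1 + k * x.2 + l) : \bar R).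
  by apply: (measurableT_comp mf); exact: measurable_affine2.
have f1 x : measurable_fun setT (fun y : measurableTypeR R => f (x, y)).
  exact: measurableT_comp mf (pair1_measurable x).
have mfr := measurableT_comp mf (measurable_rot (a +i* b)).
have intF g : measurable_fun setT g -> (forall x, 0 <= g x)%E ->
    measurable_fun setT (fun x : measurableTypeR R => \int[mu]_y g (x, y) : \bar R)%E.
  by move=> mg g0; exact: (measurable_fun_fubini_tonelli_F (m2 := mu) g mg g0).
have intG g : measurable_fun setT g -> (forall x, 0 <= g x)%E ->
    measurable_fun setT (fun y : measurableTypeR R => \int[mu]_x g (x, y) : \bar R)%E.
  by move=> mg g0; exact: (measurable_fun_fubini_tonelli_G (m1 := mu) g mg g0).
rewrite (integral_R2 mfr); last by move=> x; exact: f0.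
rewrite (integral_R2 mf f0) -(fubini_tonelli f mf f0).
have affine2 c e x : c != 0 ->
    (\int[mu]_y f (x, y) = `|c|%:E * \int[mu]_y f (x, c * y + e)%R)%E.
  by move=> c0; exact: (ge0_integral_affine e c0 (f1 x) (fun y => f0 _)).
have muleA_eq (u v w : R) (I J : \bar R) : u * v = w -> I = J ->
    (u%:E * (v%:E * I) = w%:E * J)%E by move=> <- <-; rewrite muleA.
have [a0|a0] := eqVneq a 0.
  have b0 : b != 0 by apply: contraNneq w0 => ->; rewrite a0.
  have nb0 : - b != 0 by rewrite oppr_eq0.
  rewrite (ge0_integral_affine 0 nb0 (intF _ mf f0)); last by move=> x; exact: integral_ge0.
  under eq_integral => y _ do rewrite (affine2 _ 0 _ b0).
  have mb : measurable_fun setT (fun x : R2 R => f (- b * x.1 + 0, b * x.2 + 0)).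
    have := mfaff (- b) 0 0 0 b 0.
    by apply: eq_measurable_fun => -[x y] _ /=; congr f; congr pair; ring.
  rewrite (ge0_integralZl mu measurableT (intF _ mb (fun x => f0 _)))//; last first.
    by move=> y _; exact: integral_ge0.
  apply: muleA_eq; first by rewrite -normrM mulNr normrN ger0_norm ?sqr_ge0 // a0 expr0n add0r.
  apply: eq_integral => y _; apply: eq_integral => x _.
  by rewrite /comp rotE a0/=; congr f; congr pair; ring.
have N0 : 0 < a ^+ 2 + b ^+ 2 by rewrite ltr_wpDr ?sqr_ge0// exprn_even_gt0.
set N := a ^+ 2 + b ^+ 2 in N0 *.
have Na0 : N / a != 0 by rewrite mulf_neq0 ?invr_eq0// gt_eqF.
(* The shear [b / a * x] is chosen so that the later substitution of [a * x - b * y] for [x] turns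
   the second coordinate into [a * y + b * x], because [N - b ^+ 2 = a ^+ 2]. *)
under eq_integral => x _ do rewrite (affine2 _ (b / a * x) _ Na0).
pose g (x : R2 R) := f (x.1, N / a * x.2 + b / a * x.1).
have mg : measurable_fun setT g.
  have := mfaff 1 0 0 (b / a) (N / a) 0.
  by apply: eq_measurable_fun => -[x y] _; rewrite /g /=; congr f; congr pair; ring.
have g0 x : (0 <= g x)%E by exact: f0.
have Ig0 x : setT x -> (0 <= \int[mu]_y g (x, y))%E by move=> _; exact: integral_ge0.
have k0 : (0 <= `|N / a|%:E)%E by rewrite lee_fin.
rewrite (ge0_integralZl mu measurableT (intF _ mg g0) Ig0 k0).
rewrite [X in (_ * X)%E](fubini_tonelli g mg g0).
have affine1 y : (\int[mu]_x g (x, y) =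
    `|a|%:E * \int[mu]_x g (a * x + - b * y, y)%R)%E.
  exact: (ge0_integral_affine (- b * y) a0 (measurableT_comp mg (pair2_measurable y)) (fun x => g0 _)).
under eq_integral => y _ do rewrite affine1.
have mh : measurable_fun setT (fun x : R2 R => g (a * x.1 + - b * x.2, x.2)).
  have := mfaff a (- b) 0 b a 0.
  apply: eq_measurable_fun => -[x y] _; rewrite /g /=; congr f; congr pair; first by ring.
  by rewrite /N /=; field.
rewrite (ge0_integralZl mu measurableT (intG _ mh (fun x => g0 _)))//; last first.
  by move=> x _; exact: integral_ge0.
apply: muleA_eq; first by rewrite -normrM divfK// ger0_norm// ltW.
apply: eq_integral => y _; apply: eq_integral => x _.
by rewrite /comp rotE/= /g /=; congr f; congr pair; rewrite ?/N; field.
Qed.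

Lemma ge0_integral_transl (v : R[i]) f : measurable_fun setT f ->
  (forall x, 0 <= f x)%E ->
  (\int[mu2]_x f x = \int[mu2]_x f (uncplx (cplx x + v)%R))%E.
Proof.
case: v => a b mf f0.
have mg : measurable_fun setT (fun x : R2 R => f (uncplx (cplx x + (a +i* b)))).
  apply: (measurableT_comp mf).
  have := measurable_affine2 1 0 a 0 1 b.
  by apply: eq_measurable_fun => -[x y] _ /=; congr pair; rewrite /=; ring.
rewrite (integral_R2 mf f0) (integral_R2 mg (fun x => f0 _)).
have mf' : measurable_fun setT (fun y : measurableTypeR R =>
      \int[mu]_x f (x, y))%E by exact: measurable_fun_fubini_tonelli_G.
rewrite (@ge0_integral_affine _ 1 b _ _ mf')//; last first.
  by move=> x; exact: integral_ge0.
rewrite normr1 mul1e; apply: eq_integral => y _.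
rewrite (@ge0_integral_affine _ 1 a (fun z => f (z, _)))//; last first.
  exact: measurableT_comp mf (pair2_measurable _).
by rewrite normr1 mul1e; apply: eq_integral => x _; rewrite !mul1r.
Qed.

End plane.

(** * Modulus, semicontinuity and compactness in the complex plane *)

Arguments cmod {R} z : simpl never.
Section cmod_theory.
Context {R : realType}.
Implicit Types z w : R[i].

Lemma cmodE a b : cmod (a +i* b) = Num.sqrt (a ^+ 2 + b ^+ 2) :> R.
Proof. by []. Qed.

Lemma cmod_ge0 z : 0 <= cmod z. Proof. by case: z => a b; exact: sqrtr_ge0. Qed.

Lemma cmod0 : cmod 0 = 0 :> R. Proof. exact: Normc.normc0. Qed.

Lemma cmod1 : cmod 1 = 1 :> R. Proof. exact: Normc.normc1. Qed.

Lemma cmod_eq0 z : (cmod z == 0) = (z == 0).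
Proof.
by apply/eqP/eqP => [/Normc.eq0_normc //|->]; exact: cmod0.
Qed.

Lemma cmod_gt0 z : (0 < cmod z) = (z != 0).
Proof. by rewrite lt0r cmod_eq0 cmod_ge0 andbT. Qed.

Lemma cmodM z w : cmod (z * w) = cmod z * cmod w.
Proof. exact: Normc.normcM. Qed.

Lemma cmodN z : cmod (- z) = cmod z. Proof. exact: normcN. Qed.

Lemma cmodBC z w : cmod (z - w) = cmod (w - z).
Proof. by rewrite -cmodN opprB. Qed.

Lemma cmodV z : cmod z^-1 = (cmod z)^-1. Proof. exact: Normc.normcV. Qed.

Lemma cmodX z n : cmod (z ^+ n) = cmod z ^+ n.
Proof. by elim: n => [|n ih]; rewrite ?expr0 ?cmod1// !exprS cmodM ih. Qed.

Lemma le_cmodD z w : cmod (z + w) <= cmod z + cmod w.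
Proof. exact: le_normcD. Qed.

Lemma le_cmodB z w : cmod (z - w) <= cmod z + cmod w.
Proof. by rewrite -(cmodN w); exact: le_cmodD. Qed.

Lemma ge_cmodD z w : cmod z - cmod w <= cmod (z + w).
Proof. by rewrite lerBlDr -{1}(addrK w z); exact: le_cmodB. Qed.

Lemma cmod_triangle z w v : cmod (z - v) <= cmod (z - w) + cmod (w - v).
Proof. by rewrite (_ : z - v = (z - w) + (w - v)) ?le_cmodD//; ring. Qed.

Lemma cmod_sqr z : cmod z ^+ 2 = complex.Re z ^+ 2 + complex.Im z ^+ 2.
Proof. by case: z => a b; rewrite cmodE sqr_sqrtr// addr_ge0// sqr_ge0. Qed.

Lemma cmod_real (r : R) : cmod r%:C = `|r|.
Proof. by rewrite cmodE expr0n addr0 sqrtr_sqr. Qed.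

Lemma cmod_cis t : cmod (cis t) = 1 :> R.
Proof. by rewrite /cis cmodE cos2Dsin2 sqrtr1. Qed.

Lemma le_Re_cmod z : `|complex.Re z| <= cmod z.
Proof.
case: z => a b /=; rewrite cmodE -sqrtr_sqr ler_sqrt ?addr_ge0 ?sqr_ge0//.
by rewrite lerDl sqr_ge0.
Qed.

Lemma le_Im_cmod z : `|complex.Im z| <= cmod z.
Proof.
case: z => a b /=; rewrite cmodE -sqrtr_sqr ler_sqrt ?addr_ge0 ?sqr_ge0//.
by rewrite lerDr sqr_ge0.
Qed.

Lemma le_cmod_ReIm z : cmod z <= `|complex.Re z| + `|complex.Im z|.
Proof.
case: z => a b; rewrite (_ : a +i* b = a%:C + (0 +i* b))//; last first.
  by apply/eqP; rewrite eq_complex/= addr0 add0r !eqxx.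
rewrite (le_trans (le_cmodD _ _))// cmod_real (cmodE 0) expr0n add0r sqrtr_sqr.
by rewrite /= addr0 add0r.
Qed.

Lemma continuous_cmod_cplx (v : R[i]) :
  continuous (fun x : R * R => cmod (cplx (x : R2 R) - v)).
Proof.
move=> x; apply/cvgrPdist_le => /= e e0; near=> y.
rewrite (@le_trans _ _ (`|x.1 - y.1| + `|x.2 - y.2|))//.
  apply: (@le_trans _ _ (cmod (cplx (x : R2 R) - cplx (y : R2 R)))); last first.
    exact: le_cmod_ReIm.
  rewrite ler_norml; apply/andP; split.
    rewrite lerNl opprB lerBlDr (le_trans (cmod_triangle _ (cplx (x : R2 R)) _))//.
    by rewrite cmodBC.
  by rewrite lerBlDr cmod_triangle.
rewrite (splitr e) lerD//; near: y.
- have : y.1 @[y --> x] --> x.1 by exact: cvg_fst.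
  by move/cvgrPdist_le; apply; rewrite divr_gt0.
- have : y.2 @[y --> x] --> x.2 by exact: cvg_snd.
  by move/cvgrPdist_le; apply; rewrite divr_gt0.
Unshelve. all: by end_near. Qed.

(** Stated with real radii, since the balls of the ambient topology have radii in [R[i]]. *)
Definition usc (V : R[i] -> R) := forall z c, V z < c ->
  exists2 d, 0 < d & forall w, cmod (w - z) < d -> V w < c.

Definition metric_open (A : set R[i]) := forall z, A z ->
  exists2 d : R, 0 < d & forall w, cmod (w - z) < d -> A w.

Lemma open_cplx (A : set R[i]) : metric_open A ->
  open [set x : R * R | A (cplx (x : R2 R))].
Proof.
move=> oA; rewrite openE => x /= /oA[d d0 dA]; rewrite /interior.
have := @continuous_cmod_cplx (cplx (x : R2 R)) x.
rewrite /continuous_at subrr cmod0 => /cvgrPdist_lt/(_ d d0).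
apply: filterS => y /=; rewrite sub0r normrN ger0_norm ?cmod_ge0//.
exact: dA.
Qed.

Lemma disc_cover (K : set R[i]) (M : R) (d : R[i] -> R) :
  metric_open (~` K) -> (forall z, K z -> cmod z <= M) ->
  (forall z, K z -> 0 < d z) ->
  exists2 s : seq R[i], (forall z, z \in s -> K z) &
    forall z, K z -> exists2 w, w \in s & cmod (z - w) < d w.
Proof.
move=> oK KM dK; pose K' := [set x : R * R | K (cplx (x : R2 R))].
have cK' : compact K'.
  have cS : compact (`[- M, M]%classic `*` `[- M, M]%classic : set (R * R)).
    by apply: compact_setX; exact: segment_compact.
  apply: (subclosed_compact _ cS).
    by rewrite -openC; exact: (open_cplx oK).
  move=> x /= /KM xM; split; rewrite /= in_itv/= -ler_norml (le_trans _ xM)//.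
    exact: (le_Re_cmod (cplx (x : R2 R))).
  exact: (le_Im_cmod (cplx (x : R2 R))).
move: cK'; rewrite compact_near_coveringP => cK'.
(* The near-covering form of compactness is applied along the filter of finite lists of centres,
   ordered by inclusion. *)
pose F : set_system (seq R[i]) := [set A : set (seq R[i]) | exists2 s : seq R[i],
  (forall z, z \in s -> K z) & forall t : seq R[i], {subset s <= t} -> A t].
have FF : Filter F.
  split; first by exists [::].
    move=> A B [s sK sA] [t tK tB]; exists (s ++ t).
      by move=> z; rewrite mem_cat => /orP[/sK|/tK].
    move=> u stu; split; [apply: sA|apply: tB] => z zs; apply: stu;
      by rewrite mem_cat zs ?orbT.
  by move=> A B AB [s sK sA]; exists s => // t /sA /AB.
have [|s sK sP] := cK' _ F (fun s x => exists2 w, w \in s &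
    cmod (cplx (x : R2 R) - w) < d w) FF; last first.
  exists s => // z Kz; have := sP s (fun _ => id) (uncplx z).
  by rewrite /K'/= uncplxK; apply.
move=> x Kx; exists ([set y : R * R | cmod (cplx (y : R2 R) - cplx (x : R2 R)) < d (cplx (x : R2 R))],
   [set s : seq R[i] | cplx (x : R2 R) \in s]) => /=; last first.
  by move=> [y s] /= [yx xs]; exists (cplx (x : R2 R)).
split; last first.
  exists [:: cplx (x : R2 R)]; first by move=> z; rewrite mem_seq1 => /eqP ->.
  by move=> s; apply; exact: mem_head.
apply: open_nbhs_nbhs; split; last by rewrite /= subrr cmod0 dK.
apply: (@open_cplx [set z | cmod (z - cplx (x : R2 R)) < d (cplx (x : R2 R))]).
move=> z /= zw; exists (d (cplx (x : R2 R)) - cmod (z - cplx (x : R2 R))).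
  by rewrite subr_gt0.
by move=> y yz; rewrite (le_lt_trans (cmod_triangle y z _))// -ltrBrDr.
Qed.

(** Without a maximum, every point of [K] has a neighbourhood on which [V] stays below a value taken
    elsewhere in [K]. Finitely many such neighbourhoods cover [K], and the largest of the finitely
    many values would lie below itself. *)
Lemma usc_max (V : R[i] -> R) (K : set R[i]) (M : R) :
  usc V -> metric_open (~` K) -> (forall z, K z -> cmod z <= M) -> K !=set0 ->
  exists2 z, K z & forall w, K w -> V w <= V z.
Proof.
move=> uV oK KM [z0 Kz0]; apply: contrapT => nomax.
have bt z : K z -> exists w, K w /\ V z < V w.
  move=> Kz; apply: contrapT => nw; apply: nomax; exists z => // w Kw.
  by rewrite leNgt; apply/negP => zw; apply: nw; exists w.
have bt2 z : exists wd : R[i] * R, K z -> [/\ K wd.1, 0 < wd.2 &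
    forall y, cmod (y - z) < wd.2 -> V y < V wd.1].
  have [Kz|nKz] := pselect (K z); last by exists (0, 0).
  by have [w [Kw /uV[d d0 dV]]] := bt _ Kz; exists (w, d).
have [f fP] := choice bt2.
have [|s sK sP] := @disc_cover K M (fun z => (f z).2) oK KM.
  by move=> z /fP[].
have maxseq (t : seq R[i]) : t != [::] ->
    exists2 w, w \in t & forall y, y \in t -> V (f y).1 <= V (f w).1.
  elim: t => // a t ih _; have [->|t0] := eqVneq t [::].
    by exists a; rewrite ?mem_seq1// => y; rewrite mem_seq1 => /eqP ->.
  have [w wt wmax] := ih t0.
  have [aw|wa] := leP (V (f a).1) (V (f w).1).
    by exists w => [|y]; rewrite in_cons ?wt ?orbT// => /predU1P[->//|/wmax].
  exists a => [|y]; rewrite in_cons ?eqxx// => /predU1P[->//|/wmax/le_trans].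
  by apply; exact: ltW.
have [|w ws wmax] := maxseq s.
  by have [y0 y0s _] := sP _ Kz0; apply: contraTneq y0s => ->.
have [Kw _ _] := fP _ (sK _ ws); have [y ys yw] := sP _ Kw.
have [_ _ /(_ _ yw)] := fP _ (sK _ ys).
by rewrite ltNge wmax.
Qed.
End cmod_theory.

Section planar_measure.
Context {R : realType}.
Notation mu := (@lebesgue_measure R).
Notation mu2 := (@lebesgueR2 R).

(** An open set is the countable union of the rational boxes that it contains. *)
Lemma measurable_metric_open (A : set R[i]) : metric_open A ->
  measurable (cplx @^-1` A : set (R2 R)).
Proof.
move=> oA; pose box (p : rat * rat * rat) : set (R2 R) :=
  `](ratr p.1.1 - ratr p.2), (ratr p.1.1 + ratr p.2)[%classic `*`
  `](ratr p.1.2 - ratr p.2), (ratr p.1.2 + ratr p.2)[%classic.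
pose P p := box p `<=` cplx @^-1` A.
rewrite (_ : cplx @^-1` A = \bigcup_p (if `[< P p >] then box p else set0)).
  apply: countable_bigcupT_measurable => [|p]; first exact: countableP.
  by case: asboolP => // _; apply: measurableX; exact: measurable_itv.
apply/seteqP; split => [x Ax|x [p _]]; last by case: asboolP => // Pp /Pp.
have [d d0 dA] := oA _ Ax.
(* With half-side below [d / 4] and a centre within the half-side of [x] in each coordinate, the box
   stays within [d / 2] of [x] in each coordinate, so within [d] in modulus. *)
have [r /[!in_itv]/= /andP[r0 rd]] : exists r : rat, ratr r \in `](0:R), d / 4[.
  by apply: rat_in_itvoo; rewrite divr_gt0.
have near_rat y : exists q : rat, `|ratr q - y| < ratr r :> R.
  have [|q /[!in_itv]/= /andP[q1 q2]] := @rat_in_itvoo R (y - ratr r) (y + ratr r).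
    by rewrite ltrD2l gtrN.
  by exists q; rewrite ltr_norml; apply/andP; split; lra.
have [q1 hq1] := near_rat x.1; have [q2 hq2] := near_rat x.2.
exists (q1, q2, r) => //; case: asboolP => [_|].
  move: hq1 hq2; rewrite !ltr_norml => /andP[? ?] /andP[? ?].
  by split; rewrite /= in_itv/=; apply/andP; split; lra.
move=> nP; case: nP => y [] /=; rewrite !in_itv/= => /andP[y1 y2] /andP[y3 y4].
apply: dA; rewrite (le_lt_trans (le_cmod_ReIm _))//=.
move: hq1 hq2; rewrite !ltr_norml => /andP[? ?] /andP[? ?].
have ? : `|y.1 - x.1| < d / 2 by rewrite ltr_norml; apply/andP; split; lra.
have ? : `|y.2 - x.2| < d / 2 by rewrite ltr_norml; apply/andP; split; lra.
by lra.
Qed.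

Lemma measurable_usc (V : R[i] -> R) : usc V ->
  measurable_fun setT (fun x : R2 R => V (cplx x)).
Proof.
move=> uV; apply: (measurability _ (RGenInftyO.measurableE R)).
move=> /= _ [_ [a ->] <-]; rewrite setTI.
rewrite (_ : _ @^-1` _ = cplx @^-1` [set z | V z < a]); last first.
  by apply/seteqP; split => x /=; rewrite in_itv/=.
by apply: (@measurable_metric_open [set z | V z < a]) => z /= /uV.
Qed.

Definition disc (a : R[i]) (r : R) : set (R2 R) := [set x | cmod (cplx x - a) < r].

Lemma metric_open_disc (a : R[i]) (r : R) : metric_open [set z | cmod (z - a) < r].
Proof.
move=> z /= za; exists (r - cmod (z - a)); first by rewrite subr_gt0.
by move=> w wz; rewrite (le_lt_trans (cmod_triangle w z a))// -ltrBrDr.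
Qed.

Lemma measurable_disc a r : measurable (disc a r).
Proof.
exact: (@measurable_metric_open [set z | cmod (z - a) < r] (@metric_open_disc a r)).
Qed.

Lemma measurable_cos : measurable_fun setT (@cos R : measurableTypeR R -> measurableTypeR R).
Proof. by apply: continuous_measurable_fun; exact: continuous_cos. Qed.

Lemma measurable_sin : measurable_fun setT (@sin R : measurableTypeR R -> measurableTypeR R).
Proof. by apply: continuous_measurable_fun; exact: continuous_sin. Qed.

Lemma measurable_rot_cis :
  measurable_fun setT (fun p : R2 R * measurableTypeR R => rot (cis p.2) p.1).
Proof.
have mc : measurable_fun setT (fun p : R2 R * measurableTypeR R => cos p.2).
  exact: (measurableT_comp measurable_cos measurable_snd).
have ms : measurable_fun setT (fun p : R2 R * measurableTypeR R => sin p.2).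
  exact: (measurableT_comp measurable_sin measurable_snd).
have m1 : measurable_fun setT (fun p : R2 R * measurableTypeR R => p.1.1).
  exact: (measurableT_comp measurable_fst measurable_fst).
have m2 : measurable_fun setT (fun p : R2 R * measurableTypeR R => p.1.2).
  exact: (measurableT_comp measurable_snd measurable_fst).
apply/measurable_fun_pairP; split; rewrite /comp /=.
  by apply: measurable_funB; apply: measurable_funM.
by apply: measurable_funD; apply: measurable_funM.
Qed.

Lemma cmod_rot (w : R[i]) (x : R2 R) : cmod (cplx (rot w x)) = cmod w * cmod (cplx x).
Proof. by rewrite /rot uncplxK cmodM. Qed.

Lemma measurable_transl (a : R[i]) :
  measurable_fun setT (fun x : R2 R => uncplx (cplx x + a)).
Proof.
case: a => a b; have := @measurable_affine2 R 1 0 a 0 1 b.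
by apply: eq_measurable_fun => -[x y] _ /=; congr pair; rewrite /=; ring.
Qed.

Lemma transl_integral_disc (a : R[i]) (r : R) (f : R2 R -> \bar R) :
  measurable_fun setT f -> (forall x, 0 <= f x)%E ->
  (\int[mu2]_(x in disc a r) f x =
   \int[mu2]_(x in disc 0%R r) f (uncplx (cplx x + a)%R))%E.
Proof.
move=> mf f0; rewrite integral_mkcond (@ge0_integral_transl _ a)//; last 2 first.
- by apply/(measurable_restrictT _ _).1 => //;
    [exact: measurable_disc|exact: measurable_funTS].
- by move=> x; rewrite patchE; case: ifP.
rewrite [RHS]integral_mkcond; apply: eq_integral => x _; rewrite !patchE.
congr (if _ then _ else _).
by apply/idP/idP; rewrite !inE /disc /= uncplxK addrK subr0.
Qed.

(* Averaging over rotations turns an area integral into circle means. *)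
Lemma disc_mean (a : R[i]) (r b : R) (w : R[i] -> \bar R) :
  measurable_fun setT (fun x : R2 R => w (cplx x)) -> (forall z, 0 <= w z)%E ->
  (forall l, (cmod l < r)%R -> \int[mu]_(t in `[0%R, (2 * pi)%R]) w (a + l * cis t)%R <=
     (2 * pi * b)%:E)%E ->
  (\int[mu2]_(x in disc a r) w (cplx x) <= b%:E * mu2 (disc 0%R r))%E.
Proof.
move=> mw w0 wb; rewrite (transl_integral_disc a r mw)//.
pose g (x : R2 R) : \bar R := ((fun x => w (cplx x + a)%R) \_ (disc 0 r)) x.
have g0 x : (0 <= g x)%E by rewrite /g patchE; case: ifP.
have mg : measurable_fun setT g.
  apply: (measurable_restrictT (fun x : R2 R => w (cplx x + a)%R)
    (measurable_disc 0 r)).1.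
  apply: measurable_funTS.
  rewrite (_ : (fun _ => _) = (fun x => w (cplx x)) \o (fun x => uncplx (cplx x + a))).
    exact: (measurableT_comp mw (measurable_transl a)).
  by apply/funext => x /=; rewrite uncplxK.
have -> : (\int[mu2]_(x in disc 0%R r) w (cplx (uncplx (cplx x + a)))%R =
    \int[mu2]_x g x)%E.
  rewrite integral_mkcond; apply: eq_integral => x _.
  by rewrite /g !patchE; case: ifP => //; rewrite uncplxK.
(* The integral is unchanged by each rotation, so it equals its average over [t]. Tonelli then
   leaves, for each [x], a mean over the circle of radius [cmod (cplx x)]. *)
have rotg t : (\int[mu2]_x g x = \int[mu2]_x g (rot (cis t) x))%E.
  rewrite (@ge0_integral_rot _ (cis t))// ?cmod_cis ?expr1n ?mul1e//.
  by rewrite -cmod_eq0 cmod_cis oner_eq0.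
have pi20 : 0 < 2 * pi :> R by rewrite mulr_gt0// pi_gt0.
pose J := `[0, (2 * pi)]%classic : set (measurableTypeR R).
have mJ : measurable J by exact: measurable_itv.
have muJ : mu J = (2 * pi)%:E.
  by rewrite /J lebesgue_measure_itv/= lte_fin pi20 sube0.
rewrite -(@lee_pmul2l _ (2 * pi)%:E)// ?lte_fin//.
have -> : ((2 * pi)%:E * \int[mu2]_x g x =
    \int[mu]_(t in J) \int[mu2]_x g (rot (cis t) x))%E.
  under [RHS]eq_integral do rewrite -rotg.
  by rewrite integral_cst// -[RHS]muleC; congr (_ * _)%E; exact/esym.
pose G (p : R2 R * measurableTypeR R) : \bar R :=
  ((\1_J p.2)%:E * g (rot (cis p.2) p.1))%E.
have G0 p : (0 <= G p)%E by rewrite /G mule_ge0// lee_fin.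
have mG : measurable_fun setT G.
  apply: emeasurable_funM.
    apply/measurable_EFinP; apply: (measurableT_comp _ measurable_snd).
    exact: measurable_indic.
  exact: (measurableT_comp mg measurable_rot_cis).
have -> : (\int[mu]_(t in J) \int[mu2]_x g (rot (cis t) x) =
    \int[mu]_t \int[mu2]_x G (x, t))%E.
  rewrite integral_mkcond; apply: eq_integral => t _; rewrite patchE /G/= indicE.
  case: ifP => tJ; first by apply: eq_integral => x _; rewrite mul1e.
  by rewrite -[LHS](integral0 mu2 setT); apply: eq_integral => x _; rewrite mul0e.
rewrite -(@fubini_tonelli _ _ _ _ _ mu2 mu G)//.
apply: (@le_trans _ _ (\int[mu2]_(x in disc 0%R r) (2 * pi * b)%:E)%E); last first.
  by rewrite integral_cst ?EFinM ?muleA//; exact: measurable_disc.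
rewrite [leRHS]integral_mkcond; apply: ge0_le_integral => //.
- by move=> x _; exact: integral_ge0.
- exact: measurable_fun_fubini_tonelli_F.
- by apply/(measurable_restrictT _ _).1 => //; exact: measurable_disc.
move=> x _; rewrite patchE; case: ifP => [|/negbT]; rewrite ?inE => xr.
  have := wb (cplx x); rewrite -[X in X < r]/(cmod (cplx x)).
  move: (xr); rewrite /disc/= subr0 => xr' /(_ xr'); apply: le_trans.
  rewrite [leRHS]integral_mkcond le_eqVlt; apply/orP; left; apply/eqP.
  apply: eq_integral => t _; rewrite patchE /G/= indicE; case: ifP => _.
    rewrite mul1e /g patchE /rot mem_set ?uncplxK ?(addrC a) ?(mulrC (cis t))//.
    by rewrite /disc/= subr0 uncplxK cmodM cmod_cis ?mul1r ?mulr1.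
  by rewrite mul0e.
rewrite (_ : (\int[mu]_y G (x, y))%E = 0%E)//.
rewrite -[RHS](integral0 mu setT); apply: eq_integral => t _.
rewrite /G/= /g patchE memNset ?mule0//.
move: xr; rewrite notin_setE; apply: contra_not.
by rewrite /disc/= !subr0 cmod_rot cmod_cis mul1r.
Qed.

End planar_measure.

(** * Means over circles *)

Section circle_integrals.
Context {R : realType}.
Notation mu := (@lebesgue_measure R).
Implicit Types (f : R -> R) (z w : R[i]).

Lemma continuous_integrable_itv f (a b : R) : continuous f ->
  mu.-integrable `[a, b] (EFin \o f).
Proof.
move=> cf; apply: continuous_compact_integrable; first exact: segment_compact.
exact: continuous_subspaceT.
Qed.

Lemma Rintegral_affine f (a b c d : R) : 0 < a -> continuous f ->
  \int[mu]_(t in `[a * c + b, a * d + b]) f t =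
  a * \int[mu]_(t in `[c, d]) f (a * t + b).
Proof.
move=> a0 cf; set I := `[a * c + b, a * d + b]%classic.
pose F : measurableTypeR R -> \bar R := (EFin \o f) \_ I.
have mI : measurable (I : set (measurableTypeR R)) by exact: measurable_itv.
have mF : measurable_fun setT F.
  apply/(measurable_restrictT _ _).1 => //.
  apply/measurable_EFinP; apply: measurable_funTS.
  exact: continuous_measurable_fun.
have intF : mu.-integrable setT F.
  by apply/(integrable_mkcond _ mI).1; exact: continuous_integrable_itv.
have mFp := measurable_funepos mF; have mFn := measurable_funeneg mF.
rewrite /Rintegral; set X := (X in _ = a * fine X).
have Xfin : X \is a fin_num.
  have mcd : measurable (`[c, d]%classic : set (measurableTypeR R)) by exact: measurable_itv.
  refine (integrable_fin_num (mu := mu) mcd (f := (fun t : measurableTypeR R => (f (a * t + b))%:E)) _).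
  apply: (@continuous_integrable_itv (fun t => f (a * t + b))) => t.
  apply: (@continuous_comp _ _ _ (fun t => a * t + b)); last exact: cf.
  by apply: cvgD; [apply: cvgM; [exact: cvg_cst|exact: cvg_id]|exact: cvg_cst].
rewrite (_ : a * fine X = fine (a%:E * X)); last by rewrite fineM.
congr fine; rewrite /X integral_mkcond -/F.
rewrite [in RHS]integral_mkcond.
pose G (x : measurableTypeR R) : \bar R := F (a * x + b).
transitivity (a%:E * \int[mu]_x G x)%E; last first.
  congr (_ * _)%E; apply: eq_integral => x _; rewrite /G /F !patchE.
  have -> : (a * x + b \in I) = (x \in `[c, d]%classic).
    apply/idP/idP; rewrite /I !inE/= !in_itv/= => /andP[? ?]; apply/andP.
      by split; rewrite -(ler_pM2l a0) -(lerD2r b).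
    by split; rewrite lerD2r ler_pM2l.
  by case: ifP.
have scale (f1 : measurableTypeR R -> \bar R) : measurable_fun setT f1 ->
    (forall x, 0 <= f1 x)%E ->
    (\int[mu]_x f1 x = a%:E * \int[mu]_x f1 (a * x + b)%R)%E.
  move=> mf1 f10; rewrite (@ge0_integral_affine _ a b _ _ mf1)//.
    by rewrite gtr0_norm.
  by rewrite gt_eqF.
have ep : (\int[mu]_x F^\+ x = a%:E * \int[mu]_x G^\+ x)%E.
  rewrite (scale _ mFp); last by move=> x; rewrite funeposE le_max lexx orbT.
  by congr (_ * _)%E; apply: eq_integral => x _; rewrite /G !funeposE.
have en : (\int[mu]_x F^\- x = a%:E * \int[mu]_x G^\- x)%E.
  rewrite (scale _ mFn); last by move=> x; rewrite funenegE le_max lexx orbT.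
  by congr (_ * _)%E; apply: eq_integral => x _; rewrite /G !funenegE.
rewrite [LHS]integralE ep en [in RHS]integralE.
(* [f] is signed, so the substitution was made on positive and negative parts; finiteness of the
   positive part allows [a] to be factored out of their difference. *)
have := integrable_pos_fin_num measurableT intF; rewrite ep.
move: (\int[mu]_x G^\+ x)%E (\int[mu]_x G^\- x)%E => A B Afin.
rewrite muleBr// fin_num_adde_defr//.
by case: A Afin => // [|]; rewrite ?gt0_muley ?gt0_muleNy ?lte_fin.
Qed.

Lemma Rintegral_split f (a b c : R) : a <= b -> b <= c -> continuous f ->
  \int[mu]_(t in `[a, c]) f t =
  \int[mu]_(t in `[a, b]) f t + \int[mu]_(t in `[b, c]) f t.
Proof.
move=> ab bc cf; have := @Rintegral_itvB _ f (BLeft a) (BRight c) b.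
rewrite !bnd_simp => /(_ (continuous_integrable_itv _ _ cf) ab bc) /eqP.
rewrite subr_eq addrC => /eqP ->; congr (_ + _).
apply: Rintegral_itv_obnd_cbnd.
apply: integrableS (continuous_integrable_itv b c cf);
  [exact: measurable_itv|exact: measurable_itv|exact: subset_itv_oc_cc].
Qed.

Notation mean f := (\int[mu]_(t in `[0, 2 * pi]) f t).

(** After splitting at [pi], the shift exchanges the two half-periods. *)
Lemma mean_shift_pi f : continuous f -> (forall t, f (t + 2 * pi) = f t) ->
  mean (fun t => f (t + pi)) = mean f.
Proof.
move=> cf pf; have p0 := pi_ge0 R.
have cs : continuous (fun t => f (t + pi)).
  move=> t; apply: continuous_comp; last exact: cf.
  by apply: cvgD; [exact: cvg_id|exact: cvg_cst].
rewrite (@Rintegral_split _ 0 pi)//; last by lra.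
rewrite (@Rintegral_split f 0 pi)//; last by lra.
have sh (c d b : R) : \int[mu]_(t in `[c, d]) f (t + b) = \int[mu]_(t in `[c + b, d + b]) f t.
  have := @Rintegral_affine f 1 b c d ltr01 cf; rewrite !mul1r => ->.
  by apply: eq_Rintegral => t _; rewrite mul1r.
have -> : \int[mu]_(t in `[0, pi]) f t = \int[mu]_(t in `[0, pi]) f (t + 2 * pi).
  by apply: eq_Rintegral => t _; rewrite pf.
rewrite !sh !add0r addrC (_ : pi + pi = 2 * pi); last by rewrite mulr_natl.
by rewrite (addrC _ (2 * pi)).
Qed.

Lemma cisD (s t : R) : cis (s + t) = cis s * cis t.
Proof. by rewrite /cis cosD sinD; apply/eqP; rewrite eq_complex/= addrC (mulrC (cos s)) eqxx /= (addrC (sin s * _)) mulrC (mulrC (sin s)) eqxx. Qed.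

Lemma cis_pi : cis pi = -1 :> R[i].
Proof. by rewrite /cis cospi sinpi; apply/eqP; rewrite eq_complex/= oppr0 !eqxx. Qed.

Lemma cis_2pi (t : R) : cis (t + 2 * pi) = cis t.
Proof. by rewrite mulr_natl mulr2n addrA cisD cis_pi cisD cis_pi; ring. Qed.

Lemma continuous_cmod_circle (a l : R[i]) : continuous (fun t : R => cmod (a + l * cis t)).
Proof.
move=> t; case: a l => a1 a2 [l1 l2].
have E s : cmod (a1 +i* a2 + (l1 +i* l2) * cis s) =
   Num.sqrt ((a1 + (l1 * cos s - l2 * sin s)) ^+ 2 + (a2 + (l1 * sin s + l2 * cos s)) ^+ 2) by [].
rewrite /continuous_at E; under eq_fun do rewrite E.
have cc := @continuous_cos R t; have cs := @continuous_sin R t.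
apply: continuous_cvg; first exact: sqrt_continuous.
have cl (u : R) (g : R -> R) : g s @[s --> t] --> g t -> u * g s @[s --> t] --> u * g t.
  by move=> h; apply: cvgM => //; exact: cvg_cst.
have sq (g : R -> R) : g s @[s --> t] --> g t -> g s ^+ 2 @[s --> t] --> g t ^+ 2.
  by move=> h; rewrite expr2; under eq_fun do rewrite expr2; exact: cvgM.
apply: cvgD; apply: (sq (fun s => _ + _)); apply: cvgD; try exact: cvg_cst.
  by apply: cvgB; exact: cl.
by apply: cvgD; exact: cl.
Qed.

End circle_integrals.

Section log_mean.
Context {R : realType}.
Notation mu := (@lebesgue_measure R).
Implicit Types (z w a l : R[i]).
Notation mean f := (\int[mu]_(t in `[0, 2 * pi]) f t).

Lemma cmod_circle_gt0 a l t : cmod l < cmod a -> 0 < cmod (a + l * cis t).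
Proof.
move=> la; rewrite (lt_le_trans _ (ge_cmodD _ _))// cmodM cmod_cis mulr1.
by rewrite subr_gt0.
Qed.

Lemma continuous_ln_circle a l : cmod l < cmod a ->
  continuous (fun t : R => ln (cmod (a + l * cis t))).
Proof.
move=> la t; apply: (@continuous_comp _ _ _ (fun t => cmod (a + l * cis t)) (@ln R)).
  exact: continuous_cmod_circle.
by apply: continuous_ln; exact: cmod_circle_gt0.
Qed.

Lemma mean_cst (c : R) : mean (fun=> c) = 2 * pi * c.
Proof.
have p0 := pi_gt0 R; rewrite Rintegral_cst; last exact: measurable_itv.
rewrite -[RHS]mulrC; congr (_ * _).
rewrite -[LHS]/(fine (mu (`[0, (2 * pi)]%classic : set (measurableTypeR R)))).
by rewrite lebesgue_measure_itv/= lte_fin mulr_gt0//= subr0.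
Qed.

Let f z t := ln (cmod (1 + z * cis t)).

Let cf z : cmod z < 1 -> continuous (f z).
Proof. by move=> z1; apply: continuous_ln_circle; rewrite cmod1. Qed.

Lemma mean_double (g : R -> R) : continuous g -> (forall t, g (t + 2 * pi) = g t) ->
  mean (fun t => g (2 * t)) = mean g.
Proof.
move=> cg pg; have p0 := pi_ge0 R.
have := @Rintegral_affine R g 2 0 0 (2 * pi) (ltr0n _ 2) cg.
rewrite mulr0 !addr0 (@Rintegral_split _ g 0 (2 * pi))//; [|by lra|by lra].
have := @Rintegral_affine R g 1 (2 * pi) 0 (2 * pi) ltr01 cg.
rewrite !mul1r add0r (_ : 2 * pi + 2 * pi = 2 * (2 * pi)); last by ring.
move=> ->.
have -> : mean (fun t => g (1 * t + 2 * pi)) = mean g.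
  by apply: eq_Rintegral => t _; rewrite mul1r pg.
have -> : mean (fun t => g (2 * t + 0)) = mean (fun t => g (2 * t)).
  by apply: eq_Rintegral => t _; rewrite addr0.
lra.
Qed.

(** Duplication: (1 + z e^it)(1 - z e^it) = 1 - z^2 e^2it, and both factors have the same
    logarithmic mean since they differ by a half-period. Iterating this identity replaces an appeal
    to harmonicity. *)
Let mean_f_half z : cmod z < 1 -> mean (f z) = 2^-1 * mean (f (- z ^+ 2)).
Proof.
move=> z1; have fN t : f (- z) t = f z (t + pi).
  by rewrite /f cisD cis_pi mulrN1 mulrN mulNr.
have p w t : f w (t + 2 * pi) = f w t by rewrite /f cis_2pi.
have z21 : cmod (- z ^+ 2) < 1.
  by rewrite cmodN cmodX exprn_ilt1 ?cmod_ge0.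
have Nz1 : cmod (- z) < 1 by rewrite cmodN.
have e : mean (f z) + mean (f (- z)) = mean (f (- z ^+ 2)).
  rewrite -RintegralD//; try exact: measurable_itv;
    try by apply: continuous_integrable_itv; exact: cf.
  rewrite -(mean_double (cf z21) (p _)).
  apply: eq_Rintegral => t _; rewrite /f -lnM ?posrE.
  - rewrite -cmodM; congr (ln (cmod _)).
    by rewrite mulr_natl mulr2n cisD; ring.
  - by apply: cmod_circle_gt0; rewrite cmod1.
  - by apply: cmod_circle_gt0; rewrite cmod1.
have e2 : mean (f (- z)) = mean (f z).
  rewrite -(mean_shift_pi (cf z1) (p _)).
  by apply: eq_Rintegral => t _; exact: fN.
move: e; rewrite e2; lra.
Qed.

Let mean_f_bound z (r : R) : cmod z <= r -> r < 1 ->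
  `|mean (f z)| <= 2 * pi * - ln (1 - r).
Proof.
move=> zr r1; have z1 := le_lt_trans zr r1; have r0 := le_trans (cmod_ge0 z) zr.
have p0 := pi_gt0 R.
have intf : mu.-integrable `[0, 2 * pi] (EFin \o f z).
  by apply: continuous_integrable_itv; exact: cf.
have mJ : measurable (`[0, 2 * pi]%classic : set (measurableTypeR R)) by exact: measurable_itv.
rewrite (le_trans (le_normr_Rintegral mJ intf))//.
rewrite -mean_cst; apply: le_Rintegral.
- exact: measurable_itv.
- exact: (@integrable_norm _ _ _ mu _ (f z)).
- by apply: continuous_integrable_itv => ?; exact: cvg_cst.
move=> t _; have h1 : 1 - r <= cmod (1 + z * cis t).
  rewrite (le_trans _ (ge_cmodD _ _))// cmodM cmod_cis cmod1 mulr1 lerD2l.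
  by rewrite lerN2.
have h2 : cmod (1 + z * cis t) <= 1 + r.
  by rewrite (le_trans (le_cmodD _ _))// cmodM cmod_cis cmod1 mulr1 lerD2l.
have r10 : 0 < 1 - r by lra.
rewrite ler_norml opprK; apply/andP; split.
  by rewrite ler_ln ?posrE// (lt_le_trans r10).
rewrite -lnV ?posrE// ler_ln ?posrE ?invr_gt0// ?(lt_le_trans r10)//.
(* 1 + r <= 1 / (1 - r), so a single constant bounds the logarithm from both sides. *)
by rewrite (le_trans h2)// -[leRHS]mul1r ler_pdivlMr//; nra.
Qed.

(** Each duplication halves the mean while [- z ^+ 2] stays in the disc of radius [r], where all
    means are bounded by [B]. The mean is thus at most B / 2^n for every n. *)
Let mean_f0 z : cmod z < 1 -> mean (f z) = 0.
Proof.
move=> z1; set r := cmod z; set B := 2 * pi * - ln (1 - r).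
have it n : forall w, cmod w <= r -> `|mean (f w)| <= B / 2 ^+ n.
  elim: n => [|n ih] w wr.
    by rewrite expr0 divr1; exact: mean_f_bound.
  rewrite mean_f_half; last exact: le_lt_trans wr z1.
  rewrite normrM ger0_norm// [in leRHS]exprS invfM mulrCA ler_pM2l// ih//.
  rewrite cmodN cmodX (le_trans _ wr)// expr2 ler_piMl ?cmod_ge0//.
  exact/ltW/(le_lt_trans wr).
apply/eqP; rewrite -normr_le0; apply/ler_addgt0Pr => e e0; rewrite add0r.
have B0 : 0 <= B by exact: le_trans (mean_f_bound (lexx _) z1).
have [n nB] : exists n, B / e < 2 ^+ n.
  have Be : 0 <= B / e by rewrite divr_ge0// ltW.
  exists (Num.bound (B / e)); rewrite (lt_trans (archi_boundP Be))//.
  by rewrite -natrX ltr_nat ltn_expl.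
rewrite (le_trans (it n _ (lexx _)))// ler_pdivrMr ?exprn_gt0//.
by rewrite mulrC -ler_pdivrMr// ltW.
Qed.

(** Dividing by [a] reduces to circles about 1. This is harmonicity of log |z| off the origin, in
    the form used later. *)
Lemma mean_ln_cmod a l : cmod l < cmod a ->
  mean (fun t => ln (cmod (a + l * cis t))) = 2 * pi * ln (cmod a).
Proof.
move=> la; have a0 : 0 < cmod a by exact: le_lt_trans (cmod_ge0 _) la.
have a0' : a != 0 by rewrite -cmod_gt0.
have la1 : cmod (l / a) < 1 by rewrite cmodM cmodV ltr_pdivrMr// mul1r.
have p0 := pi_gt0 R.
transitivity (mean (fun t => ln (cmod a) + f (l / a) t)).
  apply: eq_Rintegral => t _.
  have h : 0 < cmod (1 + l / a * cis t) by apply: cmod_circle_gt0; rewrite cmod1.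
  rewrite /f -lnM ?posrE//.
  by rewrite -cmodM; congr (ln (cmod _)); field.
have cc : continuous (fun _ : R => ln (cmod a)) by move=> ?; exact: cvg_cst.
rewrite RintegralD; [|exact: measurable_itv|exact: (continuous_integrable_itv _ _ cc)
  |exact: (continuous_integrable_itv _ _ (cf la1))].
by rewrite mean_f0// addr0 mean_cst.
Qed.

(** Parallelogram law: the squares at opposite points of the circle have a constant sum. The excess
    |l|^2 over the central value is the strict subharmonicity that drives the maximum principle
    [annulus_max]. *)
Lemma mean_cmod_sqr a l :
  mean (fun t => cmod (a + l * cis t) ^+ 2) = 2 * pi * (cmod a ^+ 2 + cmod l ^+ 2).
Proof.
have p0 := pi_gt0 R.
pose c := cmod a ^+ 2 + cmod l ^+ 2.
pose g t := cmod (a + l * cis t) ^+ 2.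
have cg : continuous g.
  by move=> t; rewrite /continuous_at /g !expr2; under eq_fun do rewrite expr2;
    apply: cvgM; exact: continuous_cmod_circle.
have gp t : g t + g (t + pi) = 2 * c.
  rewrite /g cisD cis_pi mulrN1 mulrN !cmod_sqr /c !cmod_sqr.
  case: (a) (l) => a1 a2 [l1 l2] /=; have := cos2Dsin2 t.
  set x := cos t; set y := sin t => xy.
  transitivity (2 * (a1 ^+ 2 + a2 ^+ 2 + (l1 ^+ 2 + l2 ^+ 2) * (x ^+ 2 + y ^+ 2))).
    by ring.
  by rewrite xy; ring.
have cgp : continuous (fun t => g (t + pi)).
  move=> t; apply: (@continuous_comp _ _ _ (fun t => t + pi) g); last exact: cg.
  by apply: cvgD; [exact: cvg_id|exact: cvg_cst].
have e : mean g + mean (fun t => g (t + pi)) = 2 * c * (2 * pi).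
  rewrite -RintegralD//; try exact: measurable_itv;
    try by apply: continuous_integrable_itv.
  by under eq_Rintegral do rewrite gp; rewrite mean_cst mulrC.
move: e; rewrite (mean_shift_pi cg); last by move=> t; rewrite /g cis_2pi.
rewrite -/c -/g; lra.
Qed.

End log_mean.

Section submean.
Context {R : realType}.
Notation mu := (@lebesgue_measure R).
Implicit Types (V H : R[i] -> R) (a l z w : R[i]).
Notation J := (`[0%R, (2 * pi)%R]%classic : set (measurableTypeR R)).
Notation mean f := (\int[mu]_(t in `[0, 2 * pi]) f t).

(* [V] is log-subharmonic at [a] on the circle of radius [|l|]; testing against
   continuous majorants avoids indeterminate forms where [ln V] is [-oo]. *)
Definition submean_at V a l := 0 < V a -> forall g : R -> R, continuous g ->
  (forall t, V (a + l * cis t) <= expR (g t)) ->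
  (\int[mu]_(t in J) ((g t)%:E - lne (V (a + l * cis t))%:E) <=
   (mean g - 2 * pi * ln (V a))%:E)%E.

Lemma measurable_circle a l :
  measurable_fun setT (fun t : measurableTypeR R => uncplx (a + l * cis t)).
Proof.
case: a l => a1 a2 [l1 l2]; have mc := @measurable_cos R; have ms := @measurable_sin R.
apply/measurable_fun_pairP; split; rewrite /comp /=.
  apply: measurable_funD => //; apply: measurable_funB; exact: measurable_funM.
by apply: measurable_funD => //; apply: measurable_funD; exact: measurable_funM.
Qed.

Lemma measurable_lne_comp d (T : measurableType d) (f : T -> R) :
  measurable_fun setT f -> (forall x, 0 <= f x) ->
  measurable_fun setT (fun x => lne (f x)%:E).
Proof.
move=> mf f0; rewrite (_ : (fun _ => _) =
    (fun x => if f x <= 0 then -oo%E else (ln (f x))%:E)).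
  apply: measurable_fun_ifT => //; first exact: measurable_fun_ler.
  by apply/measurable_EFinP; exact: (measurableT_comp (@measurable_ln R)).
apply/funext => x; case: ifPn => [fx|]; first by rewrite le0_lneNy.
by rewrite -ltNge => /lne_EFin ->.
Qed.

Lemma measurable_lne_circle V a l : usc V -> (forall z, 0 <= V z) ->
  measurable_fun setT (fun t : measurableTypeR R => lne (V (a + l * cis t))%:E).
Proof.
move=> uV V0; apply: measurable_lne_comp => //.
have := measurableT_comp (measurable_usc uV) (measurable_circle a l).
by apply: eq_measurable_fun => t _ /=; rewrite uncplxK.
Qed.

Lemma lne_le_EFin (x y : R) : x <= expR y -> (lne x%:E <= y%:E)%E.
Proof.
move=> xy; have [x0|x0] := leP x 0; first by rewrite le0_lneNy// leNye.
by rewrite lne_EFin// lee_fin -(expRK y) ler_ln ?posrE ?expR_gt0.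
Qed.

(** As [V a > 0], the mean inequality bounds the integral of the logarithm from below, while the
    continuous majorant [g] controls its positive part. Hence the logarithm is integrable and can be
    subtracted from [g]. *)
Lemma submean_of_mean V a l : usc V -> (forall z, 0 <= V z) ->
  (lne (V a)%:E <= ((2 * pi)^-1)%:E * \int[mu]_(t in J) lne (V (a + l * cis t))%:E)%E ->
  submean_at V a l.
Proof.
move=> uV V0 Va Va0 g cg Vg; have p0 := pi_gt0 R.
have p20 : 0 < 2 * pi :> R by rewrite mulr_gt0.
set f := fun t : measurableTypeR R => lne (V (a + l * cis t))%:E.
have mJ : measurable J by exact: measurable_itv.
have mf : measurable_fun J f by apply: measurable_funTS; exact: measurable_lne_circle.
have fg t : (f t <= (g t)%:E)%E by exact: lne_le_EFin.
have ig : mu.-integrable J (EFin \o g) by exact: continuous_integrable_itv.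
have {Va} cf : ((2 * pi * ln (V a))%:E <= \int[mu]_(t in J) f t)%E.
  rewrite EFinM -lne_EFin// -lee_pdivlMl//; exact: Va.
have fp : (\int[mu]_(t in J) f^\+ t < +oo)%E.
  apply: le_lt_trans (integral_funepos_lt_pinfty mJ ig).
  apply: ge0_le_integral => //.
  - exact: measurable_funepos.
  - by apply: measurable_funepos; exact: measurable_int ig.
  by move=> t _; rewrite !funeposE ge_max !le_max fg lexx orbT.
have fn : (\int[mu]_(t in J) f^\- t < +oo)%E.
  rewrite ltey; apply: contraTneq cf => fny; rewrite integralE fny.
  by rewrite addeNy// leeNy_eq.
have fi : mu.-integrable J f.
  apply/integrableP; split=> //; under eq_integral do rewrite -/((abse \o f) _).
  rewrite fune_abse ge0_integralD//; first exact: lte_add_pinfty.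
    exact: measurable_funepos.
  exact: measurable_funeneg.
rewrite (_ : (\int[mu]_(t in J) _)%E = (\int[mu]_(t in J) (g t)%:E - \int[mu]_(t in J) f t)%E); last first.
  by rewrite -(integralB mJ ig fi).
rewrite EFinB leeB// /Rintegral fineK//.
exact: (integrable_fin_num mJ ig).
Qed.

End submean.

(** * Growth of maxima and Lelong numbers *)

Section three_circles.
Context {R : realType}.
Notation mu := (@lebesgue_measure R).
Implicit Types (V H : R[i] -> R) (a l z w : R[i]).
Notation J := (`[0%R, (2 * pi)%R]%classic : set (measurableTypeR R)).
Notation mean f := (\int[mu]_(t in `[0, 2 * pi]) f t).

Definition usc_at V z := forall c, V z < c ->
  exists2 d, 0 < d & forall w, cmod (w - z) < d -> V w < c.

Lemma usc_at_mul V1 V2 z : (forall w, 0 <= V1 w) -> (forall w, 0 < V2 w) ->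
  usc_at V1 z -> usc_at V2 z -> usc_at (fun w => V1 w * V2 w) z.
Proof.
move=> V10 V20 u1 u2 c zc; have c0 : 0 < c.
  by rewrite (le_lt_trans _ zc)// mulr_ge0// ltW.
(* Strictly between [V1 z] and [c / V2 z], so that [c'] bounds the first factor near [z] and
   [c / c'] the second. *)
pose c' := (V1 z + c / V2 z) / 2.
have c1 : V1 z < c / V2 z by rewrite ltr_pdivlMr.
have zc' : V1 z < c' by rewrite /c'; lra.
have c'0 : 0 < c' by rewrite (le_lt_trans (V10 z)).
have [d1 d10 h1] := u1 _ zc'.
have [|d2 d20 h2] := u2 (c / c').
  rewrite ltr_pdivlMr// mulrC -ltr_pdivlMr//; rewrite /c'; lra.
exists (Num.min d1 d2); first by rewrite lt_min d10.
move=> w; rewrite lt_min => /andP[/h1 w1 /h2 w2].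
rewrite (@lt_le_trans _ _ (c' * (c / c')))//; last by rewrite mulrC divfK// gt_eqF.
by apply: ltr_pM => //; exact: ltW.
Qed.

Lemma usc_at_cmod (phi : R -> R) a z :
  {for cmod (z - a), continuous phi} -> usc_at (fun w => phi (cmod (w - a))) z.
Proof.
move=> cphi c zc.
have /nbhs_normP[d /= d0 hd] : nbhs (cmod (z - a)) [set s | phi s < c].
  exact: (cvgr_lt (phi (cmod (z - a))) cphi c zc).
exists d => // w wz; apply: hd.
rewrite /ball_/= (le_lt_trans _ wz)// ler_norml.
have h1 := cmod_triangle w z a; have h2 := cmod_triangle z w a.
by move: h2; rewrite (cmodBC z w) => h2; apply/andP; split; lra.
Qed.

Lemma metric_open_setC_annulus z (r1 r3 : R) :
  metric_open (~` [set w | r1 <= cmod (w - z) <= r3]).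
Proof.
move=> w /= /negP; rewrite negb_and -!ltNge => /orP[wr|wr].
  exists (r1 - cmod (w - z)); first by rewrite subr_gt0.
  move=> y yw /andP[y1 _]; have := cmod_triangle y w z; lra.
exists (cmod (w - z) - r3); first by rewrite subr_gt0.
move=> y yw /andP[_ y1]; have := cmod_triangle w y z; rewrite (cmodBC w y); lra.
Qed.

(** Maximum principle against the harmonic function al ln |w - z|. Adding e |w - z|^2 makes log V -
    al ln |w - z| strictly subharmonic: at an interior maximum the sub-mean inequality would fail by
    2 pi e [dl]^2. So the maximum lies on the boundary, where the hypotheses bound it. *)
Lemma annulus_max V z (r1 r3 A al : R) : 0 < r1 -> r1 < r3 ->
  usc V -> (forall w, 0 <= V w) ->
  (forall a, 0 < V a -> r1 < cmod (a - z) < r3 ->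
    exists2 rho : R, 0 < rho & forall l, cmod l <= rho -> submean_at V a l) ->
  (forall w, cmod (w - z) = r1 -> V w <= A * expR (al * ln r1)) ->
  (forall w, cmod (w - z) = r3 -> V w <= A * expR (al * ln r3)) ->
  forall w, r1 <= cmod (w - z) <= r3 -> V w <= A * expR (al * ln (cmod (w - z))).
Proof.
move=> r10 r13 uV V0 sV h1 h3 w0 w0K; rewrite leNgt; apply/negP => w0A.
have p0 := pi_gt0 R.
have r30 := lt_trans r10 r13.
have A0 : 0 <= A.
  have := h1 (z + r1%:C); rewrite addrAC subrr add0r cmod_real gtr0_norm// => /(_ erefl).
  by move/(le_trans (V0 _)); rewrite pmulr_lge0// expR_gt0.
pose s0 := cmod (w0 - z); have s00 : 0 < s0.
  by case/andP: w0K => /(lt_le_trans r10).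
pose B := V w0 * expR (- (al * ln s0)).
have AB : A < B by rewrite /B expRN ltr_pdivlMr// expR_gt0.
(* Room between [A] and the alleged larger value [B]. It absorbs the perturbation e s^2, which is at
   most [x] on the annulus by the choice of [e]. *)
have [x x0 xAB] : exists2 x, 0 < x & A * expR x < B.
  have [->|A00] := eqVneq A 0; first by exists 1; rewrite // mul0r (le_lt_trans A0).
  have A1 : 0 < A by rewrite lt0r A00.
  have BA : 1 < B / A by rewrite ltr_pdivlMr// mul1r.
  exists (ln (B / A) / 2); first by rewrite divr_gt0// ln_gt0.
  rewrite mulrC -ltr_pdivlMr// -[ltRHS](@lnK _ (B / A)) ?posrE ?(lt_trans _ BA)//.
  by rewrite ltr_expR; have := ln_gt0 BA; lra.
pose e := x / r3 ^+ 2; have e0 : 0 < e by rewrite divr_gt0// exprn_gt0.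
have er3 : e * r3 ^+ 2 = x by rewrite divfK// gt_eqF// exprn_gt0.
(* The truncation [Num.max s r1] makes [q] continuous at every [s] and changes nothing on the
   annulus. *)
pose q (s : R) := expR (- (al * ln (Num.max s r1)) + e * s ^+ 2).
pose F w := V w * q (cmod (w - z)).
have cq s : {for s, continuous q}.
  apply: (@continuous_comp _ _ _ (fun s => - (al * ln (Num.max s r1)) + e * s ^+ 2) expR); last exact: continuous_expR.
  apply: cvgD; last first.
    by apply: cvgM; [exact: cvg_cst|exact: exprn_continuous].
  apply: cvgN; apply: cvgM; first exact: cvg_cst.
  apply: (@continuous_comp _ _ _ (fun s => Num.max s r1) (@ln R)); last first.
    by apply: continuous_ln; rewrite lt_max r10 orbT.
  by apply: (@continuous_max _ _ (fun s => s) (fun=> r1)) => ?; [exact: cvg_id|exact: cvg_cst].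
have uF : usc F.
  move=> y; apply: (@usc_at_mul V (fun w => q (cmod (w - z)))) => //.
  - by move=> ?; exact: expR_gt0.
  - exact: uV.
  - exact: usc_at_cmod.
have [||a aK amax] := @usc_max R F [set w | r1 <= cmod (w - z) <= r3] (r3 + cmod z) uF
  (@metric_open_setC_annulus z r1 r3).
- move=> y /= /andP[_ yr]; have := cmod_triangle y z 0; rewrite !subr0; lra.
- by exists w0.
have Fw0 : B <= F w0.
  rewrite /F /B ler_wpM2l// ler_expR -/s0 max_l//; last by case/andP: w0K.
  by rewrite lerDl mulr_ge0// ?sqr_ge0// ltW.
have Fa : A * expR x < F a by rewrite (lt_le_trans xAB)// (le_trans Fw0)// amax.
have Fa0 : 0 < F a by rewrite (le_lt_trans _ Fa)// mulr_ge0// expR_ge0.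
have Va0 : 0 < V a by move: Fa0; rewrite /F pmulr_lgt0// expR_gt0.
set s := cmod (a - z) in aK.
have FaE : V a = F a * expR (al * ln s - e * s ^+ 2).
  rewrite /F -/s /q max_l; last by case/andP: aK.
  by rewrite -mulrA -expRD (_ : _ + _ = 0) ?expR0 ?mulr1//; ring.
have bd (r : R) : s = r -> 0 < r -> r <= r3 -> V a <= A * expR (al * ln r) -> False.
  move=> sr r0 rr3; rewrite FaE sr leNgt => /negP; apply.
  rewrite expRB mulrCA (mulrC A) ltr_pM2l ?expR_gt0// ltr_pdivlMr ?expR_gt0//.
  rewrite (le_lt_trans _ Fa)// ler_wpM2l// ler_expR -er3 ler_pM2l//.
  by rewrite lerXn2r// nnegrE; exact: ltW.
have s1 : r1 < s.
  rewrite lt_neqAle; case/andP: (aK) => -> _; rewrite andbT; apply/eqP => /esym sr.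
  by apply: (bd r1) => //; [exact: ltW|exact: h1].
have s3 : s < r3.
  rewrite lt_neqAle; case/andP: (aK) => _ ->; rewrite andbT; apply/eqP => sr.
  by apply: (bd r3) => //; exact: h3.
have [|rho rho0 sub] := sV a Va0; first by rewrite s1.
pose dl := Num.min rho (Num.min (s - r1) (r3 - s)).
have dl0 : 0 < dl by rewrite !lt_min rho0 !subr_gt0 s1.
have [dl1 dl2 dl3] : [/\ dl <= rho, dl <= s - r1 & dl <= r3 - s].
  by have := lexx dl; rewrite {2}/dl !le_min => /and3P[].
have cl : cmod dl%:C = dl by rewrite cmod_real gtr0_norm.
have cls : cmod dl%:C < cmod (a - z) by rewrite cl -/s; lra.
(* Maximality of [F] at [a] says that [V] is below exp [g] on the small circle. The mean of [g] is
   explicit and falls short of 2 pi ln (V a) by 2 pi e [dl]^2. *)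
pose g t := ln (F a) + (al * ln (cmod (a - z + dl%:C * cis t)) -
   e * cmod (a - z + dl%:C * cis t) ^+ 2).
have cg1 : continuous (fun t => al * ln (cmod (a - z + dl%:C * cis t))).
  by move=> t; apply: cvgM; [exact: cvg_cst|exact: continuous_ln_circle].
have cg2 : continuous (fun t => e * cmod (a - z + dl%:C * cis t) ^+ 2).
  move=> t; apply: cvgM; first exact: cvg_cst.
  apply: (@continuous_comp _ _ _ (fun t => cmod (a - z + dl%:C * cis t)) (fun r => r ^+ 2)).
    exact: continuous_cmod_circle.
  exact: exprn_continuous.
have cg12 : continuous (fun t => al * ln (cmod (a - z + dl%:C * cis t)) -
   e * cmod (a - z + dl%:C * cis t) ^+ 2).
  by move=> t; apply: cvgB; [exact: cg1|exact: cg2].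
have cc : continuous (fun _ : R => ln (F a)) by move=> ?; exact: cvg_cst.
have cg : continuous g by move=> t; apply: cvgD; [exact: cc|exact: cg12].
have mJ : measurable J by exact: measurable_itv.
have mg : mean g = 2 * pi * (ln (F a) + al * ln s - e * (s ^+ 2 + dl ^+ 2)).
  have i1 := continuous_integrable_itv 0 (2 * pi) cg1.
  have i2 := continuous_integrable_itv 0 (2 * pi) cg2.
  have i12 := continuous_integrable_itv 0 (2 * pi) cg12.
  have ic := continuous_integrable_itv 0 (2 * pi) cc.
  rewrite (RintegralD mJ ic i12) mean_cst (RintegralB mJ i1 i2).
  rewrite RintegralZl//; last first.
    by apply: (continuous_integrable_itv 0 (2 * pi)); exact: continuous_ln_circle.
  rewrite RintegralZl//; last first.
    apply: (continuous_integrable_itv 0 (2 * pi)) => t.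
    apply: (@continuous_comp _ _ _ (fun t => cmod (a - z + dl%:C * cis t)) (fun r => r ^+ 2)).
      exact: continuous_cmod_circle.
    exact: exprn_continuous.
  by rewrite mean_ln_cmod// mean_cmod_sqr cl -/s; ring.
have Vg t : V (a + dl%:C * cis t) <= expR (g t).
  set y := a + dl%:C * cis t.
  have yz : a - z + dl%:C * cis t = y - z by rewrite /y addrAC.
  have yK : r1 <= cmod (y - z) <= r3.
    rewrite -yz; have := le_cmodD (a - z) (dl%:C * cis t).
    have := ge_cmodD (a - z) (dl%:C * cis t).
    by rewrite cmodM cmod_cis mulr1 cl -/s => ? ?; apply/andP; split; lra.
  have := amax y yK; rewrite {1}/F /q max_l; last by case/andP: yK.
  rewrite -ler_pdivlMr ?expR_gt0// => /le_trans; apply.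
  rewrite /g yz expRD lnK ?posrE// -expRN ler_wpM2l ?(ltW Fa0)// ler_expR.
  lra.
have := sub dl%:C; rewrite cl => /(_ dl1 Va0 g cg Vg).
rewrite leNgt => /negP; apply; apply: (@lt_le_trans _ _ 0%E).
  rewrite lte_fin mg FaE lnM ?posrE ?expR_gt0// expRK -mulrBr pmulr_rlt0 ?mulr_gt0//.
  have : 0 < e * dl ^+ 2 by rewrite mulr_gt0// exprn_gt0.
  lra.
apply: integral_ge0 => t _; rewrite sube_ge0; first exact: lne_le_EFin.
by rewrite ?orbT.
Qed.

End three_circles.

Section sup_growth.
Context {R : realType}.
Notation mu := (@lebesgue_measure R).
Implicit Types (V H : R[i] -> R) (a l z w : R[i]).
Notation J := (`[0%R, (2 * pi)%R]%classic : set (measurableTypeR R)).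
Notation mean f := (\int[mu]_(t in `[0, 2 * pi]) f t).

Definition Msup V z (r : R) := sup [set V w | w in [set w | cmod (w - z) <= r]].

Lemma Msup_attained V z r : usc V -> 0 <= r ->
  exists y, [/\ cmod (y - z) <= r, Msup V z r = V y &
                forall w, cmod (w - z) <= r -> V w <= V y].
Proof.
move=> uV r0.
have [| | |y yr ymax] := @usc_max R V [set w | cmod (w - z) <= r] (r + cmod z) uV.
- move=> w wr; have [|d d0 hd] := @metric_open_setC_annulus R z 0 r w.
    by move=> /= /andP[_]; exact: wr.
  by exists d => // y yd yr; apply: (hd y yd); rewrite /= cmod_ge0.
- by move=> w /= wr; have := cmod_triangle w z 0; rewrite !subr0; lra.
- by exists z; rewrite /= subrr cmod0.
exists y; split => //; apply/eqP; rewrite eq_le; apply/andP; split.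
  apply: ge_sup; first by exists (V y), y.
  by move=> _ [w wr <-]; exact: ymax.
apply: ub_le_sup; last by exists y.
by exists (V y) => _ [w wr <-]; exact: ymax.
Qed.

Lemma Msup_ge V z r w : usc V -> cmod (w - z) <= r -> V w <= Msup V z r.
Proof.
move=> uV wr; have r0 := le_trans (cmod_ge0 _) wr.
by have [y [_ -> ]] := Msup_attained z uV r0; exact.
Qed.

Lemma Msup_le V z r c : usc V -> 0 <= r ->
  (forall w, cmod (w - z) <= r -> V w <= c) -> Msup V z r <= c.
Proof. by move=> uV r0 Vc; have [y [yr -> _]] := Msup_attained z uV r0; exact: Vc. Qed.

Lemma Msup_sub V z z' r r' : usc V -> 0 <= r -> cmod (z - z') + r <= r' ->
  Msup V z r <= Msup V z' r'.
Proof.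
move=> uV r0 zr; apply: Msup_le => // w wr; apply: Msup_ge => //.
have := cmod_triangle w z z'; lra.
Qed.

(** The radius may depend on the point, and nothing is asked where [V] vanishes. This accommodates
    [twist] below, which is 0 at the origin and satisfies the inequality on discs that avoid it. *)
Definition loc_submean V := forall a, 0 < V a ->
  exists2 rho : R, 0 < rho & forall l, cmod l <= rho -> submean_at V a l.

Section growth.
Variable V : R[i] -> R.
Hypothesis (uV : usc V) (V0 : forall w, 0 <= V w) (sV : loc_submean V).
Hypothesis V_pos : exists w, 0 < V w.

(** If [V] vanished on a disc, comparison on an annulus with a power of |w - z| of large exponent,
    whose inner boundary condition is then free, would make [V] as small as desired at any other
    point. *)
Lemma Msup_gt0 z r : 0 < r -> 0 < Msup V z r.
Proof.
move=> r0; have M0 s : 0 <= s -> 0 <= Msup V z s.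
  by move=> s0; rewrite (le_trans (V0 z))// Msup_ge// subrr cmod0.
rewrite lt0r M0 ?(ltW r0)// andbT; apply/eqP => Mr.
have Vr w : cmod (w - z) <= r -> V w = 0.
  by move=> wr; apply/eqP; rewrite eq_le V0 andbT -Mr Msup_ge.
have [w Vw] := V_pos; pose s := cmod (w - z).
have rs : r < s by rewrite ltNge; apply: contraTN Vw => /Vr ->; rewrite ltxx.
have s0 := lt_trans r0 rs.
pose B := Msup V z (s + 1) + 1; pose c := ln (s + 1) - ln s.
have B0 : 0 < B by rewrite ltr_wpDl// M0//; lra.
have c0 : 0 < c by rewrite subr_gt0 ltr_ln ?posrE//; lra.
(* Makes the resulting bound at [w] equal to V(w) / e. *)
pose al := (ln (B / V w) + 1) / c.
have := @annulus_max R V z r (s + 1) (B * expR (- (al * ln (s + 1)))) al r0.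
have -> : r < s + 1 by lra.
move=> /(_ erefl uV V0 (fun a Va _ => sV Va)) h.
have /h : forall w, cmod (w - z) = r ->
    V w <= B * expR (- (al * ln (s + 1))) * expR (al * ln r).
  by move=> y yr; rewrite Vr ?yr// !mulr_ge0 ?expR_ge0// ltW.
have h3 : forall w, cmod (w - z) = s + 1 ->
    V w <= B * expR (- (al * ln (s + 1))) * expR (al * ln (s + 1)).
  move=> y yr; rewrite -mulrA -expRD addNr expR0 mulr1 /B.
  by rewrite (@le_trans _ _ (Msup V z (s + 1))) ?Msup_ge ?yr// lerDl.
move=> /(_ h3 w); rewrite -/s (ltW rs)/= => /(_ _); rewrite lerDl ler01 => /(_ erefl).
rewrite -mulrA -expRD (_ : - _ + _ = - (al * c)); last by rewrite /c; ring.
rewrite /al divfK ?gt_eqF// opprD expRD expRN lnK ?posrE ?divr_gt0//.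
rewrite invf_div mulrA mulrCA mulfV ?gt_eqF// mulr1 leNgt => /negP; apply.
by rewrite -[ltRHS]mulr1 ltr_pM2l// expR_lt1; lra.
Qed.

Let g z r := ln (Msup V z r).

(** Hadamard's theorem: [A] and [al] interpolate the maxima at [r1] and [r3], and the maximum
    principle compares in between. Since [al >= 0], the bound at [r2] also covers the disc inside
    [r1], as needed for maxima over discs. *)
Lemma three_circles z (r1 r2 r3 : R) : 0 < r1 -> r1 <= r2 -> r2 <= r3 ->
  (ln r3 - ln r1) * (g z r2 - g z r1) <= (g z r3 - g z r1) * (ln r2 - ln r1).
Proof.
move=> r10 r12 r23; have [->|r13] := eqVneq r1 r3.
  rewrite subrr mul0r subrr mul0r//.
have {}r13 : r1 < r3 by rewrite lt_neqAle r13 (le_trans r12).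
have r20 := lt_le_trans r10 r12; have r30 := lt_trans r10 r13.
have L : 0 < ln r3 - ln r1 by rewrite subr_gt0 ltr_ln.
pose al := (g z r3 - g z r1) / (ln r3 - ln r1).
have g13 : g z r1 <= g z r3.
  by rewrite /g ler_ln ?posrE ?Msup_gt0// Msup_sub ?subrr ?cmod0 ?add0r// ltW.
have al0 : 0 <= al by rewrite divr_ge0 ?subr_ge0// ltW// -subr_gt0.
pose A := expR (g z r1 - al * ln r1).
have A1 : A * expR (al * ln r1) = Msup V z r1.
  by rewrite -expRD subrK lnK// posrE Msup_gt0.
have A3 : A * expR (al * ln r3) = Msup V z r3.
  rewrite -expRD -[RHS]lnK ?posrE ?Msup_gt0//; congr expR.
  rewrite -/(g z r3) (_ : g z r3 = g z r1 + al * (ln r3 - ln r1)); first by ring.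
  by rewrite /al divfK ?gt_eqF//; ring.
have := @annulus_max R V z r1 r3 A al r10 r13 uV V0 (fun a Va _ => sV Va).
rewrite A1 A3 => h.
have {}h w : r1 <= cmod (w - z) <= r3 -> V w <= A * expR (al * ln (cmod (w - z))).
  by apply: h => y yr; apply: Msup_ge => //; rewrite yr.
have M2 : Msup V z r2 <= A * expR (al * ln r2).
  apply: Msup_le => // [|w w2]; first exact: ltW.
  have [w1|/ltW w1] := leP (cmod (w - z)) r1.
    rewrite (@le_trans _ _ (Msup V z r1))//; first exact: Msup_ge.
    by rewrite -A1 ler_pM2l ?expR_gt0// ler_expR ler_wpM2l// ler_ln.
  rewrite (le_trans (h _ _)) ?w1 ?(le_trans w2)//.
  rewrite ler_pM2l ?expR_gt0// ler_expR ler_wpM2l// ler_ln ?posrE//.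
  exact: lt_le_trans w1.
have : g z r2 <= g z r1 + al * (ln r2 - ln r1).
  rewrite -ler_expR /g lnK ?posrE ?Msup_gt0// (le_trans M2)//.
  by rewrite -expRD ler_expR /g; lra.
rewrite -lerBlDl -(ler_pM2l L) => /le_trans; apply.
by rewrite mulrA [X in X * _ <= _]mulrC /al divfK// gt_eqF.
Qed.

(** Convexity in ln r without division: both chords are compared with the chord from [a] to [d]. *)
Lemma slope_mono z (a b c d : R) : 0 < a -> a < b -> a <= c -> c < d -> b <= d ->
  (g z b - g z a) * (ln d - ln c) <= (g z d - g z c) * (ln b - ln a).
Proof.
move=> a0 ab ac cd bd; have h1 := three_circles z a0 (ltW ab) bd.
have h2 := three_circles z a0 ac (ltW cd).
have b0 := lt_trans a0 ab; have c0 := lt_le_trans a0 ac; have d0 := lt_trans c0 cd.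
have lab : 0 < ln b - ln a by rewrite subr_gt0 ltr_ln.
have lcd : 0 < ln d - ln c by rewrite subr_gt0 ltr_ln.
have lad : 0 < ln d - ln a.
  by rewrite subr_gt0 ltr_ln// ?posrE//; exact: lt_le_trans bd.
rewrite -(ler_pM2l lad).
have {}h1 := ler_wpM2r (ltW lcd) h1.
have {}h2 : (g z d - g z a) * (ln d - ln c) <= (g z d - g z c) * (ln d - ln a) by nra.
have {}h2 := ler_wpM2r (ltW lab) h2.
nra.
Qed.

(** Doubling a radius always adds ln 2 to its logarithm, so by convexity the gain of ln [Msup] can
    only be smaller at smaller radii. *)
Lemma Msup_doubling z r rho (eta : R) : 0 < r -> r <= rho ->
  Msup V z (2 * rho) <= expR eta * Msup V z rho ->
  Msup V z (2 * r) <= expR eta * Msup V z r.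
Proof.
move=> r0 rr h; have rho0 := lt_le_trans r0 rr.
have r1 : r < 2 * r by lra.
have rho1 : rho < 2 * rho by lra.
have := @slope_mono z r (2 * r) rho (2 * rho) r0 r1 rr rho1.
rewrite !lnM ?posrE// !addrK ler_pM2r ?ln_gt0 ?ltr1n// => /(_ _)/le_trans h'.
have : g z (2 * r) - g z r <= eta.
  apply: h'; first by lra.
  rewrite lerBlDr -ler_expR expRD /g !lnK ?posrE ?Msup_gt0//; lra.
rewrite lerBlDr -ler_expR expRD /g !lnK ?posrE ?Msup_gt0//; lra.
Qed.

End growth.
End sup_growth.

Section lelong_number.
Context {R : realType}.
Notation mu := (@lebesgue_measure R).
Implicit Types (V H : R[i] -> R) (a l z w : R[i]).
Notation J := (`[0%R, (2 * pi)%R]%classic : set (measurableTypeR R)).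
Notation mean f := (\int[mu]_(t in `[0, 2 * pi]) f t).

(** H |z|^(-k). The value 0 at the origin is the limit whenever H = O(|z|^nu) with k < nu, so upper
    semicontinuity survives there. *)
Definition twist (k : R) H z : R :=
  if z == 0 then 0 else H z * expR (- (k * ln (cmod z))).

Lemma twist_ge0 k H : (forall w, 0 <= H w) -> forall w, 0 <= twist k H w.
Proof. by move=> H0 w; rewrite /twist; case: ifP => // _; rewrite mulr_ge0// expR_ge0. Qed.

Lemma twistE k H z : z != 0 -> twist k H z = H z * expR (- (k * ln (cmod z))).
Proof. by rewrite /twist => /negbTE ->. Qed.

(** On a disc avoiding the origin log |z| has the mean value property. Adding k log |z| to the
    majorant therefore shifts its mean and the central value equally and leaves the integrand
    unchanged. *)
Lemma submean_twist k H a l : cmod l < cmod a -> submean_at H a l ->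
  submean_at (twist k H) a l.
Proof.
move=> la sH; have a0 : 0 < cmod a by exact: le_lt_trans (cmod_ge0 _) la.
have na : a != 0 by rewrite -cmod_gt0.
rewrite /submean_at (twistE _ _ na) => Va g cg Vg.
have Ha : 0 < H a by move: Va; rewrite pmulr_lgt0// expR_gt0.
have c0 t : 0 < cmod (a + l * cis t) by exact: cmod_circle_gt0.
pose g1 t := k * ln (cmod (a + l * cis t)).
have cg1 : continuous g1.
  by move=> t; apply: cvgM; [exact: cvg_cst|exact: continuous_ln_circle].
have cgg : continuous (fun t => g t + g1 t).
  by move=> t; apply: cvgD; [exact: cg|exact: cg1].
have Vt t : twist k H (a + l * cis t) = H (a + l * cis t) * expR (- g1 t).
  by rewrite twistE// -cmod_gt0.
have Hg t : H (a + l * cis t) <= expR (g t + g1 t).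
  have := Vg t; rewrite Vt expRN ler_pdivrMr ?expR_gt0//.
  by rewrite expRD.
have mJ : measurable J by exact: measurable_itv.
have := sH Ha _ cgg Hg.
rewrite (RintegralD mJ (continuous_integrable_itv _ _ cg) (continuous_integrable_itv _ _ cg1)).
rewrite (RintegralZl _ mJ (continuous_integrable_itv _ _ (continuous_ln_circle la))).
rewrite mean_ln_cmod// lnM ?posrE ?expR_gt0// expRK => h.
rewrite (_ : mean g - _ = mean g + k * (2 * pi * ln (cmod a)) - 2 * pi * ln (H a)).
  rewrite (le_trans _ h)// le_eqVlt; apply/orP; left; apply/eqP.
  apply: eq_integral => t _; rewrite Vt.
  have [H0|H0] := leP (H (a + l * cis t)) 0.
    by rewrite !le0_lneNy// lee_fin mulr_le0_ge0// expR_ge0.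
  rewrite !lne_EFin ?mulr_gt0 ?expR_gt0// lnM ?posrE ?expR_gt0// expRK.
  by rewrite -!EFinB; congr EFin; ring.
ring.
Qed.

Lemma loc_submean_twist k H : (forall w, 0 <= H w) ->
  (forall a l, submean_at H a l) -> loc_submean (twist k H).
Proof.
move=> H0 sH a Va; have na : a != 0.
  by apply: contraTneq Va => ->; rewrite /twist eqxx ltxx.
have a0 : 0 < cmod a by rewrite cmod_gt0.
exists (cmod a / 2); first by rewrite divr_gt0.
move=> l la; apply: submean_twist; last exact: sH.
by rewrite (le_lt_trans la)//; lra.
Qed.

Lemma usc_twist k (nu C r0 : R) H : usc H -> (forall w, 0 <= H w) -> k < nu -> 0 < r0 ->
  (forall z, cmod z <= r0 -> z != 0 -> H z <= C * expR (nu * ln (cmod z))) ->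
  usc (twist k H).
Proof.
move=> uH H0 knu r00 Hb z; have [->|z0] := eqVneq z 0; last first.
  have cz : 0 < cmod z by rewrite cmod_gt0.
  move=> c Vc.
  have [| |d d0 hd] := @usc_at_mul R H (fun w => expR (- (k * ln (cmod (w - 0))))) z H0
    (fun=> expR_gt0 _) (uH z) _ c.
  - apply: (@usc_at_cmod R (fun r => expR (- (k * ln r)))); rewrite subr0.
    apply: (@continuous_comp _ _ _ (fun r => - (k * ln r)) expR); last exact: continuous_expR.
    by apply: cvgN; apply: cvgM; [exact: cvg_cst|exact: continuous_ln].
  - by rewrite subr0 -twistE.
  exists (Num.min d (cmod z)); first by rewrite lt_min d0.
  move=> w; rewrite lt_min => /andP[wd wz].
  have w0 : w != 0 by apply: contraTneq wz => ->; rewrite sub0r cmodN ltxx.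
  by have := hd _ wd; rewrite subr0 twistE.
move=> c; rewrite {1}/twist eqxx => c0.
pose C' := Num.max C 1; have C'0 : 0 < C' by rewrite lt_max ltr01 orbT.
(* The radius at which C' s^(nu - k) reaches [c]. *)
pose dl := expR (ln (c / C') / (nu - k)).
exists (Num.min dl r0); first by rewrite lt_min expR_gt0.
move=> w; rewrite subr0 lt_min => /andP[wd wr].
have [->|w0] := eqVneq w 0; first by rewrite /twist eqxx.
have cw : 0 < cmod w by rewrite cmod_gt0.
rewrite twistE// (@le_lt_trans _ _ (C' * expR ((nu - k) * ln (cmod w))))//.
  rewrite mulrBl expRB mulrA expRN ler_wpM2r ?invr_ge0 ?expR_ge0//.
  rewrite (le_trans (Hb _ (ltW wr) w0))// ler_wpM2r ?expR_ge0//.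
  by rewrite le_max lexx.
rewrite mulrC -ltr_pdivlMr// -[ltRHS](@lnK _ (c / C')) ?posrE ?divr_gt0// ltr_expR.
rewrite mulrC -ltr_pdivlMr ?subr_gt0//.
by rewrite -ltr_expR lnK.
Qed.

Section lelong.
Variable H : R[i] -> R.
Hypothesis (uH : usc H) (H0 : forall w, 0 <= H w) (sH : forall a l, submean_at H a l).
Hypothesis H_pos : exists w, 0 < H w.

Let loc : loc_submean H.
Proof. by move=> a _; exists 1 => // l _; exact: sH. Qed.

Let g r := ln (Msup H 0 r).

Let M_gt0 r : 0 < r -> 0 < Msup H 0 r.
Proof. exact: Msup_gt0. Qed.

Let g_mono r r' : 0 < r -> r <= r' -> g r <= g r'.
Proof.
move=> r0 rr; rewrite ler_ln ?posrE ?M_gt0//; last exact: lt_le_trans rr.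
by apply: Msup_sub => //; [exact: ltW|rewrite subrr cmod0 add0r].
Qed.

(** The Lelong number is defined by maxima over circles, the growth estimates by maxima over discs;
    the maximum principle identifies them. A larger value at an interior point is excluded at the
    origin by the sub-mean inequality, and elsewhere by comparison on an annulus with a small
    negative power of |w|. *)
Lemma Msup_circle r : 0 < r -> exists2 y, cmod y = r & H y = Msup H 0 r.
Proof.
move=> r0; have p0 := pi_gt0 R.
have [| |y0 y0r y0max] := @usc_max R H [set w | r <= cmod (w - 0) <= r] r uH
   (@metric_open_setC_annulus R 0 r r).
- by move=> z /= /andP[_]; rewrite subr0.
- by exists r%:C; rewrite /= subr0 cmod_real gtr0_norm// lexx.
move: y0r; rewrite /= subr0 -eq_le => /eqP y0r.
exists y0; first by rewrite -y0r.
have [y [yr -> ymax]] := Msup_attained 0 uH (ltW r0); rewrite subr0 in yr.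
apply/eqP; rewrite eq_le ymax ?subr0 -?y0r ?lexx//= leNgt; apply/negP => Hy.
pose S := (H y0 + H y) / 2.
have S0 : 0 < S by rewrite /S; have := H0 y0; lra.
have S1 : H y0 < S by rewrite /S; lra.
have S2 : S < H y by rewrite /S; lra.
have Hy0 : 0 < H y by exact: lt_trans S2.
have circ w : cmod w = r -> H w <= S.
  by move=> wr; rewrite (le_trans (y0max w _)) ?(ltW S1)//= subr0 wr lexx.
have [y00|yn0] := eqVneq y 0.
  have cS : continuous (fun _ : R => ln S) by move=> ?; exact: cvg_cst.
  have := @sH y r%:C Hy0 _ cS; rewrite y00 => /(_ _).
  have h t : H (0 + r%:C * cis t) <= expR (ln S).
    rewrite lnK ?posrE// circ// add0r cmodM cmod_cis mulr1 cmod_real.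
    by rewrite gtr0_norm.
  move=> /(_ h); rewrite leNgt => /negP; apply; apply: (@lt_le_trans _ _ 0%E).
    rewrite mean_cst -mulrBr lte_fin pmulr_rlt0 ?mulr_gt0// subr_lt0 -y00.
    by rewrite ltr_ln ?posrE.
  apply: integral_ge0 => t _; rewrite sube_ge0; first exact: lne_le_EFin.
  by rewrite ?orbT.
have cy : 0 < cmod y by rewrite cmod_gt0.
have yr' : cmod y < r.
  rewrite lt_neqAle yr andbT; apply: contraTneq S2 => /circ.
  by rewrite leNgt.
pose L := ln r - ln (cmod y); have L0 : 0 < L by rewrite subr_gt0 ltr_ln.
pose K := ln (H y) - ln S; have K0 : 0 < K by rewrite subr_gt0 ltr_ln.
(* The comparison function equals H(y) on the inner circle and S on the outer one. As |y| is the
   geometric mean of the two radii, it is the square root of S H(y) at |y|, which is below H(y). *)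
pose e := K / (2 * L).
have eL : e * (2 * L) = K by rewrite divfK// gt_eqF// mulr_gt0.
pose r1 := expR (ln (cmod y) - L).
have r1y : r1 < cmod y by rewrite -[ltRHS]lnK ?posrE// ltr_expR; lra.
have := @annulus_max R H 0 r1 r (S * expR (e * ln r)) (- e) (expR_gt0 _) (lt_trans r1y yr')
  uH H0 (fun a Va _ => loc Va).
have Hexp : S * expR (e * ln r) * expR (- e * ln r1) = H y.
  rewrite -mulrA -expRD expRK (_ : _ + _ = K).
    by rewrite /K expRB !lnK ?posrE// mulrC divfK// gt_eqF.
  by rewrite -eL /L; ring.
move=> /(_ _ _ y); rewrite Hexp subr0 (ltW r1y) yr => h.
have h1 w : cmod (w - 0) = r1 -> H w <= H y.
  by move=> wr; apply: ymax; rewrite wr ltW// (lt_trans r1y).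
have h3 w : cmod (w - 0) = r -> H w <= S * expR (e * ln r) * expR (- e * ln r).
  by rewrite subr0 -mulrA -expRD mulNr subrr expR0 mulr1; exact: circ.
move: (h h1 h3 isT); apply/negP; rewrite -ltNge -mulrA -expRD.
rewrite (_ : _ + _ = K / 2).
  have HS : 0 < H y / S by exact: divr_gt0.
  rewrite mulrC -ltr_pdivlMr// -[ltRHS]lnK ?posrE//.
  by rewrite ltr_expR ln_div ?posrE// -/K; lra.
have -> : e * ln r + - e * ln (cmod y) = e * L by rewrite /L; ring.
move: eL; lra.
Qed.

(* [g] is convex in [ln r]: this is the limit of its slope at [r = 0]. *)
Definition lelong_nb := inf [set x | exists c d : R,
  [/\ 0 < c, c < d & x = (g d - g c) / (ln d - ln c)]].

Let slopes_lb0 : lbound [set x | exists c d : R,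
  [/\ 0 < c, c < d & x = (g d - g c) / (ln d - ln c)]] 0.
Proof.
move=> _ [c [d [c0 cd ->]]]; rewrite divr_ge0 ?subr_ge0 ?g_mono// 1?ltW//.
by rewrite ltr_ln ?posrE// (lt_trans c0).
Qed.

Lemma Msup_ge_slope t t' : 0 < t -> t <= t' ->
  lelong_nb * (ln t' - ln t) <= ln (Msup H 0 t') - ln (Msup H 0 t).
Proof.
move=> t0; rewrite le_eqVlt => /predU1P[<-|tt']; first by rewrite !subrr mulr0.
have t'0 := lt_trans t0 tt'.
have lt : 0 < ln t' - ln t by rewrite subr_gt0 ltr_ln.
rewrite -ler_pdivlMr//; apply: ge_inf; first by exists 0; exact: slopes_lb0.
by exists t, t'; split.
Qed.

(** The slope on some interval from [c] to [d] is within [e] of the infimum, and convexity makes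
    every slope to the left of [c] no larger. *)
Lemma Msup_le_slope (e : R) : 0 < e -> exists2 r0 : R, 0 < r0 &
  forall a b : R, 0 < a -> a <= b -> b <= r0 ->
  ln (Msup H 0 b) - ln (Msup H 0 a) <= (lelong_nb + e) * (ln b - ln a).
Proof.
move=> e0; have hI : has_inf [set x | exists c d : R,
    [/\ 0 < c, c < d & x = (g d - g c) / (ln d - ln c)]].
  split; last by exists 0; exact: slopes_lb0.
  by exists ((g 2 - g 1) / (ln 2 - ln 1)), 1, 2; split => //; rewrite ltr1n.
have [_ [c [d [c0 cd ->]]] xe] := inf_adherent e0 hI.
exists c => // a b a0; rewrite le_eqVlt => /predU1P[<- _|ab bc]; first by rewrite !subrr mulr0.
have ac : a <= c by rewrite ltW// (lt_le_trans ab).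
have bd : b <= d by rewrite (le_trans bc)// ltW.
have lcd : 0 < ln d - ln c by rewrite subr_gt0 ltr_ln ?posrE// (lt_trans c0).
have := slope_mono uH H0 loc H_pos 0 a0 ab ac cd bd.
rewrite -ler_pdivlMr// => /le_trans; apply.
rewrite mulrAC ler_wpM2r; [by []|by rewrite subr_ge0 ler_ln ?posrE// ?ltW// (lt_trans a0)|].
exact: ltW.
Qed.

Lemma lelong_nb_lim : (ln (Msup H 0 r) / ln r) @[r --> 0^'+] --> lelong_nb.
Proof.
apply/cvgrPdist_le => /= e e0.
have e20 : 0 < e / 2 by rewrite divr_gt0.
have [r0 r00 hr0] := Msup_le_slope e20.
pose K2 := ln (Msup H 0 r0) - (lelong_nb + e / 2) * ln r0.
pose K1 := ln (Msup H 0 1).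
(* Once - ln r exceeds [N], the constants in the two linear bounds weigh at most e / 2 after
   division by ln r. *)
pose N := 2 * (`|K1| + `|K2|) / e + 1.
have N0 : 0 < N by rewrite ltr_wpDl// divr_ge0 ?(ltW e0)// mulr_ge0// addr_ge0.
near=> r.
have r_gt0 : 0 < r by near: r; exact: nbhs_right_gt.
have rr0 : r <= r0 by near: r; exact: nbhs_right_le.
have rN : r <= expR (- N) by near: r; apply: nbhs_right_le; exact: expR_gt0.
have lnr : ln r <= - N by rewrite -ler_expR lnK.
have lr0 : ln r < 0 by lra.
have r1 : r <= 1 by rewrite (le_trans rN)// expR_le1; lra.
have h1 := Msup_ge_slope r_gt0 r1; rewrite ln1 in h1.
have h2 := hr0 _ _ r_gt0 rr0 (lexx _).
have hN : 2 * (`|K1| + `|K2|) <= e * - ln r.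
  rewrite -ler_pdivrMl// mulrC; rewrite /N in lnr; lra.
have k1 : - `|K1| <= K1 by rewrite lerNl ler_normr lexx orbT.
have k1' : K1 <= `|K1| by exact: ler_norm.
have k2 : - `|K2| <= K2 by rewrite lerNl ler_normr lexx orbT.
have n1 : 0 <= `|K1| by []. have n2 : 0 <= `|K2| by [].
have K2E : ln (Msup H 0 r) >= K2 + (lelong_nb + e / 2) * ln r by rewrite /K2; lra.
have K1E : ln (Msup H 0 r) <= K1 + lelong_nb * ln r by rewrite /K1; lra.
rewrite ler_distlC; apply/andP; split.
  by rewrite ler_ndivlMr//; lra.
by rewrite ler_ndivrMr//; lra.
Unshelve. all: by end_near. Qed.

Lemma lelong_eq (u : C1 R -> \bar R) z0 :
  (forall l, u (z0 + l) = lne (H l)%:E) -> lelong u z0 = lelong_nb%:E.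
Proof.
move=> uE; apply: cvg_lim => //.
have : (ln (Msup H 0 r) / ln r)%:E @[r --> 0^'+] --> lelong_nb%:E.
  by apply: cvg_EFin; [exact: nearW|exact: lelong_nb_lim].
apply: cvg_trans; apply: near_eq_cvg; near=> r.
have r0 : 0 < r by near: r; exact: nbhs_right_gt.
rewrite EFinM; congr (_ * _)%E; have [y yr Hy] := Msup_circle r0.
apply/eqP; rewrite eq_le; apply/andP; split.
  apply: ereal_sup_ubound; exists y => //.
  by rewrite uE Hy lne_EFin// M_gt0.
apply: ge_ereal_sup => _ [l /= lr <-]; rewrite uE; apply: lne_le_EFin.
by rewrite lnK ?posrE ?M_gt0// Msup_ge// subr0 lr.
Unshelve. all: by end_near. Qed.

End lelong.
End lelong_number.

(** * A dyadic John-Nirenberg inequality *)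

Section squares.
Context {R : realType}.
Notation mu := (@lebesgue_measure R).
Notation mu2 := (@lebesgueR2 R).
Implicit Types (c z : R[i]) (s : R).

(** [s] is half the side. The square is half-open so that it is exactly the disjoint union of its
    four children. *)
Definition sq c s : set (R2 R) :=
  `[(complex.Re c - s), (complex.Re c + s)[%classic `*`
  `[(complex.Im c - s), (complex.Im c + s)[%classic.

Definition subc (b : bool) s : R := if b then s / 2 else - (s / 2).

Definition child c s (b1 b2 : bool) : R[i] :=
  (complex.Re c + subc b1 s) +i* (complex.Im c + subc b2 s).

Lemma measurable_sq c s : measurable (sq c s).
Proof. by apply: measurableX; exact: measurable_itv. Qed.

Lemma mu2_sq c s : 0 <= s -> mu2 (sq c s) = (4 * s ^+ 2)%:E.
Proof.
move=> s0; rewrite /lebesgueR2 /sq product_measure1E; try exact: measurable_itv.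
have h (x : R) : mu (`[(x - s), (x + s)[%classic : set (measurableTypeR R)) = (2 * s)%:E.
  rewrite lebesgue_measure_itv/= lte_fin; case: ltP => xs.
    by rewrite -EFinB; congr EFin; ring.
  by congr EFin; lra.
by rewrite [X in (X * _)%E]h [X in (_ * X)%E]h -EFinM; congr EFin; ring.
Qed.

Lemma ge0_integral_splitP (D P : set (R2 R)) (f : R2 R -> \bar R) :
  measurable D -> measurable P -> measurable_fun setT f -> (forall x, 0 <= f x)%E ->
  (\int[mu2]_(x in D) f x = \int[mu2]_(x in D `&` P) f x + \int[mu2]_(x in D `&` ~` P) f x)%E.
Proof.
move=> mD mP mf f0; rewrite -ge0_integral_setU//.
- by rewrite -setIUr setUv setIT.
- exact: measurableI.
- by apply: measurableI => //; exact: measurableC.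
- exact: measurable_funTS.
- apply/disj_setPS => x [[_ Px] [_ nPx]]; exact: nPx.
Qed.

Lemma measurable_ge1 (r : R) : measurable [set x : R2 R | r <= x.1].
Proof.
have := @measurable_fst _ _ (measurableTypeR R) (measurableTypeR R) measurableT _ (measurable_itv `[r, +oo[).
by rewrite setTI; congr (measurable _); apply/seteqP; split => x /=; rewrite in_itv/= andbT.
Qed.

Lemma measurable_ge2 (r : R) : measurable [set x : R2 R | r <= x.2].
Proof.
have := @measurable_snd _ _ (measurableTypeR R) (measurableTypeR R) measurableT _ (measurable_itv `[r, +oo[).
by rewrite setTI; congr (measurable _); apply/seteqP; split => x /=; rewrite in_itv/= andbT.
Qed.

Lemma sq_child c s x : sq c s x ->
  sq (child c s (complex.Re c <= x.1) (complex.Im c <= x.2)) (s / 2) x.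
Proof.
case=> /=; rewrite !in_itv/= => /andP[? ?] /andP[? ?].
split; rewrite /= in_itv/= /subc; case: ifPn; rewrite -?ltNge => ?; apply/andP; split; lra.
Qed.

Lemma child_sq c s b1 b2 x : 0 < s -> sq (child c s b1 b2) (s / 2) x ->
  [/\ sq c s x, (complex.Re c <= x.1) = b1 & (complex.Im c <= x.2) = b2].
Proof.
move=> s0 []/=; rewrite !in_itv/= /subc => /andP[h1 h2] /andP[h3 h4].
split.
- by split; rewrite /= in_itv/=; case: (b1) h1 h2; case: (b2) h3 h4 => ? ? ? ?; apply/andP; split; lra.
- by case: (b1) h1 h2 => ? ?; [|apply/negbTE; rewrite -ltNge]; lra.
- by case: (b2) h3 h4 => ? ?; [|apply/negbTE; rewrite -ltNge]; lra.
Qed.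

Lemma ge0_integral_sq c s (f : R2 R -> \bar R) : 0 < s ->
  measurable_fun setT f -> (forall x, 0 <= f x)%E ->
  (\int[mu2]_(x in sq c s) f x =
   \int[mu2]_(x in sq (child c s true true) (s / 2)%R) f x +
   \int[mu2]_(x in sq (child c s true false) (s / 2)%R) f x +
  (\int[mu2]_(x in sq (child c s false true) (s / 2)%R) f x +
   \int[mu2]_(x in sq (child c s false false) (s / 2)%R) f x))%E.
Proof.
move=> s0 mf f0; have m1 := measurable_ge1 (complex.Re c).
have m2 := measurable_ge2 (complex.Im c); have mQ := measurable_sq c s.
rewrite (ge0_integral_splitP mQ m1 mf f0); congr (_ + _)%E.
  rewrite (ge0_integral_splitP _ m2 mf f0); last exact: measurableI.
  congr (_ + _)%E; congr integral; apply/seteqP; split => x.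
  - by move=> [[/sq_child + /= h1] h2]; rewrite h1 h2.
  - by case/(child_sq s0) => ? h1 h2; split; [split|]; rewrite //= ?h1 ?h2.
  - by move=> [[/sq_child + /= h1] /negP/negbTE h2]; rewrite h1 h2.
  - by case/(child_sq s0) => ? h1 h2; split; [split|]; rewrite //= ?h1 ?h2.
rewrite (ge0_integral_splitP _ m2 mf f0); last first.
  by apply: measurableI => //; exact: measurableC.
congr (_ + _)%E; congr integral; apply/seteqP; split => x.
- by move=> [[/sq_child + /= /negP/negbTE h1] h2]; rewrite h1 h2.
- by case/(child_sq s0) => ? h1 h2; split; [split|]; rewrite //= ?h1 ?h2.
- by move=> [[/sq_child + /= /negP/negbTE h1] /negP/negbTE h2]; rewrite h1 h2.
- by case/(child_sq s0) => ? h1 h2; split; [split|]; rewrite //= ?h1 ?h2.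
Qed.

Lemma sq_cmod c s x : sq c s x -> cmod (cplx x - c) <= 2 * s.
Proof.
case=> /=; rewrite !in_itv/= => /andP[? ?] /andP[? ?].
rewrite (le_trans (le_cmod_ReIm _))// raddfB/= raddfB/=.
have ? : `|x.1 - complex.Re c| <= s by rewrite ler_norml; apply/andP; split; lra.
have ? : `|x.2 - complex.Im c| <= s by rewrite ler_norml; apply/andP; split; lra.
lra.
Qed.

Lemma cmod_subc (b1 b2 : bool) s : 0 < s -> cmod (subc b1 s +i* subc b2 s) <= s.
Proof.
move=> s0; rewrite cmodE -[leRHS](ger0_norm (ltW s0)) -sqrtr_sqr ler_sqrt ?sqr_ge0//.
by case: b1; case: b2; rewrite /subc; nra.
Qed.

Lemma childE c s b1 b2 : child c s b1 b2 = c + (subc b1 s +i* subc b2 s).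
Proof. by case: c. Qed.

End squares.

Section limn_einf_bounds.
Context {R : realType}.
Implicit Types (u : (\bar R)^nat).

Lemma limn_einfE u : limn_einf u = ereal_sup (range (einfs u)).
Proof. by rewrite limn_einf_lim; apply/cvg_lim => //; exact: cvg_einfs_sup. Qed.

Lemma limn_einf_le u c : (forall n, u n <= c)%E -> (limn_einf u <= c)%E.
Proof.
move=> uc; rewrite limn_einfE; apply: ge_ereal_sup => _ [n _ <-].
by rewrite (le_trans _ (uc n))//; apply: ereal_inf_lbound; exists n => //=.
Qed.

Lemma limn_einf_ge u c N : (forall n, (N <= n)%N -> c <= u n)%E -> (c <= limn_einf u)%E.
Proof.
move=> uc; rewrite limn_einfE; apply: (@le_trans _ _ (einfs u N)).
  by apply: le_ereal_inf_tmp => _ [n /= Nn <-]; exact: uc.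
by apply: ereal_sup_ubound; exists N.
Qed.

End limn_einf_bounds.

(** x^(-p), set to [+oo] at 0 because the inverse of 0 is 0 by convention. *)
Definition npow {R : realType} (p : nat) (x : R) : \bar R :=
  if x == 0 then +oo%E else (x^-1 ^+ p)%:E.

Section john_nirenberg.
Context {R : realType}.
Notation mu := (@lebesgue_measure R).
Notation mu2 := (@lebesgueR2 R).
Implicit Types (c z : R[i]) (s : R).
Variables (V : R[i] -> R) (p : nat) (A eta : R) (good : R[i] -> R -> Prop).
Hypothesis (uV : usc V) (V0 : forall z, 0 <= V z).

(** The disc of radius [2 * s] contains the square, so [w], which is log (L / V), is nonnegative
    there. [eta] bounds the drop of log L from a square to a child and [A] the mean of [w]; both
    must be small against 1 / p. *)
Let L c s := Msup V c (2 * s).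
Let w c s (x : R2 R) : \bar R := ((ln (L c s))%:E - lne (V (cplx x))%:E)%E.

Hypothesis good_gt0 : forall c s, good c s -> 0 < s.
Hypothesis good_child : forall c s b1 b2, good c s -> good (child c s b1 b2) (s / 2).
Hypothesis good_L : forall c s, good c s -> 0 < L c s.
Hypothesis good_ratio : forall c s b1 b2, good c s ->
  L c s <= expR eta * L (child c s b1 b2) (s / 2).
Hypothesis good_mean : forall c s, good c s ->
  (\int[mu2]_(x in sq c s) w c s x <= (A * (4 * s ^+ 2))%:E)%E.
Hypothesis (p_gt0 : (0 < p)%N) (pA : 4 * p%:R * A <= 1) (peta : p%:R * eta <= 2^-1).

Let child_L c s b1 b2 : good c s -> L (child c s b1 b2) (s / 2) <= L c s.
Proof.
move=> gc; have s0 := good_gt0 gc; apply: Msup_sub => //; first lra.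
by rewrite childE addrAC subrr add0r; have := cmod_subc b1 b2 s0; lra.
Qed.

(** The product telescopes to (L / L')^p, where L' belongs to the n-th generation descendant
    selected by [x]. The recursive form allows an induction on the number of generations. *)
Fixpoint G n c s (x : R2 R) : R :=
  if n is n'.+1 then
    let c' := child c s (complex.Re c <= x.1) (complex.Im c <= x.2) in
    (L c s / L c' (s / 2)) ^+ p * G n' c' (s / 2) x
  else 1.

Let L_ge0 c s : 0 <= L c s.
Proof.
have [s0|s0] := leP 0 (2 * s).
  by rewrite (le_trans (V0 c))// Msup_ge// subrr cmod0.
by rewrite /L /Msup (_ : [set _ | _ in _] = set0) ?sup0//; apply/seteqP; split => // _ [z /= zc _];
  have := cmod_ge0 (z - c); lra.
Qed.

Let G_ge0 n c s x : 0 <= G n c s x.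
Proof. by elim: n c s => //= n ih c s; rewrite mulr_ge0 ?exprn_ge0 ?divr_ge0. Qed.

Let measurable_G n c s : measurable_fun setT (G n c s).
Proof.
elim: n c s => [|n ih] c s /=; first exact: measurable_cst.
pose g b1 b2 (x : R2 R) := (L c s / L (child c s b1 b2) (s / 2)) ^+ p * G n (child c s b1 b2) (s / 2) x.
have mg b1 b2 : measurable_fun setT (g b1 b2) by apply: measurable_funM.
rewrite (_ : (fun _ => _) = (fun x => if complex.Re c <= x.1 then
    (if complex.Im c <= x.2 then g true true x else g true false x) else
    (if complex.Im c <= x.2 then g false true x else g false false x))); last first.
  by apply/funext => x /=; case: (_ <= x.1); case: (_ <= x.2).
have b1 : measurable_fun setT (fun x : R2 R => complex.Re c <= x.1) by exact: measurable_fun_ler.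
have b2 : measurable_fun setT (fun x : R2 R => complex.Im c <= x.2) by exact: measurable_fun_ler.
by apply: measurable_fun_ifT => //; apply: measurable_fun_ifT.
Qed.

Let measurable_lneV : measurable_fun setT (fun x : R2 R => lne (V (cplx x))%:E).
Proof. by apply: measurable_lne_comp => //; exact: measurable_usc. Qed.

Let measurable_w c s : measurable_fun setT (w c s).
Proof. by apply: emeasurable_funB => //; exact: measurable_cst. Qed.

Let w_ge0 c s x : good c s -> sq c s x -> (0 <= w c s x)%E.
Proof.
move=> gc xc; rewrite sube_ge0 ?orbT//; apply: lne_le_EFin.
rewrite lnK ?posrE ?good_L// Msup_ge//; exact: sq_cmod.
Qed.

Let I c s := fine (\int[mu2]_(x in sq c s) w c s x).

Let I_fin c s : good c s -> (\int[mu2]_(x in sq c s) w c s x = (I c s)%:E)%E.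
Proof.
move=> gc; rewrite fineK// ge0_fin_numE; first by rewrite (le_lt_trans (good_mean gc)) ?ltry.
by apply: integral_ge0 => x; exact: w_ge0.
Qed.

Let I_ge0 c s : good c s -> 0 <= I c s.
Proof. by move=> gc; rewrite -lee_fin -I_fin//; apply: integral_ge0 => x; exact: w_ge0. Qed.

Let I_le c s : good c s -> I c s <= A * (4 * s ^+ 2).
Proof. by move=> gc; rewrite -lee_fin -I_fin//; exact: good_mean. Qed.

Let D c s b1 b2 := ln (L c s) - ln (L (child c s b1 b2) (s / 2)).

Let D_ge0 c s b1 b2 : good c s -> 0 <= D c s b1 b2.
Proof.
move=> gc; have gc' := good_child b1 b2 gc.
by rewrite subr_ge0 ler_ln ?posrE; [exact: child_L|exact: good_L|exact: good_L].
Qed.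

Let D_le c s b1 b2 : good c s -> D c s b1 b2 <= eta.
Proof.
move=> gc; have gc' := good_child b1 b2 gc.
rewrite lerBlDr -ler_expR expRD !lnK ?posrE ?good_L//; exact: good_ratio.
Qed.

Let s22 s : 4 * (s / 2) ^+ 2 = s ^+ 2. Proof. by field. Qed.

Let I_child c s b1 b2 : good c s ->
  (\int[mu2]_(x in sq (child c s b1 b2) (s / 2)%R) w c s x =
   (I (child c s b1 b2) (s / 2) + D c s b1 b2 * s ^+ 2)%:E)%E.
Proof.
move=> gc; have gc' := good_child b1 b2 gc; have s0 := good_gt0 gc.
have mQ := measurable_sq (child c s b1 b2) (s / 2).
transitivity (\int[mu2]_(x in sq (child c s b1 b2) (s / 2)%R)
   (w (child c s b1 b2) (s / 2)%R x + (D c s b1 b2)%:E))%E.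
  apply: eq_integral => x _; rewrite /w /D.
  case: (lne _) => [r| |]//=; rewrite -?EFinB -?EFinD; congr EFin; ring.
rewrite ge0_integralD//.
- rewrite I_fin// integral_cst// [RHS]EFinD [in RHS]EFinM; congr (_ + _ * _)%E.
  by rewrite -[LHS]/(mu2 (sq (child c s b1 b2) (s / 2))) mu2_sq ?s22//; lra.
- by move=> x; exact: w_ge0.
- exact: measurable_funTS.
- by move=> x _; rewrite lee_fin D_ge0.
Qed.

Let I_split c s : good c s ->
  I c s = I (child c s true true) (s / 2) + D c s true true * s ^+ 2 +
    (I (child c s true false) (s / 2) + D c s true false * s ^+ 2) +
   (I (child c s false true) (s / 2) + D c s false true * s ^+ 2 +
    (I (child c s false false) (s / 2) + D c s false false * s ^+ 2)).
Proof.
move=> gc; have s0 := good_gt0 gc; apply: EFin_inj.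
rewrite -[LHS]I_fin//.
transitivity (
  \int[mu2]_(x in sq (child c s true true) (s / 2)%R) w c s x +
   \int[mu2]_(x in sq (child c s true false) (s / 2)%R) w c s x +
  (\int[mu2]_(x in sq (child c s false true) (s / 2)%R) w c s x +
   \int[mu2]_(x in sq (child c s false false) (s / 2)%R) w c s x))%E; last first.
  by rewrite !I_child// -!EFinD.
(* [w c s] may be negative outside [sq c s], hence the truncation. *)
pose W x := Order.max (w c s x) 0%E.
have mW : measurable_fun setT W by apply: measurable_maxe => //; exact: measurable_cst.
have W0 x : (0 <= W x)%E by rewrite le_max lexx orbT.
have wW B : B `<=` sq c s -> (\int[mu2]_(x in B) w c s x = \int[mu2]_(x in B) W x)%E.
  by move=> Bc; apply: eq_integral => x /[!inE] /Bc xc; rewrite /W max_l// w_ge0.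
rewrite !wW//; first exact: ge0_integral_sq.
all: by move=> x /(child_sq s0)[].
Qed.

(** Let I' and D be the quantities of a child, whose area is s^2. From e^(pD) <= 1 + 2pD and 4p I'
    <= s^2 one gets e^(pD) (s^2 + 4p I') <= s^2 + 4p (I' + D s^2). Here I' + D s^2 is the integral
    of [w c s] over the child, so the four bounds add up to the claim with no loss from one
    generation to the next. *)
Lemma integral_G n c s : good c s ->
  (\int[mu2]_(x in sq c s) (G n c s x)%:E <= (4 * s ^+ 2 + 4 * p%:R * I c s)%:E)%E.
Proof.
elim: n c s => [|n ih] c s gc; have s0 := good_gt0 gc.
  rewrite /= integral_cst; last exact: measurable_sq.
  rewrite mul1e; rewrite -[leLHS]/(mu2 (sq c s)) mu2_sq; last exact: ltW.
  rewrite lee_fin lerDl.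
  by rewrite !mulr_ge0// I_ge0.
rewrite ge0_integral_sq//; last 2 first.
- by apply/measurable_EFinP; exact: measurable_G.
- by move=> x; rewrite lee_fin.
have step b1 b2 : (\int[mu2]_(x in sq (child c s b1 b2) (s / 2)%R) (G n.+1 c s x)%:E <=
    (s ^+ 2 + 4 * p%:R * (I (child c s b1 b2) (s / 2) + D c s b1 b2 * s ^+ 2))%:E)%E.
  have gc' := good_child b1 b2 gc.
  have k0 : 0 <= (L c s / L (child c s b1 b2) (s / 2)) ^+ p.
    by rewrite exprn_ge0// divr_ge0.
  have -> : (\int[mu2]_(x in sq (child c s b1 b2) (s / 2)%R) (G n.+1 c s x)%:E =
     ((L c s / L (child c s b1 b2) (s / 2)) ^+ p)%:E *
      \int[mu2]_(x in sq (child c s b1 b2) (s / 2)%R) (G n (child c s b1 b2) (s / 2) x)%:E)%E.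
    rewrite -ge0_integralZl//.
    - by apply: eq_integral => x /[!inE] /(child_sq s0)[_ e1 e2]; rewrite /= e1 e2 EFinM.
    - exact: measurable_sq.
    - by apply/measurable_EFinP; apply: measurable_funTS; exact: measurable_G.
    - by move=> x _; rewrite lee_fin.
  rewrite (@le_trans _ _ (((L c s / L (child c s b1 b2) (s / 2)) ^+ p)%:E *
     (s ^+ 2 + 4 * p%:R * I (child c s b1 b2) (s / 2))%:E)%E)//.
    by rewrite lee_wpmul2l ?lee_fin//; have := ih _ _ gc'; rewrite s22.
  rewrite -EFinM lee_fin.
  have -> : (L c s / L (child c s b1 b2) (s / 2)) ^+ p = expR (p%:R * D c s b1 b2).
    rewrite expRM_natl /D expRB !lnK ?posrE ?good_L//.
  have D0 := D_ge0 b1 b2 gc; have D1 := D_le b1 b2 gc.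
  have i0 := I_ge0 gc'; have i1 := I_le gc'; rewrite s22 in i1.
  set d := D c s b1 b2 in D0 D1 *; set i := I _ _ in i0 i1 *.
  have p0 : 0 <= p%:R :> R by [].
  have pd0 : 0 <= p%:R * d by rewrite mulr_ge0.
  have pd1 : p%:R * d <= 2^-1 by rewrite (le_trans _ peta)// ler_wpM2l.
  (* Uses x = pD <= 1/2: e^(-x) >= 1 - x and 1 / (1 - x) <= 1 + 2x. *)
  have ex : expR (p%:R * d) <= 1 + 2 * (p%:R * d).
    have x1 : 0 < 1 - p%:R * d by lra.
    rewrite -[leLHS]invrK -expRN (@le_trans _ _ (1 - p%:R * d)^-1)//.
      by rewrite lef_pV2 ?posrE ?expR_gt0//; exact: expR_ge1Dx.
    rewrite -[leRHS]mul1r -ler_pdivrMr; last by lra.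
    rewrite -invfM -[leRHS]invr1 lef_pV2 ?posrE//; nra.
  have s20 : 0 <= s ^+ 2 by rewrite sqr_ge0.
  have i2 : 4 * p%:R * i <= s ^+ 2.
    rewrite (@le_trans _ _ (4 * p%:R * (A * s ^+ 2)))//; first by rewrite ler_wpM2l// mulr_ge0.
    by rewrite mulrA -[leRHS]mul1r ler_wpM2r.
  have i3 : 0 <= s ^+ 2 + 4 * p%:R * i by rewrite addr_ge0// !mulr_ge0.
  apply: (le_trans (ler_wpM2r i3 ex)).
  have := ler_wpM2l pd0 i2; nra.
rewrite [in leRHS]I_split// (@le_trans _ _ _ _ _ (leeD (leeD (step _ _) (step _ _)) (leeD (step _ _) (step _ _))))//.
have addE (x y z t : R) : (x%:E + y%:E + (z%:E + t%:E) = (x + y + (z + t))%:E)%E by [].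
rewrite addE lee_fin; clear step addE ih.
move: (I (child c s true true) (s / 2)) (I (child c s true false) (s / 2))
  (I (child c s false true) (s / 2)) (I (child c s false false) (s / 2)).
move: (D c s true true) (D c s true false) (D c s false true) (D c s false false).
by move=> d1 d2 d3 d4 i1 i2 i3 i4; rewrite le_eqVlt; apply/orP; left; apply/eqP; ring.
Qed.

(** After [n] halvings the half-side is below d / 4. The disc of radius twice the half-side about
    the centre then lies within [d] of [x], so its maximum is at most [T]. *)
Let G_ge T n c s x d : good c s -> 0 < T -> sq c s x ->
  (forall z, cmod (z - cplx x) < d -> V z < T) -> s < 2 ^+ n * (d / 4) ->
  (L c s / T) ^+ p <= G n c s x.
Proof.
move=> gc T0 xc dT; elim: n c s gc xc => [|n ih] c s gc xc sn; have s0 := good_gt0 gc.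
  rewrite /= exprn_ile1 ?divr_ge0 ?(ltW T0)//.
  rewrite ler_pdivrMr// mul1r; apply: Msup_le => //; first by lra.
  move=> z zc; apply/ltW/dT; rewrite expr0 mul1r in sn.
  have := cmod_triangle z c (cplx x); rewrite (cmodBC c).
  have := sq_cmod xc; lra.
set b1 := complex.Re c <= x.1; set b2 := complex.Im c <= x.2.
have gc' := good_child b1 b2 gc; have xc' := sq_child xc.
have := ih _ _ gc' xc'; rewrite -/b1 -/b2 => {}ih /=.
rewrite -/b1 -/b2 (_ : L c s / T =
  (L c s / L (child c s b1 b2) (s / 2)) * (L (child c s b1 b2) (s / 2) / T)).
  rewrite exprMn ler_wpM2l ?exprn_ge0 ?divr_ge0// ih//.
  by move: sn; rewrite exprS; lra.
by rewrite mulrA divfK// gt_eqF// good_L.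
Qed.

(** Upper semicontinuity gives V < T near [x] for every T > V(x). Taking T = 2 V(x) costs the factor
    2^p; where V(x) = 0, letting T tend to 0 makes the limit infinite. *)
Let liminf_G c s x : good c s -> sq c s x ->
  (((L c s / 2) ^+ p)%:E * npow p (V (cplx x)) <=
   limn_einf (fun n => (G n c s x)%:E))%E.
Proof.
move=> gc xc; have s0 := good_gt0 gc; have L0 := good_L gc.
have key T : 0 < T -> V (cplx x) < T ->
    (((L c s / T) ^+ p)%:E <= limn_einf (fun n => (G n c s x)%:E))%E.
  move=> T0 /uV[d d0 dT]; pose N := Num.bound (s / (d / 4)).
  apply: (@limn_einf_ge _ _ _ N) => n Nn; rewrite lee_fin.
  apply: (G_ge gc T0 xc dT); rewrite -ltr_pdivrMr ?divr_gt0//.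
  have sd : 0 <= s / (d / 4) by rewrite divr_ge0 ?(ltW s0)// ltW// divr_gt0.
  rewrite (lt_le_trans (archi_boundP sd))// -natrX ler_nat (leq_trans Nn)// ltnW//.
  exact: ltn_expl.
rewrite /npow; case: eqVneq => [Vx0|Vx].
  rewrite gt0_muley ?lte_fin ?exprn_gt0 ?divr_gt0//.
  case: limn_einf key => [l| |] key; rewrite ?leey//.
    have l0 : 0 <= l.
      have := key 1 ltr01; rewrite Vx0 ltr01 => /(_ erefl); rewrite lee_fin.
      by apply: le_trans; rewrite exprn_ge0// divr1 ltW.
    (* For this [T] the lower bound is (l + 1)^p, which exceeds [l] because p >= 1. *)
    have T0 : 0 < L c s / (l + 1) by rewrite divr_gt0//; lra.
    have := key _ T0; rewrite Vx0 => /(_ T0); rewrite lee_fin leNgt => /negP; case.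
    rewrite invf_div mulrCA mulfV ?mulr1 ?gt_eqF//.
    rewrite (@lt_le_trans _ _ (l + 1))//; first by rewrite ltrDl.
    by rewrite -{1}(expr1 (l + 1)) ler_weXn2l//; lra.
  by have := key 1 ltr01; rewrite Vx0 ltr01 => /(_ erefl); rewrite leeNy_eq.
have V0' : 0 < V (cplx x) by rewrite lt0r Vx V0.
rewrite -EFinM -exprMn (_ : L c s / 2 * (V (cplx x))^-1 = L c s / (2 * V (cplx x))).
  by apply: key; lra.
by field.
Qed.

Lemma measurable_npow n : measurable_fun setT (fun x : R2 R => npow n (V (cplx x))).
Proof.
have mV : measurable_fun setT (fun x : R2 R => V (cplx x)) by exact: measurable_usc.
rewrite /npow; apply: measurable_fun_ifT => //; first exact: measurable_fun_eqr.
apply/measurable_EFinP; apply: measurable_funX.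
rewrite (_ : (fun _ => _) = (fun x => if V (cplx x) == 0 then 0 else expR (- ln (V (cplx x))))).
  apply: measurable_fun_ifT => //; first exact: measurable_fun_eqr.
  apply: (measurableT_comp (@measurable_expR R)); apply: measurable_funN.
  exact: (measurableT_comp (@measurable_ln R)).
apply/funext => x; case: eqVneq => [->|Vx]; first by rewrite invr0.
by rewrite expRN lnK// posrE lt0r Vx V0.
Qed.

Lemma npow_ge0 n (x : R) : 0 <= x -> (0 <= npow n x)%E.
Proof. by move=> x0; rewrite /npow; case: ifP => // _; rewrite lee_fin exprn_ge0// invr_ge0. Qed.

(* By [integral_G] the means of [G n] are bounded uniformly in [n], and [G n]
   eventually dominates [(L c s / T) ^+ p] wherever [V < T]; conclude by Fatou. *)
Lemma john_nirenberg c s : good c s ->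
  (\int[mu2]_(x in sq c s) npow p (V (cplx x)) <=
   (8 * s ^+ 2 * (2 / L c s) ^+ p)%:E)%E.
Proof.
move=> gc; have s0 := good_gt0 gc; have L0 := good_L gc.
have mQ := measurable_sq c s.
have k0 : 0 < (L c s / 2) ^+ p by rewrite exprn_gt0 ?divr_gt0.
rewrite -(@lee_pmul2l _ ((L c s / 2) ^+ p)%:E)// ?lte_fin//.
rewrite -ge0_integralZl//; last 3 first.
- by apply: measurable_funTS; exact: measurable_npow.
- by move=> x _; exact: npow_ge0.
- by rewrite lee_fin ltW.
rewrite -EFinM mulrCA -exprMn (_ : L c s / 2 * (2 / L c s) = 1) ?expr1n ?mulr1; last first.
  by field; rewrite gt_eqF.
apply: (@le_trans _ _ (\int[mu2]_(x in sq c s) limn_einf (fun n => (G n c s x)%:E))%E).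
  apply: ge0_le_integral => //.
  - by move=> x _; rewrite mule_ge0 ?npow_ge0// lee_fin ltW.
  - apply: emeasurable_funM; first exact: measurable_cst.
    by apply: measurable_funTS; exact: measurable_npow.
  - rewrite /limn_einf; apply: measurableT_comp => //.
    apply: measurable_fun_limn_esup => n; apply: measurableT_comp => //.
    by apply/measurable_EFinP; apply: measurable_funTS; exact: measurable_G.
  - by move=> x; exact: liminf_G.
apply: (@le_trans _ _ (limn_einf (fun n => \int[mu2]_(x in sq c s) (G n c s x)%:E))%E).
  apply: fatou => // [n|n x _]; last by rewrite lee_fin.
  by apply/measurable_EFinP; apply: measurable_funTS; exact: measurable_G.
(* 4p I <= 4pA |Q| <= |Q| for the square Q, so the bound is twice the area. *)
apply: limn_einf_le => n; rewrite (le_trans (integral_G n gc))// lee_fin.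
have := I_le gc; have := I_ge0 gc; set i := I c s => i0 i1.
have : 4 * p%:R * i <= 4 * p%:R * (A * (4 * s ^+ 2)) by rewrite ler_wpM2l ?mulr_ge0.
have : 4 * p%:R * A * (4 * s ^+ 2) <= 1 * (4 * s ^+ 2).
  by rewrite ler_wpM2r// mulr_ge0// sqr_ge0.
rewrite mul1r -!mulrA; lra.
Qed.

End john_nirenberg.

(** * Local integrability of negative powers *)

Section power_integrals.
Context {R : realType}.
Notation mu2 := (@lebesgueR2 R).

Definition pdisc (r : R) : set (R2 R) := [set x | 0 < cmod (cplx x) < r].

Lemma measurable_pdisc r : measurable (pdisc r).
Proof.
apply: (@measurable_metric_open R [set z | 0 < cmod z < r]) => z /= /andP[z0 zr].
exists (Num.min (cmod z) (r - cmod z)); first by rewrite lt_min z0 subr_gt0.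
move=> w; rewrite lt_min => /andP[wz wr].
have := cmod_triangle z w 0; have := cmod_triangle w z 0.
by rewrite !subr0 (cmodBC z w) => ? ?; apply/andP; split; lra.
Qed.

Lemma measurable_cmod_cplx : measurable_fun setT (fun x : R2 R => cmod (cplx x)).
Proof.
apply: (@measurable_usc R (fun z => cmod z)) => z c zc.
exists (c - cmod z); first by rewrite subr_gt0.
by move=> w wz; have := cmod_triangle w z 0; rewrite !subr0; lra.
Qed.

Lemma mu2_disc_le (r : R) : 0 <= r -> (mu2 (disc 0%R r) <= (4 * r ^+ 2)%:E)%E.
Proof.
move=> r0; rewrite -(@mu2_sq _ 0)//; apply: le_measure; rewrite ?inE.
- exact: measurable_disc.
- exact: measurable_sq.
move=> x /=; rewrite /disc/= subr0 => xr.
have := le_Re_cmod (cplx x); have := le_Im_cmod (cplx x).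
move=> /le_lt_trans/(_ xr) + /le_lt_trans/(_ xr); rewrite !ltr_norml /=.
by move=> /andP[? ?] /andP[? ?]; split; rewrite /= in_itv/=; apply/andP; split; lra.
Qed.

Lemma disc_pdisc (r : R) (f : R2 R -> \bar R) : measurable_fun setT f -> (forall x, 0 <= f x)%E ->
  (\int[mu2]_(x in disc 0%R r) f x = \int[mu2]_(x in pdisc r) f x)%E.
Proof.
move=> mf f0; pose N : set (R2 R) := [set 0] `*` [set 0].
have mN : measurable N by apply: measurableX.
have N0 : mu2 N = 0%E.
  rewrite /lebesgueR2 /N product_measure1E//.
  by rewrite -[X in (X * _)%E]/(@lebesgue_measure R [set 0]) lebesgue_measure_set1 mul0e.
rewrite (ge0_negligible_integral mN (measurable_disc _ _))//; last exact: measurable_funTS.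
congr integral; apply/seteqP; split => x; rewrite /disc /pdisc /= subr0.
  move=> [xr xN]; rewrite xr andbT cmod_gt0; apply: contra_not_neq xN => x0.
  by move: x0; case: (x) => x1 x2 /eqP; rewrite eq_complex/= => /andP[/eqP -> /eqP ->].
move=> /andP[x0 xr]; split => // -[x1 x2]; move: x0; rewrite /cplx x1 x2.
by rewrite cmodE expr0n addr0 sqrtr0 ltxx.
Qed.

Lemma pdisc_scale (r : R) (f : R2 R -> \bar R) : measurable_fun setT f -> (forall x, 0 <= f x)%E ->
  (\int[mu2]_(x in pdisc (r / 2)%R) f x =
   (2^-1 ^+ 2)%:E * \int[mu2]_(x in pdisc r) f (rot (2^-1)%:C%R x))%E.
Proof.
move=> mf f0; have h2 : cmod (2^-1)%:C = 2^-1 :> R by rewrite cmod_real ger0_norm.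
rewrite integral_mkcond (@ge0_integral_rot _ (2^-1)%:C).
- rewrite h2; congr (_ * _)%E; rewrite [RHS]integral_mkcond; apply: eq_integral => x _.
  rewrite !patchE; congr (if _ then _ else _).
  apply/idP/idP; rewrite !inE /pdisc/= cmod_rot h2 => /andP[? ?]; apply/andP; split; lra.
- by rewrite -cmod_gt0 h2.
- by apply/(measurable_restrictT _ _).1; [exact: measurable_pdisc|exact: measurable_funTS].
- by move=> x; rewrite patchE; case: ifP.
Qed.

(** |x|^(-th) off the origin; the value at the origin is a default, whence the punctured discs. *)
Definition cpow (th : R) (x : R2 R) : R := expR (- (th * ln (cmod (cplx x)))).

Lemma measurable_cpow th : measurable_fun setT (cpow th).
Proof.
apply: (measurableT_comp (@measurable_expR R)); apply: measurable_funN.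
apply: measurable_funM => //.
exact: (measurableT_comp (@measurable_ln R) measurable_cmod_cplx).
Qed.

Lemma cpow_half th x : 0 < cmod (cplx x) ->
  cpow th (rot (2^-1)%:C x) = expR (th * ln 2) * cpow th x.
Proof.
move=> x0; have h2 : cmod (2^-1)%:C = 2^-1 :> R by rewrite cmod_real ger0_norm.
rewrite /cpow cmod_rot h2 lnM ?posrE// lnV ?posrE// -expRD; congr expR.
ring.
Qed.

Lemma annulus_sub (r : R) : 0 < r ->
  (forall x, pdisc (r / 2) x -> pdisc r x).
Proof. by move=> r0 x /andP[? ?]; apply/andP; split; lra. Qed.

(** Halving maps the integral over the disc to a multiple [q] = 2^(th - 2) < 1 of itself, so I <= C
    + q I with [C] bounding the annulus. Truncation at [n] makes I finite, which is needed to solve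
    for it, and Fatou removes the truncation. *)
Lemma integral_cpow_lty (th r : R) : 0 <= th -> th < 2 -> 0 < r ->
  (\int[mu2]_(x in pdisc r) (cpow th x)%:E < +oo)%E.
Proof.
move=> th0 th2 r0; have mP := measurable_pdisc.
pose h n (x : R2 R) : R := Num.min (cpow th x) n%:R.
have mh n : measurable_fun setT (fun x => (h n x)%:E).
  by apply/measurable_EFinP; apply: measurable_minr => //; exact: measurable_cpow.
have h0 n x : 0 <= h n x by rewrite le_min expR_ge0 ler0n.
pose q := expR (th * ln 2) / 4.
have q1 : q < 1.
  rewrite ltr_pdivrMr// mul1r (_ : 4 = expR (2 * ln 2)); last first.
    by rewrite expRM_natl lnK ?posrE//; ring.
  by rewrite ltr_expR ltr_pM2r// ln_gt0// ltr1n.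
have q0 : 0 < q by rewrite divr_gt0 ?expR_gt0.
pose C := expR (- (th * ln (r / 2))) * (4 * r ^+ 2).
have C0 : 0 <= C by rewrite mulr_ge0 ?expR_ge0// mulr_ge0// sqr_ge0.
have pd : (mu2 (pdisc r) <= (4 * r ^+ 2)%:E)%E.
  apply: le_trans (mu2_disc_le (ltW r0)); apply: le_measure; rewrite ?inE//.
    exact: measurable_disc.
  by move=> x /andP[_]; rewrite /disc/= subr0.
have bound n : (\int[mu2]_(x in pdisc r) (h n x)%:E <= (C / (1 - q))%:E)%E.
  set In := integral _ _ _.
  have In0 : (0 <= In)%E by apply: integral_ge0 => x _; rewrite lee_fin.
  have Ioo : (In < +oo)%E.
    apply: (@le_lt_trans _ _ (\int[mu2]_(x in pdisc r) (n%:R)%:E)%E).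
      apply: ge0_le_integral => //; [|exact: measurable_funTS|].
      - by move=> x _; rewrite lee_fin.
      - by move=> x _; rewrite lee_fin ge_min lexx orbT.
    rewrite integral_cst// lte_mul_pinfty// ?lee_fin//.
    by rewrite (le_lt_trans pd)// ltry.
  have split : (In <= C%:E + q%:E * In)%E.
    rewrite {1}/In (@ge0_integral_splitP _ _ (pdisc (r / 2)))//; last first.
      by move=> x; rewrite lee_fin.
    rewrite addeC; apply: leeD.
      apply: (@le_trans _ _ (\int[mu2]_(x in pdisc r `&` ~` pdisc (r / 2)) (expR (- (th * ln (r / 2))))%:E)%E).
        apply: ge0_le_integral => //.
        - by apply: measurableI => //; exact: measurableC.
        - by move=> x _; rewrite lee_fin.
        - exact: measurable_funTS.
        move=> x [/andP[x0 xr] /negP]; rewrite /pdisc/= x0/= -leNgt => xr2.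
        rewrite lee_fin ge_min; apply/orP; left; rewrite ler_expR lerN2.
        by rewrite ler_wpM2l// ler_ln ?posrE//; lra.
      rewrite integral_cst; last by apply: measurableI => //; exact: measurableC.
      rewrite /C EFinM lee_wpmul2l ?lee_fin ?expR_ge0// (le_trans _ pd)//.
      apply: le_measure; rewrite ?inE//; first by apply: measurableI => //; exact: measurableC.
    rewrite (_ : pdisc r `&` _ = pdisc (r / 2)); last first.
      by apply/seteqP; split => [x []//|x xr]; split => //; exact: annulus_sub.
    have hn0 x : (0 <= (h n x)%:E)%E by rewrite lee_fin.
    rewrite (@pdisc_scale r _ (mh n) hn0).
    rewrite /q (mulrC (expR _)) (EFinM 4^-1) -muleA (_ : 2^-1 ^+ 2 = 4^-1 :> R); last by field.
    rewrite lee_wpmul2l ?lee_fin//.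
    have -> : ((expR (th * ln 2))%:E * In =
        \int[mu2]_(x in pdisc r) ((expR (th * ln 2))%:E * (h n x)%:E))%E.
      by rewrite ge0_integralZl//; exact: measurable_funTS.
    have mrh : measurable_fun setT (fun x => (h n (rot (2^-1)%:C x))%:E).
      exact: (measurableT_comp (mh n) (measurable_rot _)).
    apply: ge0_le_integral => //.
    - exact: measurable_funTS.
    - by apply: measurable_funTS; apply: emeasurable_funM; [exact: measurable_cst|exact: (mh n)].
    move=> x /andP[x0 _]; rewrite -EFinM lee_fin /h cpow_half// minr_pMr ?expR_ge0//.
    rewrite le_min !ge_min lexx/=; apply/orP; right.
    rewrite ler_peMl//; have := @ler_expR R 0 (th * ln 2); rewrite expR0 => ->.
    by rewrite mulr_ge0// ln_ge0// ler1n.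
  have Ifin : In \is a fin_num by rewrite ge0_fin_numE.
  move: split; rewrite -(fineK Ifin) -EFinM -EFinD !lee_fin => ii.
  by rewrite ler_pdivlMr; lra.
apply: (@le_lt_trans _ _ (C / (1 - q))%:E); last exact: ltry.
apply: (@le_trans _ _ (\int[mu2]_(x in pdisc r) limn_einf (fun n => (h n x)%:E))%E).
  apply: ge0_le_integral => //.
  - by move=> x _; rewrite lee_fin expR_ge0.
  - by apply/measurable_EFinP; apply: measurable_funTS; exact: measurable_cpow.
  - rewrite /limn_einf; apply: measurableT_comp => //.
    apply: measurable_fun_limn_esup => n; apply: measurableT_comp => //.
    exact: measurable_funTS.
  move=> x _; apply: (@limn_einf_ge _ _ _ (Num.bound (cpow th x))) => n nN.
  rewrite lee_fin le_min lexx/= ltW// (lt_le_trans (archi_boundP _)) ?expR_ge0//.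
  by rewrite ler_nat.
apply: (@le_trans _ _ (limn_einf (fun n => \int[mu2]_(x in pdisc r) (h n x)%:E))%E).
  apply: fatou => // [n|n x _]; last by rewrite lee_fin.
  exact: measurable_funTS.
exact: limn_einf_le.
Qed.

(** At exponent 2 halving preserves the integral. Were it finite, the annulus between r / 2 and r
    would contribute 0, yet it contains a square on which the integrand is bounded below. *)
Lemma integral_cpow2_pinfty (r : R) : 0 < r ->
  (\int[mu2]_(x in pdisc r) (cpow 2 x)%:E = +oo)%E.
Proof.
move=> r0; have mP := measurable_pdisc.
have mc : measurable_fun setT (fun x => (cpow 2 x)%:E).
  by apply/measurable_EFinP; exact: measurable_cpow.
apply/eqP; rewrite -leye_eq leNgt; apply/negP => Ioo.
have c0 x : (0 <= (cpow 2 x)%:E)%E by rewrite lee_fin expR_ge0.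
have half : (\int[mu2]_(x in pdisc (r / 2)) (cpow 2 x)%:E = \int[mu2]_(x in pdisc r) (cpow 2 x)%:E)%E.
  rewrite pdisc_scale// -ge0_integralZl//; last first.
    by apply: measurable_funTS; exact: (measurableT_comp mc (measurable_rot _)).
  apply: eq_integral => x; rewrite inE => /andP[x0 _].
  rewrite -EFinM cpow_half// expRM_natl lnK ?posrE//; congr EFin; by field.
have := @ge0_integral_splitP _ _ _ _ (mP r) (mP (r / 2)) mc c0.
rewrite (_ : pdisc r `&` pdisc (r / 2) = pdisc (r / 2)); last first.
  by apply/seteqP; split => [y []//|y yr]; split => //; exact: annulus_sub.
rewrite half; have Ifin : (\int[mu2]_(x in pdisc r) (cpow 2 x)%:E)%E \is a fin_num.
  by rewrite ge0_fin_numE//; apply: integral_ge0 => x _; exact: c0.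
rewrite -(fineK Ifin); set i := fine _ => e.
have e0 : (\int[mu2]_(x in pdisc r `&` ~` pdisc (r / 2)) (cpow 2 x)%:E = 0)%E.
  move: e; case: (\int[mu2]_(x in _ `&` _) _)%E => [b| |]//=.
  by rewrite -EFinD => /eqP; rewrite eqe => /eqP e'; congr EFin; lra.
(* All points of this square are within r / 8 of 3r / 4, hence between 5r / 8 and 7r / 8 in
   modulus. *)
pose c : R[i] := (3 * r / 4)%:C; pose s := r / 16.
have s0 : 0 < s by rewrite divr_gt0.
have sub : sq c s `<=` pdisc r `&` ~` pdisc (r / 2).
  move=> x xc; have := sq_cmod xc; rewrite /s => h.
  have cc : cmod c = 3 * r / 4 by rewrite cmod_real gtr0_norm//; lra.
  have := ge_cmodD c (cplx x - c); have := le_cmodD c (cplx x - c).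
  rewrite (_ : c + (cplx x - c) = cplx x) ?cc; last by ring.
  move=> h1 h2; split; first by apply/andP; split; lra.
  by apply/negP; rewrite /pdisc/= negb_and -!leNgt; apply/orP; right; lra.
have mD : measurable (pdisc r `&` ~` pdisc (r / 2)).
  by apply: measurableI => //; exact: measurableC.
suff : (0 < \int[mu2]_(x in sq c s) (cpow 2 x)%:E)%E.
  rewrite ltNge => /negP; apply; rewrite -[leRHS]e0.
  apply: ge0_subset_integral => //; first exact: measurable_sq.
  exact: measurable_funTS.
apply: (@lt_le_trans _ _ (\int[mu2]_(x in sq c s) (expR (- (2 * ln r)))%:E)%E).
  rewrite integral_cst; last exact: measurable_sq.
  rewrite -[X in (_ * X)%E]/(mu2 (sq c s)) mu2_sq ?ltW//.
  by rewrite -EFinM lte_fin mulr_gt0 ?expR_gt0// mulr_gt0// exprn_gt0.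
apply: ge0_le_integral => //.
- exact: measurable_sq.
- exact: measurable_funTS.
move=> x /sub[/andP[x0 xr] _]; rewrite lee_fin ler_expR lerN2 ler_pM2l// ler_ln ?posrE//.
exact: ltW.
Qed.

End power_integrals.

Section whitney_bound.
Context {R : realType}.
Notation mu := (@lebesgue_measure R).
Notation mu2 := (@lebesgueR2 R).
Implicit Types (a l z c y : R[i]) (s r : R).
Notation J := (`[0%R, (2 * pi)%R]%classic : set (measurableTypeR R)).
Variable H : R[i] -> R.
Hypothesis (uH : usc H) (H0 : forall w, 0 <= H w) (sH : forall a l, submean_at H a l).
Hypothesis H_pos : exists w, 0 < H w.

Let nu := lelong_nb H.
Let g r := ln (Msup H 0 r).

Let loc : loc_submean H.
Proof. by move=> a _; exists 1 => // l _; exact: sH. Qed.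

Let MH_gt0 r : 0 < r -> 0 < Msup H 0 r.
Proof. exact: Msup_gt0. Qed.

Let gE r : 0 < r -> expR (g r) = Msup H 0 r.
Proof. by move=> r0; rewrite lnK// posrE MH_gt0. Qed.

Lemma H_le_pow z : z != 0 -> cmod z <= 1 ->
  H z <= Msup H 0 1 * expR (nu * ln (cmod z)).
Proof.
move=> z0 z1; have cz : 0 < cmod z by rewrite cmod_gt0.
rewrite (@le_trans _ _ (Msup H 0 (cmod z)))//; first by rewrite Msup_ge// subr0.
rewrite -gE// -gE// -expRD ler_expR.
have := Msup_ge_slope uH H0 sH H_pos cz z1; rewrite ln1 -/(g _) -/(g _) -/nu; lra.
Qed.

Section twisted.
Variable eps : R.
Hypothesis eps0 : 0 < eps.
Let k := nu - eps.
Let V := twist k H.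

Let V0 : forall w, 0 <= V w. Proof. exact: twist_ge0. Qed.

Let uV : usc V.
Proof.
apply: (@usc_twist _ k nu (Msup H 0 1) 1) => //; first by rewrite /k gtrBl.
by move=> z z1 z0; exact: H_le_pow.
Qed.

Let sV : loc_submean V. Proof. exact: loc_submean_twist. Qed.

Let V_pos : exists w, 0 < V w.
Proof.
have [y y1 Hy] := Msup_circle uH H0 sH (@ltr01 R).
exists y; rewrite /V twistE; last by rewrite -cmod_gt0 y1.
by rewrite mulr_gt0 ?expR_gt0// Hy MH_gt0.
Qed.

Let MV_gt0 z r : 0 < r -> 0 < Msup V z r. Proof. exact: Msup_gt0. Qed.

(** An equality: the slopes of [g] are at least nu > k, so s^(-k) times the maximum of H over |w| <=
    s increases with s, and that maximum is attained on the circle. *)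
Let lnMV r : 0 < r -> ln (Msup V 0 r) = g r - k * ln r.
Proof.
move=> r0; rewrite -[RHS]expRK expRD gE// ; congr ln.
apply/eqP; rewrite eq_le; apply/andP; split.
  apply: Msup_le => //; first exact: ltW.
  move=> w; rewrite subr0 => wr; rewrite /V; have [->|w0] := eqVneq w 0.
    by rewrite /twist eqxx mulr_ge0 ?expR_ge0// ltW// MH_gt0.
  rewrite twistE//; have cw : 0 < cmod w by rewrite cmod_gt0.
  rewrite (@le_trans _ _ (Msup H 0 (cmod w) * expR (- (k * ln (cmod w)))))//.
    by rewrite ler_wpM2r ?expR_ge0// Msup_ge// subr0.
  rewrite -!gE// -!expRD ler_expR.
  have := Msup_ge_slope uH H0 sH H_pos cw wr; rewrite -/nu -/(g _) -/(g _).
  have : ln (cmod w) <= ln r by rewrite ler_ln ?posrE.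
  rewrite -subr_ge0 => /(mulr_ge0 (ltW eps0)); rewrite /k; lra.
have [y yr Hy] := Msup_circle uH H0 sH r0.
rewrite -Hy -yr -twistE; last by rewrite -cmod_gt0 yr.
by apply: Msup_ge => //; rewrite subr0 yr.
Qed.

Variable r0 : R.
Hypothesis slope_le : forall a b : R, 0 < a -> a <= b -> b <= r0 ->
  g b - g a <= (nu + eps) * (ln b - ln a).

Let ln3 : ln 3 <= 2 :> R.
Proof. by have := @le_ln1Dx R 2; rewrite (_ : 1 + 2 = 3); [apply; lra|ring]. Qed.

(** The disc of radius 4|c| about [c] contains that of radius 3|c| about 0, and the one of radius
    8|c| lies in that of radius 9|c|. Between 3|c| and 9|c| the log-maximum of V has slope at most
    (nu + eps) - (nu - eps) = 2 eps, and ln 3 <= 2 yields 4 eps. Convexity passes this on to smaller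
    radii. *)
Let doubling c r : c != 0 -> 9 * cmod c <= r0 -> 0 < r -> r <= 4 * cmod c ->
  Msup V c (2 * r) <= expR (4 * eps) * Msup V c r.
Proof.
move=> c0 cr r_gt0 rc; have cc : 0 < cmod c by rewrite cmod_gt0.
apply: (@Msup_doubling _ _ uV V0 sV V_pos c r (4 * cmod c)) => //.
have h1 : Msup V c (2 * (4 * cmod c)) <= Msup V 0 (9 * cmod c).
  by apply: Msup_sub => //; rewrite ?subr0; lra.
have h2 : Msup V 0 (3 * cmod c) <= Msup V c (4 * cmod c).
  by apply: Msup_sub => //; rewrite ?sub0r ?cmodN; lra.
rewrite (le_trans h1)// (@le_trans _ _ (expR (4 * eps) * Msup V 0 (3 * cmod c)))//; last first.
  by rewrite ler_wpM2l// expR_ge0.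
have c3 : 0 < 3 * cmod c by lra.
have c9 : 0 < 9 * cmod c by lra.
rewrite -[leLHS]lnK ?posrE ?MV_gt0// -[Msup V 0 (3 * _)]lnK ?posrE ?MV_gt0//.
rewrite -expRD ler_expR !lnMV//.
have c39 : 3 * cmod c <= 9 * cmod c by lra.
have := slope_le c3 c39 cr.
have e9 : ln (9 * cmod c) = ln 3 + ln (3 * cmod c).
  by rewrite -lnM ?posrE//; congr ln; ring.
rewrite e9 /k; have := ler_wpM2l (ltW eps0) ln3; lra.
Qed.

Let iter_doubling c r n : c != 0 -> 9 * cmod c <= r0 -> 0 < r -> 2 ^+ n * r <= 8 * cmod c ->
  Msup V c (2 ^+ n * r) <= expR (n%:R * (4 * eps)) * Msup V c r.
Proof.
move=> c0 cr r_gt0; elim: n => [|n ih] nr; first by rewrite mul0r expR0 !mul1r.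
have n0 : 0 < 2 ^+ n * r by rewrite mulr_gt0// exprn_gt0.
rewrite exprS -mulrA in nr *.
rewrite (le_trans (doubling c0 cr n0 _))//; first by lra.
have -> : n.+1%:R * (4 * eps) = 4 * eps + n%:R * (4 * eps) by rewrite -natr1; ring.
by rewrite expRD -mulrA ler_wpM2l ?expR_ge0// ih//; lra.
Qed.

Variable p : nat.
Hypotheses (p_gt0 : (0 < p)%N) (p_eps : 800 * p%:R * eps <= 1).

(** Circle means are taken about the point [y] where V attains its maximum [L]: circles of radius
    below 5s stay within 8s of [c], where two doublings give V <= e^(8 eps) L, so the mean of log
    (e^(8 eps) L / V) is at most 8 eps. The disc of radius 5s about [y] contains the square, and its
    area is at most 100 s^2, whence 200 eps. *)
Let mean_bound c s : c != 0 -> 9 * cmod c <= r0 -> 0 < s -> 16 * s <= cmod c ->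
  (\int[mu2]_(x in sq c s) ((ln (Msup V c (2 * s)%R))%:E - lne (V (cplx x))%:E) <=
   (200 * eps * (4 * s ^+ 2))%:E)%E.
Proof.
move=> c0 cr s0 sc; have s20 : 0 < 2 * s by lra.
have [y [yc Ly ymax]] := Msup_attained c uV (ltW s20).
set L := Msup V c (2 * s) in Ly *.
have L0 : 0 < L by rewrite /L MV_gt0.
(* Keeps the origin outside the circles of radius below 5s about [y], as [submean_twist]
   requires. *)
have cy : 14 * s <= cmod y by have := cmod_triangle c y 0; rewrite !subr0 cmodBC; lra.
have M8 w : cmod (w - c) <= 8 * s -> V w <= expR (8 * eps) * L.
  move=> wc; rewrite (@le_trans _ _ (Msup V c (2 ^+ 2 * (2 * s))))//.
    by apply: Msup_ge => //; lra.
  rewrite (le_trans (iter_doubling c0 cr s20 _)) -/L//; first by lra.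
  by rewrite ler_pM2r// ler_expR; lra.
pose W z : \bar R := Order.max ((ln L + 8 * eps)%:E - lne (V z)%:E)%E 0%E.
have mlne : measurable_fun setT (fun x : R2 R => lne (V (cplx x))%:E).
  by apply: measurable_lne_comp => //; exact: measurable_usc.
have mW : measurable_fun setT (fun x : R2 R => W (cplx x)).
  by apply: measurable_maxe => //; apply: emeasurable_funB => //.
have W0 z : (0 <= W z)%E by rewrite le_max lexx orbT.
have L8 z : V z <= expR (8 * eps) * L -> V z <= expR (ln L + 8 * eps).
  by move=> h; rewrite addrC expRD lnK ?posrE.
apply: (@le_trans _ _ (\int[mu2]_(x in sq c s) W (cplx x))%E).
  apply: ge0_le_integral => //.
  - exact: measurable_sq.
  - move=> x xc; rewrite sube_ge0 ?orbT//; apply: lne_le_EFin.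
    by rewrite lnK ?posrE// /L Msup_ge// sq_cmod.
  - by apply: measurable_funTS; apply: emeasurable_funB => //.
  - exact: measurable_funTS.
  by move=> x _; rewrite /W le_max leeB ?lee_fin// lerDl mulr_ge0// ltW.
apply: (@le_trans _ _ (\int[mu2]_(x in disc y (5 * s)) W (cplx x))%E).
  apply: ge0_subset_integral => //.
  - exact: measurable_sq.
  - exact: measurable_disc.
  - exact: measurable_funTS.
  move=> x /sq_cmod xc; rewrite /disc/=; have := cmod_triangle (cplx x) c y.
  by rewrite (cmodBC c y); lra.
have dm : (\int[mu2]_(x in disc y (5 * s)) W (cplx x) <= (8 * eps)%:E * mu2 (disc 0%R (5 * s)%R))%E.
  apply: (@disc_mean R y (5 * s) (8 * eps) W mW W0) => l ls.
  have Vy0 : 0 < V y by rewrite -Ly.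
  have cg : continuous (fun _ : R => ln L + 8 * eps) by move=> ?; exact: cvg_cst.
  have ly : cmod l < cmod y by lra.
  have Vg t : V (y + l * cis t) <= expR (ln L + 8 * eps).
    apply/L8/M8; have := cmod_triangle (y + l * cis t) y c.
    by rewrite (addrC y) addrK cmodM cmod_cis mulr1; lra.
  have := @submean_twist R k H y l ly (@sH y l) Vy0 _ cg Vg.
  rewrite mean_cst -mulrBr -/V -Ly addrAC subrr add0r; apply: le_trans.
  rewrite le_eqVlt; apply/orP; left; apply/eqP; apply: eq_integral => t _.
  by rewrite /W max_l// sube_ge0 ?orbT//; exact: lne_le_EFin.
rewrite (le_trans dm)//; apply: (@le_trans _ _ ((8 * eps)%:E * (4 * (5 * s) ^+ 2)%:E)%E).
  rewrite lee_wpmul2l ?lee_fin//; first by rewrite mulr_ge0// ltW.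
  by apply: mu2_disc_le; rewrite mulr_ge0// ltW.
by rewrite -EFinM lee_fin; nra.
Qed.

Let child_near c s b1 b2 : 0 < s -> cmod (child c s b1 b2 - c) <= s.
Proof. by move=> s0; rewrite childE addrAC subrr add0r cmod_subc. Qed.

(** The constants are A = 200 eps and eta = 8 eps, the latter from two doublings; the condition 4pA
    <= 1 is the origin of 800 p eps <= 1. *)
Let whitney_JN z : z != 0 -> 10 * cmod z <= r0 ->
  (\int[mu2]_(x in sq z (cmod z / 64)) npow p (V (cplx x)) <=
   (8 * (cmod z / 64) ^+ 2 * (2 / Msup V z (2 * (cmod z / 64))) ^+ p)%:E)%E.
Proof.
move=> z0 zr; have cz : 0 < cmod z by rewrite cmod_gt0.
set s0 := cmod z / 64.
have s00 : 0 < s0 by rewrite divr_gt0.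
have zs : cmod z = 64 * s0 by rewrite /s0; field.
(* Says that the disc of radius 2s about [c] stays in the initial disc about [z]. A child moves the
   centre by at most s and halves s, so the condition is inherited, and the origin remains far
   away. *)
pose good c s := 0 < s /\ cmod (c - z) + 2 * s <= 2 * s0.
have near_z c s : good c s -> [/\ c != 0, 9 * cmod c <= r0, 16 * s <= cmod c & 0 < s].
  move=> [s1 cs]; have h1 := cmod_triangle z c 0; have h2 := cmod_triangle c z 0.
  rewrite !subr0 in h1 h2; rewrite (cmodBC z) in h1; have := cmod_ge0 (c - z) => h3.
  by split => //; [rewrite -cmod_gt0|..]; lra.
apply: (@john_nirenberg R V p (200 * eps) (8 * eps) good uV V0) => //.
- by move=> c s [].
- move=> c s b1 b2 [s1 cs]; split; first by lra.
  have := child_near c b1 b2 s1; have := cmod_triangle (child c s b1 b2) c z; lra.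
- by move=> c s [s1 _]; apply: MV_gt0; lra.
- move=> c s b1 b2 gc; have [_ _ _ s1] := near_z _ _ gc.
  set c' := child c s b1 b2.
  have gc' : good c' (s / 2).
    case: gc => _ cs; split; first by lra.
    have := child_near c b1 b2 s1; have := cmod_triangle c' c z; rewrite -/c'; lra.
  have [c'0 c'r c's _] := near_z _ _ gc'.
  rewrite (@le_trans _ _ (Msup V c' (2 ^+ 2 * s)))//.
    apply: Msup_sub => //; first by lra.
    by have := child_near c b1 b2 s1; rewrite -/c' cmodBC; lra.
  rewrite (le_trans (iter_doubling c'0 c'r s1 _))//; first by lra.
  rewrite (_ : 2 * (s / 2) = s); last by field.
  have e8 : 2%:R * (4 * eps) <= 8 * eps by rewrite mulrA -natrM.
  by rewrite ler_wpM2r//; [exact/ltW/MV_gt0|rewrite ler_expR].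
- by move=> c s gc; have [c0 cr cs s1] := near_z _ _ gc; exact: mean_bound.
- by have := p_eps; lra.
- have pe0 : 0 <= p%:R * eps by rewrite mulr_ge0// ltW.
  by have := p_eps; lra.
- by split => //; rewrite subrr cmod0 add0r.
Qed.

(** Lower bound for the maximum of V near [z]: the slope bound is followed from [r0] down to |z|,
    where untwisting leaves 2 eps ln |z|, and six doublings back to radius |z| / 32 lose 24 eps. *)
Let Lz z := expR (g r0 - (nu + eps) * ln r0 - 24 * eps + 2 * eps * ln (cmod z)).

Let L_ge z : z != 0 -> 10 * cmod z <= r0 -> Lz z <= Msup V z (2 * (cmod z / 64)).
Proof.
move=> z0 zr; have cz : 0 < cmod z by rewrite cmod_gt0.
set t := 2 * (cmod z / 64); have t0 : 0 < t by rewrite /t mulr_gt0// divr_gt0.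
have e64 : 2 ^+ 6 * t = 2 * cmod z by rewrite /t; field.
have z9 : 9 * cmod z <= r0 by lra.
have t8 : 2 ^+ 6 * t <= 8 * cmod z by rewrite e64; lra.
have := iter_doubling z0 z9 t0 t8; rewrite e64 (mulrC (expR _)) -ler_pdivrMr ?expR_gt0// => h.
apply: le_trans h; rewrite ler_pdivlMr ?expR_gt0// -expRD.
have h1 : Msup V 0 (cmod z) <= Msup V z (2 * cmod z).
  by apply: Msup_sub => //; rewrite ?sub0r ?cmodN; lra.
apply: le_trans h1; rewrite -[leRHS]lnK ?posrE ?MV_gt0// ler_expR lnMV//.
have zr0 : cmod z <= r0 by lra.
have := slope_le cz zr0 (lexx _); rewrite /k (_ : 6%:R * (4 * eps) = 24 * eps); last by ring.
lra.
Qed.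

(** On the square |x| is comparable to |z| within a factor 2, so the power |x|^q left by untwisting
    is frozen at the cost of 2^|q|. The factor Lz^(-p) contributes |z|^(-2p eps), and q - 2p eps = e
    - p nu - p eps. *)
Lemma whitney_bound (e : nat) : exists2 C : R, 0 < C & forall z, z != 0 -> 10 * cmod z <= r0 ->
  (\int[mu2]_(x in sq z (cmod z / 64))
      ((cmod (cplx x) ^+ e)%:E * npow p (H (cplx x))) <=
   (C * (cmod z ^+ 2 * expR (- ((p%:R * nu - e%:R + p%:R * eps) * ln (cmod z)))))%:E)%E.
Proof.
pose q := e%:R - p%:R * k.
pose K := g r0 - (nu + eps) * ln r0 - 24 * eps.
exists (8 / 64 ^+ 2 * expR (`|q| * ln 2) * 2 ^+ p * expR (- (p%:R * K))).
  by rewrite !mulr_gt0 ?expR_gt0// exprn_gt0.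
move=> z z0 zr; have cz : 0 < cmod z by rewrite cmod_gt0.
set s := cmod z / 64; have s0 : 0 < s by rewrite divr_gt0.
have near x : sq z s x -> cmod z / 2 <= cmod (cplx x) <= 2 * cmod z.
  move=> /sq_cmod; rewrite /s => xz; have := cmod_triangle (cplx x) z 0.
  have := cmod_triangle z (cplx x) 0; rewrite !subr0 (cmodBC z) => ? ?.
  by apply/andP; split; lra.
have mV := measurable_npow uV V0 p.
have mQ := measurable_sq z s.
apply: (@le_trans _ _ (\int[mu2]_(x in sq z s)
    ((expR (q * ln (cmod z) + `|q| * ln 2))%:E * npow p (V (cplx x))))%E).
  apply: ge0_le_integral => //.
  - by move=> x _; rewrite mule_ge0 ?npow_ge0// lee_fin exprn_ge0// cmod_ge0.
  - apply: measurable_funTS; apply: emeasurable_funM; last exact: measurable_npow.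
    by apply/measurable_EFinP; apply: measurable_funX; exact: measurable_cmod_cplx.
  - by apply: measurable_funTS; apply: emeasurable_funM.
  move=> x /near/andP[x1 x2]; have cx : 0 < cmod (cplx x) by lra.
  have x0 : cplx x != 0 by rewrite -cmod_gt0.
  have HV : H (cplx x) = V (cplx x) * expR (k * ln (cmod (cplx x))).
    by rewrite /V twistE// -mulrA -expRD addNr expR0 mulr1.
  have -> : ((cmod (cplx x) ^+ e)%:E * npow p (H (cplx x)) =
      (expR (q * ln (cmod (cplx x))))%:E * npow p (V (cplx x)))%E.
    rewrite /npow HV mulf_eq0 (gt_eqF (expR_gt0 _)) orbF; case: ifP => Vx.
      by rewrite !gt0_muley// lte_fin ?expR_gt0// exprn_gt0.
    rewrite -!EFinM; congr EFin; rewrite invfM exprMn mulrCA mulrC; congr (_ * _).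
    rewrite -expRN -expRM_natl -{1}[cmod (cplx x)]lnK ?posrE// -expRM_natl -expRD.
    by congr expR; rewrite /q; ring.
  rewrite lee_wpmul2r ?npow_ge0// lee_fin ler_expR.
  rewrite -lerBlDl -mulrBr (le_trans (ler_norm _))// normrM ler_wpM2l//.
  have l1 : ln (cmod z) - ln 2 <= ln (cmod (cplx x)).
    by rewrite -ln_div ?posrE// ler_ln ?posrE ?divr_gt0.
  have l2 : ln (cmod (cplx x)) <= ln 2 + ln (cmod z).
    by rewrite -lnM ?posrE// ler_ln ?posrE ?mulr_gt0.
  by rewrite ler_norml; apply/andP; split; lra.
rewrite ge0_integralZl//; last 2 first.
- exact: measurable_funTS.
- by move=> x _; exact: npow_ge0.
apply: (le_trans (lee_wpmul2l _ (whitney_JN z0 zr))); first by rewrite lee_fin expR_ge0.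
rewrite -EFinM lee_fin -/s.
have LL := L_ge z0 zr; have Lz0 : 0 < Lz z by exact: expR_gt0.
have M0 : 0 < Msup V z (2 * s) by exact: lt_le_trans LL.
have : (2 / Msup V z (2 * s)) ^+ p <= (2 / Lz z) ^+ p.
  rewrite lerXn2r ?nnegrE ?divr_ge0 ?(ltW M0) ?(ltW Lz0)//.
  by rewrite ler_pM2l// lef_pV2 ?posrE.
have s2 : 0 <= expR (q * ln (cmod z) + `|q| * ln 2) * (8 * s ^+ 2).
  by rewrite mulr_ge0 ?expR_ge0// mulr_ge0// sqr_ge0.
move=> /(ler_wpM2l s2) h; rewrite [leLHS]mulrA; apply: (le_trans h); clear h.
have -> : (2 / Lz z) ^+ p = 2 ^+ p * (Lz z)^-1 ^+ p by rewrite exprMn.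
rewrite /Lz -expRN -expRM_natl expRD /s expr_div_n.
have -> : expR (p%:R * - (g r0 - (nu + eps) * ln r0 - 24 * eps + 2 * eps * ln (cmod z))) =
   expR (- (p%:R * K)) * expR (- (p%:R * (2 * eps * ln (cmod z)))).
  by rewrite -expRD; congr expR; rewrite /K; ring.
have -> : expR (- ((p%:R * nu - e%:R + p%:R * eps) * ln (cmod z))) =
   expR (q * ln (cmod z)) * expR (- (p%:R * (2 * eps * ln (cmod z)))).
  by rewrite -expRD; congr expR; rewrite /q /k; ring.
by rewrite le_eqVlt; apply/orP; left; apply/eqP; ring.
Qed.

End twisted.
End whitney_bound.

Section local_criterion.
Context {R : realType}.
Notation mu := (@lebesgue_measure R).
Notation mu2 := (@lebesgueR2 R).
Implicit Types (z : R[i]) (r : R).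

(* Tonelli: a point [x] belongs to [sq z (cmod z / 64)] for a set of [z] of
   measure comparable to [cmod x ^+ 2]. *)
Lemma averaging (f : R2 R -> \bar R) (C th r1 : R) :
  measurable_fun setT f -> (forall x, (0 <= f x)%E) -> 0 <= C -> th < 2 ->
  0 < r1 -> r1 <= 1 ->
  (forall z, (0 < cmod z < r1)%R ->
    \int[mu2]_(x in sq z (cmod z / 64)%R) f x <=
      (C * (cmod z ^+ 2 * expR (- (th * ln (cmod z)))))%:E)%E ->
  (\int[mu2]_(x in disc 0%R (r1 / 2)%R) f x < +oo)%E.
Proof.
move=> mf f0 C0 th2 r10 r11 hf; rewrite (disc_pdisc _ mf f0).
pose S : set (R2 R * R2 R) := [set p | pdisc r1 p.1 /\ sq (cplx p.1) (cmod (cplx p.1) / 64) p.2].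
have mc1 : measurable_fun setT (fun p : R2 R * R2 R => cmod (cplx p.1)).
  exact: (measurableT_comp measurable_cmod_cplx measurable_fst).
have m11 : measurable_fun setT (fun p : R2 R * R2 R => p.1.1).
  exact: (measurableT_comp measurable_fst measurable_fst).
have m12 : measurable_fun setT (fun p : R2 R * R2 R => p.1.2).
  exact: (measurableT_comp measurable_snd measurable_fst).
have m21 : measurable_fun setT (fun p : R2 R * R2 R => p.2.1).
  exact: (measurableT_comp measurable_fst measurable_snd).
have m22 : measurable_fun setT (fun p : R2 R * R2 R => p.2.2).
  exact: (measurableT_comp measurable_snd measurable_snd).
have mle (a b : R2 R * R2 R -> R) : measurable_fun setT a -> measurable_fun setT b ->
    measurable [set p | a p <= b p].
  move=> ma mb; have m := measurable_fun_ler ma mb; have := m measurableT [set true] I.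
  by rewrite setTI; congr (measurable _); apply/seteqP; split.
have mlt (a b : R2 R * R2 R -> R) : measurable_fun setT a -> measurable_fun setT b ->
    measurable [set p | a p < b p].
  move=> ma mb; have m := measurable_fun_ltr ma mb; have := m measurableT [set true] I.
  by rewrite setTI; congr (measurable _); apply/seteqP; split.
have ms : measurable_fun setT (fun p : R2 R * R2 R => cmod (cplx p.1) / 64).
  by apply: measurable_funM.
have mS : measurable S.
  rewrite (_ : S = [set p | 0 < cmod (cplx p.1)] `&` [set p | cmod (cplx p.1) < r1] `&`
    ([set p | p.1.1 - cmod (cplx p.1) / 64 <= p.2.1] `&` [set p | p.2.1 < p.1.1 + cmod (cplx p.1) / 64]) `&`
    ([set p | p.1.2 - cmod (cplx p.1) / 64 <= p.2.2] `&` [set p | p.2.2 < p.1.2 + cmod (cplx p.1) / 64])).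
    apply: measurableI; [apply: measurableI; apply: measurableI|apply: measurableI];
      (apply: mle || apply: mlt) => //; (apply: measurable_funB || apply: measurable_funD) => //.
  apply/seteqP; split => -[[z1 z2] [x1 x2]] /=; rewrite /S /pdisc /sq /= !in_itv/=.
    by move=> [/andP[? ?] [/andP[? ?] /andP[? ?]]].
  by move=> [[[-> ->] [-> ->]] [-> ->]].
(* The weight |z|^(-2) compensates the measure, of order |x|^2, of the set of [z] whose square
   contains [x]. *)
pose F (p : R2 R * R2 R) : \bar R := ((\1_S p)%:E * (cpow 2 p.1)%:E * f p.2)%E.
have F0 p : (0 <= F p)%E by rewrite /F mule_ge0// mule_ge0// lee_fin// expR_ge0.
have mF : measurable_fun setT F.
  apply: emeasurable_funM; last exact: (measurableT_comp mf measurable_snd).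
  apply: emeasurable_funM; first by apply/measurable_EFinP; exact: measurable_indic.
  by apply/measurable_EFinP; exact: (measurableT_comp (measurable_cpow 2) measurable_fst).
(* Only |z| < 1 occurs, so raising the exponent to a nonnegative one keeps the upper bound and meets
   the hypothesis of [integral_cpow_lty]. *)
pose th' := Num.max th 0.
have th'0 : 0 <= th' by rewrite le_max lexx orbT.
have th'2 : th' < 2 by rewrite gt_max th2 ltr0n.
have up : (\int[mu2]_z \int[mu2]_x F (z, x) < +oo)%E.
  apply: (@le_lt_trans _ _ (C%:E * \int[mu2]_(z in pdisc r1) (cpow th' z)%:E)%E); last first.
    by rewrite lte_mul_pinfty// ?lee_fin//; exact: integral_cpow_lty.
  rewrite -ge0_integralZl//; last 3 first.
  - exact: measurable_pdisc.
  - by apply/measurable_EFinP; apply: measurable_funTS; exact: measurable_cpow.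
  - by move=> x _; rewrite lee_fin expR_ge0.
  rewrite [leRHS]integral_mkcond; apply: ge0_le_integral => //.
  - by move=> z _; exact: integral_ge0.
  - exact: measurable_fun_fubini_tonelli_F.
  - apply/(measurable_restrictT _ _).1 => //; first exact: measurable_pdisc.
    apply: emeasurable_funM; first exact: measurable_cst.
    by apply/measurable_EFinP; apply: measurable_funTS; exact: measurable_cpow.
  move=> z _; rewrite patchE; case: ifPn => [|]; rewrite ?inE ?notin_setE => zr; last first.
    rewrite (_ : (\int[mu2]_x _)%E = 0%E)// -[RHS](integral0 mu2 setT).
    by apply: eq_integral => x _; rewrite /F indicE memNset ?mul0e// => -[].
  have z0 : 0 < cmod (cplx z) by case/andP: zr.
  have -> : (\int[mu2]_x F (z, x) = (cpow 2 z)%:E * \int[mu2]_(x in sq (cplx z) (cmod (cplx z) / 64)%R) f x)%E.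
    rewrite -ge0_integralZl//; last 3 first.
    - exact: measurable_sq.
    - exact: measurable_funTS.
    - by rewrite lee_fin expR_ge0.
    rewrite [RHS]integral_mkcond; apply: eq_integral => x _; rewrite patchE /F /= indicE.
    case: ifPn => [|]; rewrite ?inE ?notin_setE => xz.
      by rewrite mem_set// mul1e.
    by rewrite memNset ?mul0e// => -[].
  apply: (le_trans (lee_wpmul2l _ (hf (cplx z) zr))); first by rewrite lee_fin expR_ge0.
  rewrite -!EFinM lee_fin mulrCA ler_wpM2l// /cpow mulrA.
  rewrite -{2}[cmod (cplx z)]lnK ?posrE// -expRM_natl -expRD addNr expR0 mul1r.
  rewrite ler_expR lerN2 ler_wnM2r//; first by rewrite ln_le0// (le_trans _ r11)// ltW//; case/andP: zr.
  by rewrite le_max lexx.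
move: up; rewrite (@fubini_tonelli _ _ _ _ _ mu2 mu2 F)// => up.
rewrite ltey; apply: contraTneq up => foo; rewrite -leNgt leye_eq -leye_eq.
(* The square of half-side X / 100 has area 4 (X / 100)^2, and on it the weight is at least
   (2X)^(-2); the product is [kap]. *)
pose kap : R := 100^-1 ^+ 2; have k0 : 0 < kap by rewrite exprn_gt0.
have -> : (+oo = kap%:E * \int[mu2]_(x in pdisc (r1 / 2)%R) f x)%E.
  by rewrite foo gt0_muley// lte_fin.
rewrite -ge0_integralZl//; last 3 first.
- exact: measurable_pdisc.
- exact: measurable_funTS.
- by rewrite lee_fin ltW.
rewrite integral_mkcond; apply: ge0_le_integral => //.
- by move=> x _; rewrite patchE; case: ifP => // _; rewrite mule_ge0// lee_fin ltW.
- apply/(measurable_restrictT _ _).1 => //; first exact: measurable_pdisc.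
  apply: measurable_funTS; apply: emeasurable_funM => //; exact: measurable_cst.
- exact: measurable_fun_fubini_tonelli_G.
move=> x _; rewrite patchE; case: ifPn => [|_]; last by exact: integral_ge0.
rewrite inE => /andP[x0 xr]; set X := cmod (cplx x) in x0 xr *.
have -> : (\int[mu2]_z F (z, x) = \int[mu2]_z ((\1_S (z, x))%:E * (cpow 2 z)%:E) * f x)%E.
  rewrite -ge0_integralZr//.
  - apply: emeasurable_funM; last by apply/measurable_EFinP; exact: measurable_cpow.
    apply/measurable_EFinP; apply: (measurableT_comp (measurable_indic mS)).
    exact: (pair2_measurable x).
  - by move=> z _; rewrite mule_ge0// lee_fin// expR_ge0.
rewrite lee_wpmul2r//.
pose s := X / 100; have s0 : 0 < s by rewrite divr_gt0.
(* Here |z| >= 0.98 X, so |z| / 64 > X / 100 and membership can be reversed. *)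
have sub (z : R2 R) : sq (cplx x) s z -> S (z, x) /\ cmod (cplx z) <= 2 * X.
  move=> zs; have := sq_cmod zs; rewrite /s => zx.
  have h1 := cmod_triangle (cplx z) (cplx x) 0; have h2 := cmod_triangle (cplx x) (cplx z) 0.
  rewrite !subr0 (cmodBC (cplx x) (cplx z)) -/X in h1 h2.
  split; last by lra.
  split; first by apply/andP; split => /=; lra.
  move: zs => []/=; rewrite !in_itv/= => /andP[a1 a2] /andP[a3 a4].
  by rewrite /s in a1 a2 a3 a4; split; rewrite /= in_itv/=; apply/andP; split; lra.
apply: (@le_trans _ _ (\int[mu2]_(z in sq (cplx x) s) (expR (- (2 * ln (2 * X))))%:E)%E).
  rewrite integral_cst; last exact: measurable_sq.
  rewrite -[X in (_ * X)%E]/(mu2 (sq (cplx x) s)) mu2_sq; last exact: ltW.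
  rewrite -EFinM lee_fin.
  rewrite expRN expRM_natl lnK ?posrE ?mulr_gt0// /s /kap.
  by rewrite le_eqVlt; apply/orP; left; apply/eqP; field; rewrite gt_eqF.
rewrite integral_mkcond; apply: ge0_le_integral => //.
- by move=> z _; rewrite patchE; case: ifP => // _; rewrite lee_fin expR_ge0.
- apply/(measurable_restrictT _ _).1 => //; first exact: measurable_sq.
- apply: emeasurable_funM; last by apply/measurable_EFinP; exact: measurable_cpow.
  apply/measurable_EFinP; apply: (measurableT_comp (measurable_indic mS)).
  exact: (pair2_measurable x).
move=> z _; rewrite patchE; case: ifPn => [|_]; last by rewrite mule_ge0// lee_fin// expR_ge0.
rewrite inE => /sub[zS zX]; rewrite indicE mem_set// mul1e lee_fin ler_expR lerN2.
rewrite ler_pM2l// ler_ln ?posrE ?mulr_gt0//.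
by case: zS => /andP[].
Qed.

Variable H : R[i] -> R.
Hypothesis (uH : usc H) (H0 : forall w, 0 <= H w) (sH : forall a l, submean_at H a l).
Hypothesis H_pos : exists w, 0 < H w.
Variables (e p : nat).
Hypothesis p_gt0 : (0 < p)%N.

Let f (x : R2 R) : \bar R := ((cmod (cplx x) ^+ e)%:E * npow p (H (cplx x)))%E.

Let f_ge0 x : (0 <= f x)%E.
Proof. by rewrite mule_ge0 ?npow_ge0// lee_fin exprn_ge0// cmod_ge0. Qed.

Let mf : measurable_fun setT f.
Proof.
apply: emeasurable_funM; last exact: measurable_npow.
by apply/measurable_EFinP; apply: measurable_funX; exact: measurable_cmod_cplx.
Qed.

Lemma local_sufficient : p%:R * lelong_nb H < e%:R + 2 ->
  exists2 r : R, 0 < r & (\int[mu2]_(x in disc 0%R r) f x < +oo)%E.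
Proof.
set nu := lelong_nb H => hnu.
have p0 : 0 < p%:R :> R by rewrite ltr0n.
have [N N0 NE] : exists2 N : R, 0 < N & N = 800 * p%:R.
  exists (800 * p%:R); last by [].
  by apply: mulr_gt0; [rewrite ltr0n; exact: isT|exact: p0].
(* The first term keeps p nu - e + p eps below 2, using the strict inequality; the second is the
   smallness required by [whitney_bound]. *)
pose eps := Num.min ((e%:R + 2 - p%:R * nu) / (2 * p%:R)) N^-1.
have eps0 : 0 < eps.
  rewrite lt_min invr_gt0 N0 andbT; apply: divr_gt0; first by rewrite subr_gt0.
  exact: mulr_gt0.
have e1 : p%:R * eps <= (e%:R + 2 - p%:R * nu) / 2.
  rewrite mulrC -ler_pdivlMr//; rewrite /eps ge_min; apply/orP; left.
  by rewrite invfM mulrA.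
have e2 : 800 * p%:R * eps <= 1.
  by rewrite -NE mulrC -ler_pdivlMr// mul1r /eps ge_min lexx orbT.
have [r0 r00 sl] := Msup_le_slope uH H0 sH H_pos eps0.
have [C C0 hC] := whitney_bound uH H0 sH H_pos eps0 sl p_gt0 e2 e.
pose r1 := Num.min (r0 / 10) 1.
have r10 : 0 < r1 by rewrite lt_min divr_gt0//=.
exists (r1 / 2); first by rewrite divr_gt0.
apply: (@averaging f C _ r1 mf f_ge0 (ltW C0) _ r10 _ _); last 2 first.
- by rewrite ge_min lexx orbT.
- move=> z /andP[z0 zr]; apply: hC; first by rewrite -cmod_gt0.
  have : cmod z < r0 / 10 by rewrite (lt_le_trans zr)// ge_min lexx.
  lra.
rewrite -/nu; lra.
Qed.

Lemma local_necessary r : 0 < r -> e%:R + 2 <= p%:R * lelong_nb H ->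
  (\int[mu2]_(x in disc 0%R r) f x = +oo)%E.
Proof.
move=> r0; set nu := lelong_nb H => hnu.
rewrite (disc_pdisc _ mf f_ge0); apply/eqP; rewrite -leye_eq.
(* The growth bound [H_le_pow] is available for |z| <= 1, and the integral already diverges on the
   smaller disc. *)
pose r1 := Num.min r 1; have r10 : 0 < r1 by rewrite lt_min r0 ltr01.
pose M := Msup H 0 1; have M0 : 0 < M.
  have loc : loc_submean H by move=> a _; exists 1 => // l _; exact: sH.
  exact: Msup_gt0.
have -> : (+oo = (M^-1 ^+ p)%:E * \int[mu2]_(x in pdisc r1) (cpow 2 x)%:E)%E.
  by rewrite integral_cpow2_pinfty// gt0_muley// lte_fin exprn_gt0// invr_gt0.
have mp := measurable_pdisc.
rewrite -ge0_integralZl//; last 3 first.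
- by apply/measurable_EFinP; apply: measurable_funTS; exact: measurable_cpow.
- by move=> x _; rewrite lee_fin expR_ge0.
- by rewrite lee_fin exprn_ge0// invr_ge0 ltW.
apply: (@le_trans _ _ (\int[mu2]_(x in pdisc r1) f x)%E); last first.
  apply: ge0_subset_integral => //; first exact: measurable_funTS.
  by move=> x /andP[x0]; rewrite lt_min => /andP[xr _]; apply/andP.
apply: ge0_le_integral => //.
- by move=> x _; rewrite mule_ge0// lee_fin ?expR_ge0// exprn_ge0// invr_ge0 ltW.
- apply: measurable_funTS; apply: emeasurable_funM; first exact: measurable_cst.
  by apply/measurable_EFinP; exact: measurable_cpow.
- exact: measurable_funTS.
move=> x /andP[x0]; rewrite lt_min => /andP[_ x1].
rewrite /f /npow; case: eqVneq => [_|Hx].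
  by rewrite gt0_muley ?leey// lte_fin exprn_gt0.
have z0 : cplx x != 0 by rewrite -cmod_gt0.
have Hx0 : 0 < H (cplx x) by rewrite lt0r Hx H0.
have := H_le_pow uH H0 sH H_pos z0 (ltW x1); rewrite -/M -/nu => HM.
rewrite -!EFinM lee_fin.
apply: (@le_trans _ _ (cmod (cplx x) ^+ e * (M * expR (nu * ln (cmod (cplx x))))^-1 ^+ p)); last first.
  rewrite ler_wpM2l ?exprn_ge0 ?cmod_ge0// lerXn2r ?nnegrE ?invr_ge0 ?(ltW Hx0) ?mulr_ge0 ?expR_ge0 ?(ltW M0)//.
  by rewrite lef_pV2 ?posrE// mulr_gt0 ?expR_gt0.
rewrite invfM exprMn mulrCA ler_wpM2l ?exprn_ge0 ?invr_ge0 ?(ltW M0)//.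
rewrite -{1}[cmod (cplx x)]lnK ?posrE// -expRN -!expRM_natl -expRD /cpow ler_expR.
have lx : ln (cmod (cplx x)) <= 0 by rewrite ln_le0// ltW.
by nra.
Qed.

End local_criterion.

(** * Slicing by lines through the origin *)

Section slice.
Context {R : realType}.
Notation mu2 := (@lebesgueR2 R).
Implicit Types (y : R2 R).

Lemma measurable_inv_ge0 d (T : measurableType d) (f : T -> R) :
  (forall x, 0 <= f x) -> measurable_fun setT f -> measurable_fun setT (fun x => (f x)^-1).
Proof.
move=> f0 mf; rewrite (_ : (fun _ => _) = (fun x => if f x == 0 then 0 else expR (- ln (f x)))).
  apply: measurable_fun_ifT => //; first exact: measurable_fun_eqr.
  apply: (measurableT_comp (@measurable_expR R)); apply: measurable_funN.
  exact: (measurableT_comp (@measurable_ln R)).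
apply/funext => x; case: eqVneq => [->|fx]; first by rewrite invr0.
by rewrite expRN lnK// posrE lt0r fx f0.
Qed.

(** The affine coordinate of the complex line through a point. It is 0 by convention when the second
    coordinate vanishes, hence the guards in the integrals below. *)
Definition quot (p : R2 R * R2 R) : R2 R := uncplx (cplx p.1 / cplx p.2).

Lemma measurable_quot : measurable_fun setT quot.
Proof.
have m11 : measurable_fun setT (fun p : R2 R * R2 R => p.1.1).
  exact: (measurableT_comp measurable_fst measurable_fst).
have m12 : measurable_fun setT (fun p : R2 R * R2 R => p.1.2).
  exact: (measurableT_comp measurable_snd measurable_fst).
have m21 : measurable_fun setT (fun p : R2 R * R2 R => p.2.1).
  exact: (measurableT_comp measurable_fst measurable_snd).
have m22 : measurable_fun setT (fun p : R2 R * R2 R => p.2.2).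
  exact: (measurableT_comp measurable_snd measurable_snd).
have mN : measurable_fun setT (fun p : R2 R * R2 R => (p.2.1 ^+ 2 + p.2.2 ^+ 2)^-1).
  apply: measurable_inv_ge0; first by move=> p; rewrite addr_ge0// sqr_ge0.
  by apply: measurable_funD; apply: measurable_funX.
have E p : quot p = ((p.1.1 * p.2.1 + p.1.2 * p.2.2) * (p.2.1 ^+ 2 + p.2.2 ^+ 2)^-1,
   (p.1.2 * p.2.1 - p.1.1 * p.2.2) * (p.2.1 ^+ 2 + p.2.2 ^+ 2)^-1).
  case: p => -[a b] [c d]; rewrite /quot /uncplx /cplx /= /GRing.inv/=.
  by congr pair; ring.
apply/measurable_fun_pairP; split.
  rewrite (_ : fst \o _ = (fun p => (p.1.1 * p.2.1 + p.1.2 * p.2.2) * (p.2.1 ^+ 2 + p.2.2 ^+ 2)^-1)).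
    by apply: measurable_funM => //; apply: measurable_funD; apply: measurable_funM.
  by apply/funext => p; rewrite /comp E.
rewrite (_ : snd \o _ = (fun p => (p.1.2 * p.2.1 - p.1.1 * p.2.2) * (p.2.1 ^+ 2 + p.2.2 ^+ 2)^-1)).
  by apply: measurable_funM => //; apply: measurable_funB; apply: measurable_funM.
by apply/funext => p; rewrite /comp E.
Qed.

Lemma measurable_neq0 : measurable_fun setT (fun x : R2 R => cplx x != 0).
Proof.
rewrite (_ : (fun _ => _) = (fun x : R2 R => 0 < cmod (cplx x))).
  by apply: measurable_fun_ltr => //; exact: measurable_cmod_cplx.
by apply/funext => x; rewrite cmod_gt0.
Qed.

(** For fixed second coordinate w != 0, the first one is written l w; multiplication by w has
    Jacobian |w|^2. At w = 0 both sides contribute 0. *)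
Lemma integral_quot (G : R2 R * R2 R -> \bar R) :
  measurable_fun setT G -> (forall p, 0 <= G p)%E ->
  (\int[mu2 \x mu2]_p (if cplx p.2 != 0%R then G (quot p, p.2) else 0) =
   \int[mu2]_l \int[mu2]_w ((cmod (cplx w) ^+ 2)%:E * G (l, w)))%E.
Proof.
move=> mG G0.
have mGq : measurable_fun setT (fun p : R2 R * R2 R => G (quot p, p.2)).
  by apply: (measurableT_comp mG); apply: measurable_fun_pair => //; exact: measurable_quot.
have mF : measurable_fun setT
    (fun p : R2 R * R2 R => if cplx p.2 != 0 then G (quot p, p.2) else 0%E).
  by apply: measurable_fun_ifT => //; exact: (measurableT_comp measurable_neq0).
have F0 (p : R2 R * R2 R) : (0 <= if cplx p.2 != 0%R then G (quot p, p.2) else 0)%E.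
  by case: ifP.
rewrite (fubini_tonelli2 _ mF F0) /fubini_G.
have mw : measurable_fun setT (fun p : R2 R * R2 R => ((cmod (cplx p.2) ^+ 2)%:E * G p)%E).
  apply: emeasurable_funM => //; apply/measurable_EFinP; apply: measurable_funX.
  exact: (measurableT_comp measurable_cmod_cplx measurable_snd).
have w0 (p : R2 R * R2 R) : (0 <= (cmod (cplx p.2) ^+ 2)%:E * G p)%E.
  by rewrite mule_ge0// lee_fin sqr_ge0.
rewrite [RHS](fubini_tonelli (m1 := mu2) (m2 := mu2) _ mw w0).
apply: eq_integral => w _ /=; case: eqVneq => [w00|wn0] /=.
  rewrite integral0; rewrite -[LHS](integral0 mu2 setT); apply: eq_integral => l _.
  by rewrite w00 cmod0 expr0n mul0e.
have mGw : measurable_fun setT (fun l => G (l, w)) by exact: (measurableT_comp mG (pair2_measurable w)).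
rewrite ge0_integralZl// ?lee_fin ?sqr_ge0//.
rewrite (@ge0_integral_rot R (cplx w))//; last exact: (measurableT_comp mGq (pair2_measurable w)).
congr (_ * _)%E; apply: eq_integral => l _; congr G; congr pair.
by rewrite /quot /rot /= uncplxK mulrC mulKf// cplxK.
Qed.

Section kernel_mass.
Variable n : nat.

(** Integrand along one line, with [rho] the value of h at (l, 1): by homogeneity the domain is |w|
    rho < 1, and homogeneous factors contribute |w|^n. *)
Definition kern (rho : R) (x : R2 R) : R := (cmod (cplx x) * rho < 1)%R%:R * cmod (cplx x) ^+ n.

Lemma kern_ge0 rho x : 0 <= kern rho x.
Proof. by rewrite mulr_ge0 ?ler0n// exprn_ge0// cmod_ge0. Qed.

Lemma measurable_kern2 d (T : measurableType d) (f : T -> R) (g : T -> R2 R) :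
  measurable_fun setT f -> measurable_fun setT g ->
  measurable_fun setT (fun t => kern (f t) (g t)).
Proof.
move=> mf mg; have mc := measurableT_comp measurable_cmod_cplx mg.
apply: measurable_funM; last exact: measurable_funX.
rewrite (_ : (fun _ => _) = (fun t => if cmod (cplx (g t)) * f t < 1 then 1 else 0)).
  apply: measurable_fun_ifT => //; apply: measurable_fun_ltr => //.
  exact: measurable_funM.
by apply/funext => t; case: ifP.
Qed.

Lemma measurable_kern rho : measurable_fun setT (fun x => (kern rho x)%:E).
Proof. by apply/measurable_EFinP; apply: measurable_kern2. Qed.

Definition kmass rho : \bar R := (\int[mu2]_x (kern rho x)%:E)%E.

Lemma kmass_scale rho (t : R) : 0 < t ->
  kmass rho = ((t ^+ n.+2)%:E * kmass (rho * t))%E.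
Proof.
move=> t0; have ct : cmod t%:C = t by rewrite cmod_real gtr0_norm.
rewrite /kmass (@ge0_integral_rot R t%:C); last 3 first.
- by rewrite -cmod_gt0 ct.
- exact: measurable_kern.
- by move=> x; rewrite lee_fin kern_ge0.
rewrite ct (_ : t ^+ n.+2 = t ^+ 2 * t ^+ n); last by rewrite -exprD.
rewrite (EFinM (t ^+ 2) (t ^+ n)) -muleA; congr (_ * _)%E; rewrite -ge0_integralZl//; last 3 first.
- exact: measurable_kern.
- by move=> x _; rewrite lee_fin kern_ge0.
- by rewrite lee_fin exprn_ge0// ltW.
apply: eq_integral => x _; rewrite -EFinM; congr EFin; rewrite /kern cmod_rot ct.
have -> : t * cmod (cplx x) * rho = cmod (cplx x) * (rho * t) by ring.
by rewrite exprMn mulrCA.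
Qed.

Lemma kmass1_lty : (kmass 1 < +oo)%E.
Proof.
apply: (@le_lt_trans _ _ (\int[mu2]_(x in disc 0%R 1%R) 1)%E).
  rewrite [leRHS]integral_mkcond; apply: ge0_le_integral => //.
  - by move=> x _; rewrite lee_fin kern_ge0.
  - exact: measurable_kern.
  - by apply/(measurable_restrictT _ _).1 => //; exact: measurable_disc.
  move=> x _; rewrite patchE; case: ifPn => [|]; rewrite ?inE ?notin_setE /disc/= subr0 => h.
    by rewrite lee_fin /kern mulr1 h mul1r exprn_ile1 ?cmod_ge0// ltW.
  rewrite /kern mulr1 (_ : _ < 1 = false) ?mul0r//; exact/negbTE/negP.
rewrite integral_cst; last exact: measurable_disc.
by rewrite mul1e; apply: (le_lt_trans (mu2_disc_le ler01)); exact: ltry.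
Qed.

Lemma kmass1_gt0 : (0 < kmass 1)%E.
Proof.
have h2 : cmod (2^-1)%:C = 2^-1 :> R by rewrite cmod_real gtr0_norm.
pose c : R[i] := (2^-1)%:C; have s0 : 0 < 8^-1 :> R by rewrite invr_gt0.
apply: (@lt_le_trans _ _ (\int[mu2]_(x in sq c 8^-1) (4^-1 ^+ n)%:E)%E).
  rewrite integral_cst; last exact: measurable_sq.
  rewrite -[X in (_ * X)%E]/(mu2 (sq c 8^-1)) mu2_sq; last exact: ltW.
  by rewrite -EFinM lte_fin mulr_gt0 ?exprn_gt0 ?invr_gt0// mulr_gt0// exprn_gt0.
rewrite integral_mkcond; apply: ge0_le_integral => //.
- by move=> x _; rewrite patchE; case: ifP => // _; rewrite lee_fin exprn_ge0// invr_ge0.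
- by apply/(measurable_restrictT _ _).1 => //; exact: measurable_sq.
- exact: measurable_kern.
move=> x _; rewrite patchE; case: ifPn => [|_]; last by rewrite lee_fin kern_ge0.
rewrite inE => /sq_cmod xc.
have := cmod_triangle (cplx x) c 0; have := cmod_triangle c (cplx x) 0.
rewrite !subr0 (cmodBC c) h2 => l1 l2.
have x1 : cmod (cplx x) < 1 by lra.
rewrite lee_fin /kern mulr1 x1 mul1r lerXn2r ?nnegrE ?invr_ge0 ?cmod_ge0//; lra.
Qed.

(** For rho > 0 this is scaling. At rho = 0, scaling by 2 gives kmass 0 = 2^(n + 2) kmass 0, and
    positivity leaves only [+oo]. *)
Lemma kmassE rho : 0 <= rho -> kmass rho = (kmass 1 * npow n.+2 rho)%E.
Proof.
rewrite le_eqVlt => /predU1P[<-|rho0]; last first.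
  rewrite /npow gt_eqF// (@kmass_scale _ rho^-1) ?invr_gt0// mulfV ?gt_eqF//.
  by rewrite muleC.
rewrite /npow eqxx gt0_muley; last exact: kmass1_gt0.
have K0 : (0 < kmass 0)%E.
  apply: (lt_le_trans kmass1_gt0); apply: ge0_le_integral => //.
  - by move=> x _; rewrite lee_fin kern_ge0.
  - exact: measurable_kern.
  - exact: measurable_kern.
  move=> x _; rewrite lee_fin /kern mulr0 ltr01 ler_wpM2r ?exprn_ge0 ?cmod_ge0//.
  by case: (_ < 1); rewrite ?ler01.
have := @kmass_scale 0 2 (ltr0n _ 2); rewrite mul0r.
case: (kmass 0) K0 => // k; rewrite lte_fin => k0 /eqP; rewrite -EFinM eqe => /eqP e.
have : 1 < 2 ^+ n.+2 :> R by rewrite exprn_egt1// ltr1n.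
by rewrite -(ltr_pM2r k0) mul1r -e ltxx.
Qed.

End kernel_mass.

(** The Jacobian raises |w|^n to |w|^(n + 2), and integration over the disc |w| < 1 / rho gives
    rho^(-(n + 4)). The set [L] of lines lets each chart be used on its own region. *)
Lemma slice_formula (n : nat) (phi rho : R2 R -> R) (L : set (R2 R)) :
  measurable L -> measurable_fun setT phi -> measurable_fun setT rho ->
  (forall x, 0 <= phi x) -> (forall x, 0 <= rho x) ->
  (\int[mu2 \x mu2]_p (if cplx p.2 != 0%R then
      (\1_L (quot p) * phi (quot p) * cmod (cplx p.2) ^+ n *
      (cmod (cplx p.2) * rho (quot p) < 1)%R%:R)%:E else 0) =
   kmass n.+2 1 * \int[mu2]_(l in L) ((phi l)%:E * npow n.+4 (rho l)))%E.
Proof.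
move=> mL mphi mrho phi0 rho0.
pose G (p : R2 R * R2 R) : \bar R := (\1_L p.1 * phi p.1 * kern n (rho p.1) p.2)%:E.
have G0 p : (0 <= G p)%E by rewrite lee_fin mulr_ge0 ?kern_ge0// mulr_ge0//.
have m1 : measurable_fun setT (fun p : R2 R * R2 R => \1_L p.1 : R).
  exact: (measurableT_comp (measurable_indic mL) measurable_fst).
have m2 : measurable_fun setT (fun p : R2 R * R2 R => phi p.1).
  exact: (measurableT_comp mphi measurable_fst).
have m3 : measurable_fun setT (fun p : R2 R * R2 R => rho p.1).
  exact: (measurableT_comp mrho measurable_fst).
have mG : measurable_fun setT G.
  apply/measurable_EFinP; apply: measurable_funM; first exact: measurable_funM.
  exact: measurable_kern2.
transitivity (\int[mu2 \x mu2]_p (if cplx p.2 != 0%R then G (quot p, p.2) else 0))%E.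
  apply: eq_integral => p _; case: ifP => // _; congr EFin; rewrite /= /kern.
  by ring.
rewrite integral_quot//.
have K0 : (0 <= kmass n.+2 1)%E by exact/ltW/kmass1_gt0.
have mn : measurable_fun setT (fun l => (phi l)%:E * npow n.+4 (rho l))%E.
  apply: emeasurable_funM; first exact/measurable_EFinP.
  rewrite /npow; apply: measurable_fun_ifT => //; first exact: measurable_fun_eqr.
  by apply/measurable_EFinP; apply: measurable_funX; exact: measurable_inv_ge0.
rewrite -ge0_integralZl//; last 2 first.
- exact: measurable_funTS.
- by move=> x _; rewrite mule_ge0 ?npow_ge0// lee_fin.
rewrite [RHS]integral_mkcond; apply: eq_integral => l _.
transitivity (\int[mu2]_w ((\1_L l * phi l)%:E * (kern n.+2 (rho l) w)%:E))%E.
  apply: eq_integral => w _; rewrite /G -!EFinM; congr EFin; rewrite /kern/= !exprS.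
  by ring.
rewrite ge0_integralZl//; last 3 first.
- exact: measurable_kern.
- by move=> x _; rewrite lee_fin kern_ge0.
- by rewrite lee_fin mulr_ge0.
rewrite -/(kmass _ _) kmassE// patchE indicE; case: ifP => lL.
  by rewrite mul1r muleCA.
by rewrite !mul0r mul0e.
Qed.

End slice.

(** * The local criterion near a point of a chart *)

Section chart_local.
Context {R : realType}.
Notation mu2 := (@lebesgueR2 R).
Implicit Types (a b z : R[i]) (P : {poly R[i]}).

Lemma horner_bounded P a : exists2 M : R, 0 <= M &
  forall z, cmod z <= 1 -> cmod P.[a + z] <= M.
Proof.
elim/poly_ind: P => [|P c [M M0 hM]].
  by exists 0 => // z _; rewrite horner0 cmod0.
exists (M * (cmod a + 1) + cmod c) => [|z z1].
  by rewrite addr_ge0 ?mulr_ge0 ?addr_ge0 ?cmod_ge0.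
rewrite hornerMXaddC; apply: (le_trans (le_cmodD _ _)); rewrite lerD2r cmodM.
apply: ler_pM; rewrite ?cmod_ge0 ?hM//.
by apply: (le_trans (le_cmodD _ _)); rewrite lerD2l.
Qed.

(** P = (X - a)^m S with S(a) != 0, and |S| stays between |S(a)| / 2 and 2 |S(a)| near [a]. *)
Lemma horner_near_root P a : P != 0 -> exists2 r : R, 0 < r &
  exists k K : R, 0 < k /\ forall z, cmod z < r ->
    k * cmod z ^+ mup a P <= cmod P.[a + z] <= K * cmod z ^+ mup a P.
Proof.
have arith (s t u : R) : u <= s + t -> s <= u + t -> t <= s / 2 -> s / 2 <= u /\ u <= 2 * s.
  by move=> *; split; lra.
move=> P0; set m := mup a P.
have /dvdpP[S PE] : ('X - a%:P) ^+ m %| P by rewrite -mup_geq.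
have Sa : S.[a] != 0.
  apply/negP => Sa; have /factor_theorem[T ST] : root S a by [].
  have : (m < m)%N; last by rewrite ltnn.
  by rewrite {2}/m mup_geq// PE ST -mulrA -exprS dvdp_mull.
have /factor_theorem[T ST] : root (S - S.[a]%:P) a.
  by rewrite /root hornerD hornerN hornerC subrr.
have [M M0 hM] := horner_bounded T a.
have s0 : 0 < cmod S.[a] by rewrite cmod_gt0.
(* S(a + z) - S(a) = z T(a + z), with |T| <= M on the unit disc, so this radius keeps the difference
   below |S(a)| / 2. *)
pose r : R := Num.min 1 (cmod S.[a] / (2 * (M + 1))).
have M1 : 0 < 2 * (M + 1) by rewrite mulr_gt0// ltr_wpDl.
exists r; first by rewrite lt_min ltr01 divr_gt0.
exists (cmod S.[a] / 2), (2 * cmod S.[a]); split; first by rewrite divr_gt0.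
move=> z; rewrite lt_min => /andP[z1]; rewrite ltr_pdivlMr// => z2.
have PzE : cmod P.[a + z] = cmod S.[a + z] * cmod z ^+ m.
  by rewrite PE hornerM horner_exp hornerXsubC addrAC subrr add0r cmodM cmodX.
have Sz : S.[a + z] = S.[a] + T.[a + z] * z.
  rewrite -[S in LHS](subrK S.[a]%:P) hornerD ST hornerC hornerM hornerXsubC.
  by rewrite addrAC subrr add0r addrC.
have Tz : cmod (T.[a + z] * z) <= cmod S.[a] / 2.
  rewrite cmodM; apply: (le_trans (ler_wpM2r (cmod_ge0 z) (hM z (ltW z1)))).
  rewrite ler_pdivlMr//; apply: le_trans (ltW z2); rewrite -mulrA mulrCA (mulrC M).
  by rewrite !ler_wpM2l ?cmod_ge0// lerDl.
have l1 : cmod S.[a + z] <= cmod S.[a] + cmod (T.[a + z] * z) by rewrite Sz le_cmodD.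
have l2 : cmod S.[a] <= cmod S.[a + z] + cmod (T.[a + z] * z).
  by have := le_cmodB S.[a + z] (T.[a + z] * z); rewrite {1}Sz addrK.
have [l3 l4] := arith _ _ _ l1 l2 Tz.
by rewrite PzE; apply/andP; split; rewrite ler_wpM2r// exprn_ge0// cmod_ge0.
Qed.

(** Multiplicities and Lelong numbers are read off on the line with second coordinate [b], for an
    arbitrary representative (a, b), whereas the slices use second coordinate 1; the two parameters
    are related by x = (a + z) / b. *)
Lemma integral_disc_chart a b (r : R) (f : R2 R -> \bar R) : b != 0 ->
  measurable_fun setT f -> (forall x, 0 <= f x)%E ->
  (\int[mu2]_(x in disc (a / b)%R r) f x = (cmod b^-1 ^+ 2)%:E *
    \int[mu2]_(x in disc 0%R (r * cmod b)%R) f (uncplx ((a + cplx x) / b)%R))%E.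
Proof.
move=> b0 mf f0; have cb : 0 < cmod b by rewrite cmod_gt0.
have md z s : measurable (disc z s : set (R2 R)) by exact: measurable_disc.
have fd0 z s x : (0 <= (f \_ (disc z s)) x)%E by rewrite patchE; case: ifP.
have mfd z s : measurable_fun setT (f \_ (disc z s))%E.
  by apply/(measurable_restrictT _ _).1 => //; exact: measurable_funTS.
rewrite integral_mkcond (@ge0_integral_rot R b^-1)// ?invr_eq0//; congr (_ * _)%E.
rewrite (@ge0_integral_transl R a); last 2 first.
- exact: (measurableT_comp (mfd _ _) (measurable_rot _)).
- by move=> x; exact: fd0.
rewrite [RHS]integral_mkcond; apply: eq_integral => x _.
rewrite /rot uncplxK !patchE (addrC (cplx x)) (mulrC b^-1).
congr (if _ then _ else _).
apply/idP/idP; rewrite !inE /disc /= uncplxK subr0 -mulrBl addrAC subrr add0r cmodM cmodV.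
  by rewrite ltr_pdivrMr.
by rewrite ltr_pdivrMr.
Qed.

Variables (H : R[i] -> R).
Hypothesis (uH : usc H) (H0 : forall w, 0 <= H w) (sH : forall a l, submean_at H a l).
Hypothesis H_pos : exists w, 0 < H w.
Variables (P : {poly R[i]}) (P_neq0 : P != 0) (a b : R[i]) (b_neq0 : b != 0).
Variables (p : nat) (p_gt0 : (0 < p)%N).
Variables (f : R2 R -> \bar R) (c : R) (c_gt0 : 0 < c).
Hypothesis mf : measurable_fun setT f.
Hypothesis fE : forall x : R2 R, f (uncplx ((a + cplx x) / b)) =
  ((c * cmod P.[a + cplx x] ^+ 2)%:E * npow p (H (cplx x)))%E.

Let f_ge0 x : (0 <= f x)%E.
Proof.
have -> : x = uncplx ((a + cplx (uncplx (b * cplx x - a))) / b).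
  by rewrite uncplxK addrC subrK mulrC mulKf// cplxK.
by rewrite fE mule_ge0 ?npow_ge0// lee_fin mulr_ge0 ?sqr_ge0// ltW.
Qed.

Let mg m : measurable_fun setT (fun x : R2 R => ((cmod (cplx x) ^+ m)%:E * npow p (H (cplx x)))%E).
Proof.
apply: emeasurable_funM; last exact: measurable_npow.
by apply/measurable_EFinP; apply: measurable_funX; exact: measurable_cmod_cplx.
Qed.

Let mF : measurable_fun setT (fun x : R2 R => f (uncplx ((a + cplx x) / b))).
Proof.
rewrite (_ : (fun x => _) = (fun x => f (rot b^-1 (uncplx (cplx x + a))))).
  apply: (measurableT_comp (measurableT_comp mf (measurable_rot _))).
  exact: measurable_transl.
by apply/funext => x; rewrite /rot uncplxK addrC mulrC.
Qed.

Lemma chart_sufficient : p%:R * lelong_nb H < 2 * (mup a P)%:R + 2 ->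
  exists2 r : R, 0 < r & (\int[mu2]_(x in disc (a / b)%R r) f x < +oo)%E.
Proof.
have [r1 r10 [k [K [k0 kK]]]] := horner_near_root a P_neq0; set m := mup a P in kK *.
have K0 : 0 <= K.
  pose z : R[i] := (r1 / 2)%:C; have r2 : 0 < r1 / 2 by rewrite divr_gt0.
  have zr : cmod z = r1 / 2 by rewrite cmod_real gtr0_norm.
  have /kK/andP[l1 l2] : cmod z < r1 by rewrite zr ltr_pdivrMr// ltr_pMr// ltr1n.
  have zm : 0 < cmod z ^+ m by rewrite exprn_gt0// zr.
  rewrite -(pmulr_lge0 _ zm); apply: le_trans (le_trans l1 l2).
  by rewrite mulr_ge0 ?(ltW k0)// ltW.
move=> hnu; have [r2 r20 I2] : exists2 r, 0 < r & (\int[mu2]_(x in disc 0%R r)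
    ((cmod (cplx x) ^+ (2 * m))%:E * npow p (H (cplx x))) < +oo)%E.
  by apply: local_sufficient => //; rewrite natrM.
pose r := Num.min r1 r2; have r0 : 0 < r by rewrite lt_min r10.
have cb : 0 < cmod b by rewrite cmod_gt0.
exists (r / cmod b); first exact: divr_gt0.
rewrite integral_disc_chart// divfK ?gt_eqF//.
apply: lte_mul_pinfty; rewrite ?lee_fin ?sqr_ge0//.
have md s : measurable (disc 0 s : set (R2 R)) by exact: measurable_disc.
apply: (@le_lt_trans _ _ ((c * K ^+ 2)%:E * \int[mu2]_(x in disc 0%R r)
    ((cmod (cplx x) ^+ (2 * m))%:E * npow p (H (cplx x))))%E); last first.
  apply: lte_mul_pinfty; rewrite ?lee_fin ?mulr_ge0 ?sqr_ge0 ?(ltW c_gt0)//.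
  apply: le_lt_trans I2; apply: ge0_subset_integral => //.
  - exact: measurable_funTS.
  - by move=> x _; rewrite mule_ge0 ?npow_ge0// lee_fin exprn_ge0// cmod_ge0.
  - by move=> x; rewrite /disc/= lt_min => /andP[].
have g0 (x : R2 R) : (0 <= (cmod (cplx x) ^+ (2 * m))%:E * npow p (H (cplx x)))%E.
  by rewrite mule_ge0 ?npow_ge0// lee_fin exprn_ge0// cmod_ge0.
rewrite -ge0_integralZl//; last 2 first.
- exact: measurable_funTS.
- by rewrite lee_fin mulr_ge0 ?sqr_ge0// ltW.
apply: ge0_le_integral => //.
- exact: measurable_funTS.
- by apply: measurable_funTS; apply: emeasurable_funM => //; exact: measurable_cst.
move=> x; rewrite /disc /= subr0 lt_min => /andP[/kK/andP[_ PK] _].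
rewrite fE muleA lee_wpmul2r ?npow_ge0// -EFinM lee_fin -mulrA ler_wpM2l ?(ltW c_gt0)//.
rewrite mulnC exprM -exprMn lerXn2r ?nnegrE ?cmod_ge0//.
by rewrite mulr_ge0 ?exprn_ge0 ?cmod_ge0.
Qed.

Lemma chart_necessary (r : R) : 0 < r -> 2 * (mup a P)%:R + 2 <= p%:R * lelong_nb H ->
  (\int[mu2]_(x in disc (a / b)%R r) f x = +oo)%E.
Proof.
move=> r0; have [r1 r10 [k [K [k0 kK]]]] := horner_near_root a P_neq0.
set m := mup a P in kK * => hnu.
have cb : 0 < cmod b by rewrite cmod_gt0.
pose s := Num.min (r * cmod b) r1; have s0 : 0 < s by rewrite lt_min mulr_gt0.
have md t : measurable (disc 0 t : set (R2 R)) by exact: measurable_disc.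
rewrite integral_disc_chart// cmodV; apply/eqP; rewrite -leye_eq.
have -> : (+oo = ((cmod b)^-1 ^+ 2 * (c * k ^+ 2))%:E * \int[mu2]_(x in disc 0%R s)
    ((cmod (cplx x) ^+ (2 * m))%:E * npow p (H (cplx x))))%E.
  rewrite local_necessary ?natrM// gt0_muley// lte_fin mulr_gt0//.
    by rewrite exprn_gt0// invr_gt0.
  by rewrite mulr_gt0// exprn_gt0.
rewrite EFinM -muleA lee_wpmul2l ?lee_fin ?sqr_ge0//.
have g0 (x : R2 R) : (0 <= (cmod (cplx x) ^+ (2 * m))%:E * npow p (H (cplx x)))%E.
  by rewrite mule_ge0 ?npow_ge0// lee_fin exprn_ge0// cmod_ge0.
rewrite -ge0_integralZl//; last 2 first.
- exact: measurable_funTS.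
- by rewrite lee_fin mulr_ge0 ?sqr_ge0// ltW.
apply: (@le_trans _ _ (\int[mu2]_(x in disc 0%R s) f (uncplx ((a + cplx x) / b)%R))%E).
  apply: ge0_le_integral => //.
  - by move=> x _; rewrite mule_ge0// lee_fin mulr_ge0 ?sqr_ge0// ltW.
  - by apply: measurable_funTS; apply: emeasurable_funM => //; exact: measurable_cst.
  - exact: measurable_funTS.
  move=> x; rewrite /disc /= subr0 lt_min => /andP[_ /kK/andP[Pk _]].
  rewrite fE muleA lee_wpmul2r ?npow_ge0// -EFinM lee_fin -mulrA ler_wpM2l ?(ltW c_gt0)//.
  rewrite mulnC exprM -exprMn lerXn2r ?nnegrE ?cmod_ge0//.
  by rewrite mulr_ge0 ?exprn_ge0 ?cmod_ge0// ltW.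
apply: ge0_subset_integral => //; first exact: measurable_funTS.
by move=> x; rewrite /disc/= lt_min => /andP[].
Qed.

End chart_local.

(** * Homogeneous polynomials in two variables *)

Section polynomials.
Context {R : realType}.
Implicit Types (Q : mpoly 2 R[i]) (z : C2 R) (b l : R[i]) (d : nat).

Lemma mmap_pair (S : comNzRingType) (f : R[i] -> S) (x y : S) Q :
  mmap f (pair_val x y) Q =
  \sum_(m <- msupp Q) f (mcoeff m Q) * (x ^+ m ord0 * y ^+ m ord_max).
Proof.
apply: eq_bigr => m _; congr (_ * _); rewrite /mmap1 big_ord_recl big_ord1 /pair_val/=.
by rewrite (_ : lift _ _ = ord_max)//; exact/val_inj.
Qed.

Lemma polyfunE Q z :
  polyfun Q z = \sum_(m <- msupp Q) mcoeff m Q * (z.1 ^+ m ord0 * z.2 ^+ m ord_max).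
Proof. exact: mmap_pair. Qed.

Lemma mdeg2 (m : multinom 2) : mdeg m = (m ord0 + m ord_max)%N.
Proof.
rewrite mdegE big_ord_recl big_ord1; congr (_ + m _)%N; exact/val_inj.
Qed.

Lemma homog_exponents d Q m : Q \is ishomog1 d mdeg -> m \in msupp Q ->
  (m ord0 + m ord_max)%N = d.
Proof. by move=> /dhomogP hQ mQ; rewrite -mdeg2; exact: hQ. Qed.

Lemma polyfun_hom d Q l z : Q \is ishomog1 d mdeg ->
  polyfun Q (l *: z) = l ^+ d * polyfun Q z.
Proof.
move=> hQ; rewrite !polyfunE mulr_sumr big_seq [RHS]big_seq.
apply: eq_bigr => m /(homog_exponents hQ) <-; rewrite /= exprD !exprMn; ring.
Qed.

Lemma horner_polysub Q (P1 P2 : {poly R[i]}) (x : R[i]) :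
  (polysub Q P1 P2).[x] = polyfun Q (P1.[x], P2.[x]).
Proof.
rewrite polyfunE /polysub mmap_pair horner_sum; apply: eq_bigr => m _.
by rewrite !hornerM hornerC !horner_exp.
Qed.

(** By homogeneity a monomial of the support is determined by either exponent, so fixing one
    variable at [b != 0] lets no two monomials cancel. *)
Lemma polysub_neq0 d Q b : Q != 0 -> Q \is ishomog1 d mdeg -> b != 0 ->
  polysub Q 'X b%:P != 0 /\ polysub Q b%:P 'X != 0.
Proof.
move=> Q0 hQ b0; have [m mQ] : exists m, m \in msupp Q.
  case E : (msupp Q) => [|m s]; last by exists m; rewrite mem_head.
  by move/eqP: E; rewrite msupp_eq0 (negbTE Q0).
have Qm : mcoeff m Q != 0 by rewrite -mcoeff_msupp.
have eqm m' : m' \in msupp Q -> ((m' ord0 == m ord0) || (m' ord_max == m ord_max)) -> m' = m.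
  move=> /(homog_exponents hQ); rewrite -(homog_exponents hQ mQ) => e h; apply/mnmP => i.
  have [e0 e1] : m' ord0 = m ord0 /\ m' ord_max = m ord_max.
    case/orP: h => /eqP h; split => //; [apply: (@addnI (m ord0)); rewrite -{1}h|
      apply: (@addIn (m ord_max)); rewrite -{1}h]; exact: e.
  case: i => -[|[|//]] hi.
    by rewrite (_ : Ordinal hi = ord0)//; exact/val_inj.
  by rewrite (_ : Ordinal hi = ord_max)//; exact/val_inj.
have bX n : b^+ n != 0 by rewrite expf_neq0.
split; rewrite /polysub mmap_pair.
  apply/eqP => /(congr1 (coefp (m ord0))) /eqP; rewrite /= coef0 coef_sum.
  rewrite (bigD1_seq m)//= big_seq_cond big1 ?addr0 => [|m' /andP[m'Q m'm]].
    by rewrite coefCM coefXnM ltnn subnn -rmorphXn/= coefC eqxx !mulf_eq0 (negbTE (bX _)) (negbTE Qm).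
  rewrite coefCM -rmorphXn/= coefMC coefXn; case: eqP => [e|_]; rewrite ?mul0r ?mulr0//.
  by case/eqP: m'm; apply: eqm => //; rewrite e eqxx.
apply/eqP => /(congr1 (coefp (m ord_max))) /eqP; rewrite /= coef0 coef_sum.
rewrite (bigD1_seq m)//= big_seq_cond big1 ?addr0 => [|m' /andP[m'Q m'm]].
  by rewrite coefCM -rmorphXn/= coefCM coefXn eqxx !mulf_eq0 (negbTE (bX _)) (negbTE Qm) oner_eq0.
rewrite coefCM -rmorphXn/= coefCM coefXn; case: eqP => [e|_]; rewrite ?mul0r ?mulr0//.
by case/eqP: m'm; apply: eqm => //; rewrite e eqxx orbT.
Qed.

Lemma differentiable_polyfun Q (z : C2 R) : differentiable (polyfun Q : C2 R -> C1 R) z.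
Proof.
have d1 : differentiable (fst : C2 R -> C1 R) z.
  by apply: linear_differentiable => w; exact: cvg_fst.
have d2 : differentiable (snd : C2 R -> C1 R) z.
  by apply: linear_differentiable => w; exact: cvg_snd.
have dX (f : C2 R -> C1 R) n : differentiable f z -> differentiable (fun w => f w ^+ n : C1 R) z.
  move=> df; elim: n => [|n IH]; first exact: differentiable_cst.
  by under eq_fun do rewrite exprS; exact: differentiableM.
rewrite (_ : polyfun Q = fun w : C2 R =>
    \sum_(m <- msupp Q) mcoeff m Q * (w.1 ^+ m ord0 * w.2 ^+ m ord_max)); last first.
  by apply/funext => w; rewrite polyfunE.
elim: (msupp Q) => [|m s IH].
  by under eq_fun do rewrite big_nil; exact: differentiable_cst.
under eq_fun do rewrite big_cons; apply: differentiableD => //.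
apply: differentiableM; first exact: differentiable_cst.
by apply: differentiableM; exact: dX.
Qed.

Lemma measurable_polyfun Q :
  measurable_fun setT (fun x : R2 R * R2 R => complex.Re (polyfun Q (ofR4 x))) /\
  measurable_fun setT (fun x : R2 R * R2 R => complex.Im (polyfun Q (ofR4 x))).
Proof.
pose mC (f : R2 R * R2 R -> R[i]) := measurable_fun setT (fun x : R2 R * R2 R => complex.Re (f x)) /\
  measurable_fun setT (fun x : R2 R * R2 R => complex.Im (f x)).
have mD f g : mC f -> mC g -> mC (fun x => f x + g x).
  move=> [f1 f2] [g1 g2]; split.
    rewrite (_ : (fun _ => _) = (fun x => complex.Re (f x) + complex.Re (g x))).
      exact: measurable_funD.
    by apply/funext => x; case: (f x) (g x) => ? ? [].
  rewrite (_ : (fun _ => _) = (fun x => complex.Im (f x) + complex.Im (g x))).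
    exact: measurable_funD.
  by apply/funext => x; case: (f x) (g x) => ? ? [].
have mM f g : mC f -> mC g -> mC (fun x => f x * g x).
  move=> [f1 f2] [g1 g2]; split.
    rewrite (_ : (fun _ => _) = (fun x => complex.Re (f x) * complex.Re (g x)
      - complex.Im (f x) * complex.Im (g x))).
      by apply: measurable_funB; exact: measurable_funM.
    by apply/funext => x; case: (f x) (g x) => ? ? [].
  rewrite (_ : (fun _ => _) = (fun x => complex.Re (f x) * complex.Im (g x)
      + complex.Im (f x) * complex.Re (g x))).
    by apply: measurable_funD; exact: measurable_funM.
  by apply/funext => x; case: (f x) (g x) => ? ? [].
have mK c : mC (fun=> c) by split; exact: measurable_cst.
have mX f n : mC f -> mC (fun x => f x ^+ n).
  move=> mf; elim: n => [|n IH]; first exact: mK.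
  by under eq_fun do rewrite exprS; exact: mM.
have m1 : mC (fun x => (ofR4 x).1).
  by split; apply: (measurableT_comp _ measurable_fst); [exact: measurable_fst|exact: measurable_snd].
have m2 : mC (fun x => (ofR4 x).2).
  by split; apply: (measurableT_comp _ measurable_snd); [exact: measurable_fst|exact: measurable_snd].
suff : mC (fun x => polyfun Q (ofR4 x)) by [].
under eq_fun do rewrite polyfunE.
elim: (msupp Q) => [|m s IH]; first by under eq_fun do rewrite big_nil; exact: mK.
under eq_fun do rewrite big_cons; apply: (mD) IH; apply: (mM) => //.
by apply: mM; exact: mX.
Qed.

End polynomials.

(** * Restriction to complex lines *)

Section psh_lines.
Context {R : realType}.
Notation mu := (@lebesgue_measure R).
Implicit Types (H : R[i] -> R) (a l z w : R[i]).

Lemma usc_of_lne H : (forall z, 0 <= H z) ->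
  upper_semicontinuous (fun z : C1 R => lne (H z)%:E) -> usc H.
Proof.
move=> H0 uH z c Hzc; have c0 : 0 < c by exact: le_lt_trans Hzc.
have in0 (x : R) : 0 <= x -> x%:E \in `[0%E, +oo%E]%R.
  by move=> x0; rewrite in_itv/= lee_fin x0 leey.
have ltE w : (lne (H w)%:E < (ln c)%:E)%E = (H w < c).
  by rewrite -lne_EFin// lte_lne ?lte_fin//; apply: in0 => //; exact: ltW.
have := uH z (- ln c); rewrite EFinN lteN2 ltE => /(_ Hzc)[V zV hV].
have /nbhs_ballP[e e0 eV] := zV.
(* The radius of a ball is an element of [R[i]]; being positive, it is real. *)
have eE : e = (complex.Re e)%:C.
  have : (0 : R[i]) < e by [].
  by case: (e) => e1 e2; rewrite ltcE/= => /andP[/eqP-> _].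
have e1 : 0 < complex.Re e.
  have : (0 : R[i]) < e by [].
  by rewrite {1}eE ltcR.
exists (complex.Re e) => // w wz; rewrite -ltE -lteN2 -EFinN; apply: hV; apply: eV.
by rewrite /ball /= {1}eE /Num.norm /= -/(cmod _) ltcR -/(cmod _) cmodBC.
Qed.

Variable h : C2 R -> R.
Hypothesis h_ge0 : forall v, 0 <= h v.
Hypothesis h_psh : plurisubharmonic (logh h).
Hypothesis h_hom : homogeneous h.

Lemma usc_line (A B : C2 R) : usc (fun z => h (A + z *: B)).
Proof.
apply: usc_of_lne => [z//|]; have [_ _ /(_ A B)[_ uH _]] := h_psh; exact: uH.
Qed.

(** Plurisubharmonicity is applied on the line through A + aB with direction lB, at 0 and radius 1,
    which accommodates a complex [l], including 0. *)
Lemma line_mean (A B : C2 R) a l :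
  (lne (h (A + a *: B))%:E <= ((2 * pi)^-1)%:E *
   \int[mu]_(t in (`[0%R, (2 * pi)%R]%classic : set (measurableTypeR R)))
     lne (h (A + (a + l * cis t) *: B))%:E)%E.
Proof.
have [_ _ /(_ (A + a *: B) (l *: B))[_ _ /(_ 0 1 ltr01)]] := h_psh.
rewrite scale0r addr0; move/le_trans; apply; rewrite le_eqVlt; apply/orP; left; apply/eqP; congr (_ * _)%E; apply: eq_integral => t _.
by rewrite /logh add0r mul1r scalerA scalerDl addrA (mulrC l).
Qed.

Lemma submean_line (A B : C2 R) a l : submean_at (fun z => h (A + z *: B)) a l.
Proof. by apply: submean_of_mean; [exact: usc_line| |exact: line_mean]. Qed.

(** If h vanished on the whole circle, the mean of its logarithm would be -oo, below the finite
    value at the centre. *)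
Lemma line_pos (A B : C2 R) a l : 0 < h (A + a *: B) ->
  exists t, 0 < h (A + (a + l * cis t) *: B).
Proof.
move=> ha; apply: contrapT => no.
have h0 t : h (A + (a + l * cis t) *: B) = 0.
  by apply/eqP; rewrite eq_le h_ge0 andbT leNgt; apply/negP => ?; apply: no; exists t.
have := line_mean A B a l.
under eq_integral do rewrite h0 le0_lneNy//.
have pi2 : 0 < 2 * pi :> R by rewrite mulr_gt0 ?pi_gt0.
rewrite integral_cst//= lebesgue_measure_itv/= lte_fin pi2 sube0.
rewrite gt0_mulNye ?lte_fin// gt0_muleNy ?lte_fin ?invr_gt0//.
by rewrite (lt_geF ha).
Qed.

End psh_lines.

Section affine_chart.
Context {R : realType}.
Notation mu2 := (@lebesgueR2 R).
Variables (h : C2 R -> R) (q : C2 R -> R[i]) (d : nat) (P : R[i] -> {poly R[i]}).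
Hypothesis h_ge0 : forall v, 0 <= h v.
Hypothesis h_hom : homogeneous h.
Hypothesis h_usc : forall A B : C2 R, usc (fun z => h (A + z *: B)).
Hypothesis h_sub : forall (A B : C2 R) a l, submean_at (fun z => h (A + z *: B)) a l.
Hypothesis h_pos : forall b : R[i], b != 0 -> exists w, 0 < h (w, b).
Hypothesis q_hom : forall (l : R[i]) z, q (l *: z) = l ^+ d * q z.
Hypothesis q_meas : measurable_fun setT (fun p => cmod (q (ofR4 p))).
Hypothesis qE : forall w b : R[i], q (w, b) = (P b).[w].
Hypothesis P_neq0 : forall b, b != 0 -> P b != 0.

(** The exponent is 2(d + 2) = 2d + 4. The functions [h], [q] and [P] are abstract so that the
    section serves both charts, the second one with exchanged coordinates. *)
Definition chart_integrand (x : R2 R) : \bar R :=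
  ((cmod (q (cplx x, 1%R)) ^+ 2)%:E * npow (2 * d).+4 (h (cplx x, 1%R)))%E.

Let lineE (a b z : R[i]) : h (a + z, b) = h ((a, b) + z *: ((1, 0) : C2 R)).
Proof.
congr h; apply: (@congr2 _ _ _ pair).
  by congr (_ + _); rewrite [RHS]mulr1.
by rewrite -[LHS]addr0; congr (_ + _); rewrite [RHS]mulr0.
Qed.

Let usc_chart a b : usc (fun z => h (a + z, b)).
Proof. by under eq_fun do rewrite lineE; exact: h_usc. Qed.

Let submean_chart a b c l : submean_at (fun z => h (a + z, b)) c l.
Proof. by under eq_fun do rewrite lineE; exact: h_sub. Qed.

Let pos_chart a b : b != 0 -> exists w, 0 < h (a + w, b).
Proof. by move=> /h_pos[w hw]; exists (w - a); rewrite addrC subrK. Qed.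

Let h1_meas : measurable_fun setT (fun x : R2 R => h (cplx x, 1)).
Proof.
have := measurable_usc (@usc_chart 0 1); apply: eq_measurable_fun => x _ /=.
by rewrite add0r.
Qed.

Let q1_meas : measurable_fun setT (fun x : R2 R => cmod (q (cplx x, 1))).
Proof.
have := measurableT_comp q_meas (pair2_measurable (uncplx (1 : R[i]))).
by apply: eq_measurable_fun => x _.
Qed.

Lemma measurable_chart_integrand : measurable_fun setT chart_integrand.
Proof.
apply: emeasurable_funM; first by apply/measurable_EFinP; exact: measurable_funX.
rewrite /npow; apply: measurable_fun_ifT => //; first exact: measurable_fun_eqr.
by apply/measurable_EFinP; apply: measurable_funX; exact: measurable_inv_ge0.
Qed.

Lemma chart_integrand_ge0 x : (0 <= chart_integrand x)%E.
Proof. by rewrite mule_ge0 ?npow_ge0// lee_fin sqr_ge0. Qed.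

Let scale_pair (a b z : R[i]) : b != 0 -> ((a + z) / b, 1) = b^-1 *: ((a + z, b) : C2 R).
Proof. by move=> b0; apply: (@congr2 _ _ _ pair); [rewrite [RHS]mulrC|rewrite [RHS]mulVf]. Qed.

(** The factor |b|^(-2d) from q and |b|^(2d + 4) from h leave |b|^4. *)
Let chart_integrandE a b (x : R2 R) : b != 0 ->
  chart_integrand (uncplx ((a + cplx x) / b)) =
  ((cmod b ^+ 4 * cmod (P b).[a + cplx x] ^+ 2)%:E * npow (2 * d).+4 (h ((a + cplx x)%R, b)))%E.
Proof.
move=> b0; have cb : 0 < cmod b by rewrite cmod_gt0.
rewrite /chart_integrand uncplxK scale_pair// q_hom h_hom qE !cmodM !cmodX !cmodV /npow.
rewrite mulf_eq0 invr_eq0 (gt_eqF cb)/=; case: ifP => h0.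
  (* Where h vanishes, a zero of P gives 0 times [+oo], which is 0 on both sides; otherwise both
     sides are [+oo]. *)
  have [->|n0] := eqVneq (cmod (P b).[a + cplx x]) 0.
    by rewrite mulr0 expr0n/= mulr0.
  have n1 : 0 < cmod (P b).[a + cplx x] by rewrite lt0r n0 cmod_ge0.
  rewrite !gt0_muley// lte_fin; first by rewrite mulr_gt0// exprn_gt0.
  by rewrite exprn_gt0// mulr_gt0// exprn_gt0// invr_gt0.
rewrite -!EFinM; congr EFin; rewrite invfM invrK exprMn (exprMn _ (cmod b)).
rewrite -!exprM exprVn (_ : (2 * d).+4 = (d * 2 + 4)%N); last by rewrite addn4 mulnC.
rewrite (exprD (cmod b)) exprVn.
have cancelV (u v w s : R) : u != 0 -> u^-1 * v * (u * w * s) = w * v * s by move=> ?; field.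
by apply: cancelV; rewrite expf_neq0// gt_eqF.
Qed.

Lemma chart_integrable_near a b : b != 0 ->
  (2 * d).+4%:R * lelong_nb (fun z => h (a + z, b)) < 2 * (mup a (P b))%:R + 2 ->
  exists2 r : R, 0 < r & (\int[mu2]_(x in disc (a / b)%R r) chart_integrand x < +oo)%E.
Proof.
move=> b0; have cb : 0 < cmod b by rewrite cmod_gt0.
apply: (@chart_sufficient R (fun z => h (a + z, b)) _ _ _ _ (P b) _ a b b0 (2 * d).+4 _
  chart_integrand (cmod b ^+ 4)) => //.
- exact: pos_chart.
- exact: P_neq0.
- exact: exprn_gt0.
- exact: measurable_chart_integrand.
- by move=> x; exact: chart_integrandE.
Qed.

Lemma chart_integral_pinfty a b (r : R) : b != 0 -> 0 < r ->
  2 * (mup a (P b))%:R + 2 <= (2 * d).+4%:R * lelong_nb (fun z => h (a + z, b)) ->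
  (\int[mu2]_(x in disc (a / b)%R r) chart_integrand x = +oo)%E.
Proof.
move=> b0 r0; have cb : 0 < cmod b by rewrite cmod_gt0.
apply: (@chart_necessary R (fun z => h (a + z, b)) _ _ _ _ (P b) _ a b b0 (2 * d).+4
  chart_integrand (cmod b ^+ 4)) => //.
- exact: pos_chart.
- exact: P_neq0.
- exact: exprn_gt0.
- exact: measurable_chart_integrand.
- by move=> x; exact: chart_integrandE.
Qed.

Definition domain_integrand (p : R2 R * R2 R) : R :=
  (h (ofR4 p) < 1)%R%:R * cmod (q (ofR4 p)) ^+ 2.

Let ofR4E p : cplx p.2 != 0 -> ofR4 p = cplx p.2 *: ((cplx (quot p), 1) : C2 R).
Proof.
move=> p0; rewrite /quot uncplxK; apply: (@congr2 _ _ _ pair).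
  by rewrite [RHS]mulrC divfK.
by rewrite [RHS]mulr1.
Qed.

(** In this section semicontinuity is assumed along lines; homogeneity reduces joint measurability
    to the line at height 1 and to the modulus on the plane where the second coordinate is 0. *)
Lemma measurable_h : measurable_fun setT (fun p => h (ofR4 p)).
Proof.
rewrite (_ : (fun _ => _) = (fun p : R2 R * R2 R => if cplx p.2 != 0
    then cmod (cplx p.2) * h (cplx (quot p), 1) else cmod (cplx p.1) * h (1, 0))).
  apply: measurable_fun_ifT => //; first exact: (measurableT_comp measurable_neq0).
    apply: measurable_funM; first exact: (measurableT_comp measurable_cmod_cplx).
    exact: (measurableT_comp h1_meas measurable_quot).
  apply: measurable_funM; last exact: measurable_cst.
  exact: (measurableT_comp measurable_cmod_cplx).
apply/funext => p; case: ifPn => [p0|/negPn/eqP p0]; first by rewrite ofR4E// h_hom.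
rewrite -h_hom; congr h; rewrite /ofR4 -/(cplx p.1) -/(cplx p.2) p0.
by apply: (@congr2 _ _ _ pair); [rewrite [RHS]mulr1|rewrite [RHS]mulr0].
Qed.

Lemma measurable_domain_integrand : measurable_fun setT domain_integrand.
Proof.
apply: measurable_funM; last exact: measurable_funX.
rewrite (_ : (fun _ => _) = (fun p => if h (ofR4 p) < 1 then 1 else 0)).
  apply: measurable_fun_ifT => //; apply: measurable_fun_ltr => //; exact: measurable_h.
by apply/funext => p; case: ifP.
Qed.

Lemma domain_integrand_ge0 p : 0 <= domain_integrand p.
Proof. by rewrite mulr_ge0 ?ler0n// sqr_ge0. Qed.

Lemma domain_slice (L : set (R2 R)) : measurable L ->
  (\int[mu2 \x mu2]_p (if cplx p.2 != 0%R then (\1_L (quot p) * domain_integrand p)%:E else 0) =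
   kmass (2 * d).+2 1 * \int[mu2]_(l in L) chart_integrand l)%E.
Proof.
move=> mL; rewrite -(slice_formula (2 * d) mL (measurable_funX 2 q1_meas) h1_meas)//; last first.
  by move=> x; exact: sqr_ge0.
apply: eq_integral => p _; case: ifPn => // p0; congr EFin.
rewrite /domain_integrand ofR4E// q_hom h_hom cmodM cmodX exprMn -exprM (mulnC d).
by rewrite /=; ring.
Qed.

Lemma domain_slice_lty (L : set (R2 R)) : measurable L ->
  (\int[mu2]_(l in L) chart_integrand l < +oo)%E ->
  (\int[mu2 \x mu2]_p (if cplx p.2 != 0%R then (\1_L (quot p) * domain_integrand p)%:E else 0)
    < +oo)%E.
Proof.
move=> mL I; rewrite domain_slice//; apply: lte_mul_pinfty => //; first exact/ltW/kmass1_gt0.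
by rewrite ge0_fin_numE ?kmass1_lty//; exact/ltW/kmass1_gt0.
Qed.

Lemma domain_integral_pinfty a b : b != 0 ->
  2 * (mup a (P b))%:R + 2 <= (2 * d).+4%:R * lelong_nb (fun z => h (a + z, b)) ->
  (\int[mu2 \x mu2]_p (domain_integrand p)%:E = +oo)%E.
Proof.
move=> b0 hnu; apply/eqP; rewrite -leye_eq.
have md : measurable (disc (a / b) 1 : set (R2 R)) by exact: measurable_disc.
have I : (\int[mu2]_l chart_integrand l = +oo)%E.
  apply/eqP; rewrite -leye_eq -(@chart_integral_pinfty a b 1)//.
  apply: ge0_subset_integral => //; first exact: measurable_chart_integrand.
  by move=> x _; exact: chart_integrand_ge0.
have <- : (kmass (2 * d).+2 1 * +oo = +oo :> \bar R)%E.
  by rewrite gt0_muley//; exact: kmass1_gt0.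
rewrite -I -domain_slice//; apply: ge0_le_integral => //.
- by move=> p _; case: ifP => // _; rewrite indicT mul1r lee_fin domain_integrand_ge0.
- apply: measurable_fun_ifT => //; first exact: (measurableT_comp measurable_neq0).
  apply/measurable_EFinP; rewrite indicT; apply: measurable_funM => //.
  exact: measurable_domain_integrand.
- by apply/measurable_EFinP; exact: measurable_domain_integrand.
by move=> p _; rewrite indicT mul1r; case: ifP => // _; rewrite lee_fin domain_integrand_ge0.
Qed.

End affine_chart.

(** * The two charts of the projective line *)

Section swap.
Context {R : realType}.
Notation mu2 := (@lebesgueR2 R).

Lemma integral_swap (G : R2 R * R2 R -> \bar R) :
  measurable_fun setT G -> (forall p, 0 <= G p)%E ->
  (\int[mu2 \x mu2]_p G (p.2, p.1) = \int[mu2 \x mu2]_p G p)%E.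
Proof.
move=> mG G0.
have mGs : measurable_fun setT (fun p : R2 R * R2 R => G (p.2, p.1)).
  by apply: (measurableT_comp mG); exact: measurable_fun_pair.
rewrite fubini_tonelli1// [RHS](@fubini_tonelli2 _ _ _ _ _ mu2 mu2)//.
Qed.

(** Carries the chart with nonzero first coordinate to the one already treated. *)
Definition swap_pair (z : C2 R) : C2 R := (z.2, z.1).

Lemma plurisubharmonic_swap (u : C2 R -> \bar R) :
  plurisubharmonic u -> plurisubharmonic (u \o swap_pair).
Proof.
move=> [uoo uu us]; split => [z|z c|a b]; first exact: uoo.
  move=> /(uu (swap_pair z))[V zV hV]; exists (swap_pair @^-1` V); last by move=> y /hV.
  exact: (cvg_pair (@cvg_snd (C1 R) (C1 R) (nbhs z.1) (nbhs z.2) _)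
    (@cvg_fst (C1 R) (C1 R) (nbhs z.1) (nbhs z.2) _)) V zV.
rewrite (_ : (fun _ => _) = (fun l => u (swap_pair a + l *: swap_pair b))); first exact: us.
by apply/funext => l /=; congr u; apply: (@congr2 _ _ _ pair).
Qed.

Lemma homogeneous_swap (h : C2 R -> R) : homogeneous h -> homogeneous (h \o swap_pair).
Proof. by move=> hh l z; rewrite /= -hh; congr h; exact: (@congr2 _ _ _ pair). Qed.

End swap.

Section log_psh.
Context {R : realType}.
Variable h : C2 R -> R.
Hypothesis h_ge0 : forall v, 0 <= h v.
Hypothesis h_neq0 : exists v, h v != 0.
Hypothesis h_psh : plurisubharmonic (logh h).
Hypothesis h_hom : homogeneous h.

(** If h vanished on one horizontal line off the origin, homogeneity would make it vanish at every
    point with nonzero second coordinate. A positive value at (x, 0) is then refuted by the unit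
    circle about that point in the vertical line. *)
Lemma horizontal_pos (b : R[i]) : b != 0 -> exists w, 0 < h (w, b).
Proof.
move=> b0; apply: contrapT => no.
have hb w : h (w, b) = 0.
  by apply/eqP; rewrite eq_le h_ge0 andbT leNgt; apply/negP => ?; apply: no; exists w.
have hy x y : y != 0 -> h (x, y) = 0.
  move=> y0; have -> : (x, y) = (y / b) *: ((b / y * x, b) : C2 R).
    apply: (@congr2 _ _ _ pair); last by rewrite [RHS]divfK.
    rewrite [RHS](_ : _ = (y / b) * (b / y * x))// mulrA -[LHS]mul1r; congr (_ * _).
    by field; rewrite ?b0 ?y0.
  by rewrite h_hom hb mulr0.
have [[x y] hxy] := h_neq0.
have y0 : y = 0 by apply/eqP; apply: contraNT hxy => /hy ->.
have xE z : (x, z) = ((x, 0) : C2 R) + z *: ((0, 1) : C2 R).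
  apply: (@congr2 _ _ _ pair); first by rewrite -[LHS]addr0; congr (_ + _); rewrite [RHS]mulr0.
  by rewrite -[LHS]add0r; congr (_ + _); rewrite [RHS]mulr1.
have : 0 < h ((x, 0) + 0 *: ((0, 1) : C2 R)) by rewrite -xE -y0 lt0r hxy h_ge0.
move=> /(line_pos h_ge0 h_psh 1)[t]; rewrite -xE add0r mul1r hy ?ltxx//.
by rewrite -cmod_gt0 cmod_cis.
Qed.

Lemma lelong_horizontal (a b : R[i]) : b != 0 ->
  lelong (fun l : C1 R => logh h (l, b)) a = (lelong_nb (fun z => h (a + z, b)))%:E.
Proof.
move=> b0.
have E z : h (a + z, b) = h ((a, b) + z *: ((1, 0) : C2 R)).
  congr h; apply: (@congr2 _ _ _ pair); first by congr (_ + _); rewrite [RHS]mulr1.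
  by rewrite -[LHS]addr0; congr (_ + _); rewrite [RHS]mulr0.
apply: lelong_eq => //.
- by under eq_fun do rewrite E; exact: usc_line.
- by move=> c l; under eq_fun do rewrite E; exact: submean_line.
- by have [w hw] := horizontal_pos b0; exists (w - a); rewrite addrC subrK.
Qed.

End log_psh.

Section compactness.
Context {R : realType}.
Notation mu2 := (@lebesgueR2 R).

Lemma measurable_closed_disc (M : R) : measurable [set x : R2 R | cmod (cplx x) <= M].
Proof.
have m : measurable_fun setT (fun x : R2 R => cmod (cplx x) <= M).
  by apply: measurable_fun_ler => //; exact: measurable_cmod_cplx.
rewrite (_ : [set _ | _] = setT `&` (fun x : R2 R => cmod (cplx x) <= M) @^-1` [set true]).
  exact: m.
by rewrite setTI; apply/seteqP; split.
Qed.

Lemma integral_closed_disc_lty (f : R2 R -> \bar R) (M : R) :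
  measurable_fun setT f -> (forall x, 0 <= f x)%E ->
  (forall a, exists2 r : R, 0 < r & (\int[mu2]_(x in disc a r) f x < +oo)%E) ->
  (\int[mu2]_(x in [set x | (cmod (cplx x) <= M)%R]) f x < +oo)%E.
Proof.
move=> mf f0 loc.
have [rad radP] := @choice _ _ (fun a r => 0 < r /\ (\int[mu2]_(x in disc a r) f x < +oo)%E)
  (fun a => let: ex_intro2 r r0 fr := loc a in ex_intro _ r (conj r0 fr)).
pose K := [set z : R[i] | cmod z <= M].
have oK : metric_open (~` K).
  move=> z /negP; rewrite -ltNge => zM; exists (cmod z - M); first by rewrite subr_gt0.
  move=> w wz; apply/negP; rewrite -ltNge; have := le_cmodB w (w - z).
  by rewrite subKr; lra.
have [s sK sP] := @disc_cover R K M rad oK (fun z zK => zK) (fun z _ => (radP z).1).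
have mfd a : measurable_fun setT (f \_ (disc a (rad a)))%E.
  apply/(measurable_restrictT _ _).1 => //; first exact: measurable_disc.
  exact: measurable_funTS.
have fd0 a x : (0 <= (f \_ (disc a (rad a))) x)%E by rewrite patchE; case: ifP.
(* The sum over a finite cover of the integrand restricted to each disc dominates it on the closed
   disc. *)
apply: (@le_lt_trans _ _ (\int[mu2]_x (\sum_(w <- s) (f \_ (disc w (rad w))) x))%E); last first.
  rewrite ge0_integral_sum//; elim: (s) => [|w t IH]; first by rewrite big_nil.
  by rewrite big_cons lte_add_pinfty// -integral_mkcond (radP w).2.
have mK := measurable_closed_disc M.
rewrite integral_mkcond; apply: ge0_le_integral => //.
- by move=> x _; rewrite patchE; case: ifP.
- by apply/(measurable_restrictT _ _).1 => //; exact: measurable_funTS.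
- by apply: emeasurable_sum.
move=> x _; rewrite patchE; case: ifPn => [|_]; last exact: sume_ge0.
rewrite inE => /sP[w ws xw]; rewrite (big_rem w)//=.
have -> : f x = (f \_ (disc w (rad w))) x by rewrite patchE mem_set.
by rewrite leeDl// sume_ge0.
Qed.

End compactness.

Section two_charts.
Context {R : realType}.
Notation mu2 := (@lebesgueR2 R).
Variables (F : R2 R * R2 R -> R) (r : R).
Hypothesis (r_gt0 : 0 < r) (mF : measurable_fun setT F) (F_ge0 : forall p, 0 <= F p).

Let K := [set x : R2 R | cmod (cplx x) <= r^-1].

Let G (A : set (R2 R)) (f : R2 R * R2 R -> R) (p : R2 R * R2 R) : \bar R :=
  if cplx p.2 != 0 then (\1_A (quot p) * f p)%:E else 0%E.

Let G_meas A f : measurable A -> measurable_fun setT f -> measurable_fun setT (G A f).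
Proof.
move=> mA mf; apply: measurable_fun_ifT => //; first exact: (measurableT_comp measurable_neq0).
apply/measurable_EFinP; apply: measurable_funM => //.
exact: (measurableT_comp (measurable_indic mA) measurable_quot).
Qed.

Let G_ge0 A f p : (forall x, 0 <= f x) -> (0 <= G A f p)%E.
Proof. by move=> f0; rewrite /G; case: ifP => // _; rewrite lee_fin mulr_ge0. Qed.

Let swap_meas : measurable_fun setT (fun p : R2 R * R2 R => (p.2, p.1)).
Proof. exact: measurable_fun_pair. Qed.

Let Fs p := F (p.2, p.1).

Let Fs_meas : measurable_fun setT Fs.
Proof. exact: (measurableT_comp mF swap_meas). Qed.

Let N : set (R2 R * R2 R) := ([set 0] `*` [set 0]) `*` ([set 0] `*` [set 0]).

Let measurable_set0 : measurable ([set 0] `*` [set 0] : set (R2 R)).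
Proof. by apply: measurableX; exact: measurable_set1. Qed.

Let N_meas : measurable N. Proof. exact: measurableX. Qed.

Let N_null : (mu2 \x mu2)%E N = 0%E.
Proof.
rewrite product_measure1E// [X in (X * _)%E](_ : _ = 0%E) ?mul0e//.
transitivity ((@lebesgue_measure R \x @lebesgue_measure R)%E ([set 0] `*` [set 0])) => //.
have m0 : measurable ([set 0] : set (measurableTypeR R)) by exact: measurable_set1.
rewrite product_measure1E// [X in (X * _)%E](_ : _ = 0%E) ?mul0e//.
exact: lebesgue_measure_set1.
Qed.

(** Either |z1 / z2| <= 1 / r, or |z2 / z1| < r, where points with z2 = 0 != z1 belong to the second
    case; the origin remains and forms the null set [N]. *)
Let cover p : ((F p)%:E <= G K F p + G (disc 0%R r) Fs (p.2, p.1) + ((EFin \o F) \_ N) p)%E.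
Proof.
have F0 : (0 <= ((EFin \o F) \_ N) p)%E.
  by rewrite patchE; case: ifP => // _; rewrite lee_fin.
have G10 : (0 <= G K F p)%E by exact: G_ge0.
have G20 : (0 <= G (disc 0%R r) Fs (p.2, p.1))%E by apply: G_ge0 => x; exact: F_ge0.
have le1 : ((F p)%:E <= G K F p)%E ->
    ((F p)%:E <= G K F p + G (disc 0%R r) Fs (p.2, p.1) + ((EFin \o F) \_ N) p)%E.
  by move=> /le_trans; apply; rewrite -addeA leeDl// adde_ge0.
have le2 : ((F p)%:E <= G (disc 0%R r) Fs (p.2, p.1))%E ->
    ((F p)%:E <= G K F p + G (disc 0%R r) Fs (p.2, p.1) + ((EFin \o F) \_ N) p)%E.
  by move=> /le_trans; apply; rewrite addeAC leeDr// adde_ge0.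
case: p F0 G10 G20 le1 le2 => x y /= F0 G10 G20 le1 le2.
have [y0|y0] := eqVneq (cplx y) 0; have [x0|x0] := eqVneq (cplx x) 0.
- have -> : (F (x, y))%:E = ((EFin \o F) \_ N) (x, y).
    rewrite patchE mem_set// /N /=; case: x y x0 y0 {F0 G10 G20 le1 le2} => [x1 x2] [y1 y2].
    by rewrite /cplx /= => -[-> ->] [-> ->].
  by rewrite leeDr// adde_ge0.
- apply: le2; rewrite /G/= x0 lee_fin indicE mem_set ?mul1r//.
  by rewrite /disc/= subr0 /quot uncplxK y0 mul0r cmod0.
- apply: le1; rewrite /G/= y0 lee_fin indicE mem_set ?mul1r//.
  by rewrite /K/= /quot uncplxK x0 mul0r cmod0 invr_ge0 ltW.
have [xy|xy] := leP (cmod (cplx x / cplx y)) r^-1.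
  by apply: le1; rewrite /G/= y0 lee_fin indicE mem_set ?mul1r// /K/= /quot uncplxK.
apply: le2; rewrite /G/= x0 lee_fin indicE mem_set ?mul1r//.
rewrite /disc/= subr0 /quot uncplxK /=.
have -> : cplx y / cplx x = (cplx x / cplx y)^-1 by rewrite invfM invrK mulrC.
rewrite cmodV -(invrK r) ltf_pV2// posrE ?invr_gt0//.
by rewrite (lt_trans _ xy)// invr_gt0.
Qed.

Lemma integral_two_charts :
  (\int[mu2 \x mu2]_p (if cplx p.2 != 0%R then (\1_K (quot p) * F p)%:E else 0) < +oo)%E ->
  (\int[mu2 \x mu2]_p (if cplx p.2 != 0%R
     then (\1_(disc 0%R r) (quot p) * F (p.2, p.1))%:E else 0) < +oo)%E ->
  (\int[mu2 \x mu2]_p (F p)%:E < +oo)%E.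
Proof.
move=> I1 I2; have mK : measurable K by exact: measurable_closed_disc.
have mD : measurable (disc 0 r : set (R2 R)) by exact: measurable_disc.
have m1 := G_meas mK mF; have m2 := G_meas mD Fs_meas.
have m2s := measurableT_comp m2 swap_meas.
have mFE : measurable_fun setT (EFin \o F) by exact/measurable_EFinP.
have m3 : measurable_fun setT ((EFin \o F) \_ N)%E.
  by apply/(measurable_restrictT _ _).1 => //; exact: measurable_funTS.
have g1 p : (0 <= G K F p)%E by exact: G_ge0.
have g2 p : (0 <= G (disc 0%R r) Fs p)%E by apply: G_ge0 => x; exact: F_ge0.
have g3 p : (0 <= ((EFin \o F) \_ N) p)%E by rewrite patchE; case: ifP => // _; rewrite lee_fin.
apply: (@le_lt_trans _ _ (\int[mu2 \x mu2]_p
    (G K F p + G (disc 0%R r) Fs (p.2, p.1) + ((EFin \o F) \_ N) p))%E).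
  apply: ge0_le_integral => //.
  - by move=> p _; rewrite lee_fin.
  - by apply: emeasurable_funD => //; exact: emeasurable_funD.
rewrite ge0_integralD//; last 2 first.
- by move=> p _; exact: adde_ge0.
- exact: emeasurable_funD.
have -> : (\int[mu2 \x mu2]_p ((EFin \o F) \_ N) p = 0)%E.
  rewrite -integral_mkcond; apply: null_set_integral; [exact: N_meas| |exact: N_null].
  by apply: measurable_funTS; exact: mFE.
by rewrite adde0 ge0_integralD// lte_add_pinfty// integral_swap.
Qed.

End two_charts.

(** * The criterion on the projective line *)

Section criterion.
Context {R : realType}.
Notation mu2 := (@lebesgueR2 R).

Lemma homcoord_neq0 (p : P1 R) : homcoord p != 0.
Proof. exact: (valP (repr p)). Qed.

(** The representative chosen for a class is known up to a nonzero scalar, which is why the chart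
    lemmas allow an arbitrary [b != 0]. *)
Lemma homcoord_class (v : C2 R) : v != 0 ->
  exists (p : P1 R) (c : R[i]), c != 0 /\ homcoord p = c *: v.
Proof.
move=> v0; pose w : nzvec R := exist _ v v0; exists (\pi_(P1 R)%qT w).
have : (\pi_(P1 R)%qT w) = \pi_(P1 R)%qT (repr (\pi_(P1 R)%qT w)) by rewrite reprK.
by move=> /eqmodP/asboolP[c c0 E]; exists c; split.
Qed.

Lemma lelong_conditionE (m d : nat) (nu : R) :
  (m%:R%:E > nu%:E * (d + 2)%:R%:E - 1)%E = ((2 * d).+4%:R * nu < 2 * m%:R + 2).
Proof.
rewrite -EFinM -EFinB lte_fin (_ : (2 * d).+4 = (2 * (d + 2))%N); last by rewrite mulnDr addn4.
by rewrite natrM; apply/idP/idP; lra.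
Qed.

Variables (h : C2 R -> R) (d : nat) (Q : mpoly 2 R[i]).
Hypothesis h_ge0 : forall v, 0 <= h v.
Hypothesis h_neq0 : exists v, h v != 0.
Hypothesis h_psh : plurisubharmonic (logh h).
Hypothesis h_hom : homogeneous h.
Hypothesis Q_neq0 : Q != 0.
Hypothesis Q_hom : Q \is ishomog1 d mdeg.

Let hs := h \o swap_pair.
Let hs_ge0 v : 0 <= hs v. Proof. exact: h_ge0. Qed.
Let hs_neq0 : exists v, hs v != 0.
Proof. by have [[x y] hv] := h_neq0; exists (y, x). Qed.
Let hs_psh : plurisubharmonic (logh hs). Proof. exact: (plurisubharmonic_swap h_psh). Qed.
Let hs_hom : homogeneous hs. Proof. exact: homogeneous_swap. Qed.

Let q := polyfun Q.
Let qs := q \o swap_pair.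
Let P (b : R[i]) := polysub Q 'X b%:P.
Let Ps (b : R[i]) := polysub Q b%:P 'X.

Let q_hom (l : R[i]) z : q (l *: z) = l ^+ d * q z. Proof. exact: polyfun_hom. Qed.
Let qs_hom (l : R[i]) z : qs (l *: z) = l ^+ d * qs z.
Proof. by rewrite -[RHS]q_hom; congr q; apply: (@congr2 _ _ _ pair). Qed.

Let q_meas : measurable_fun setT (fun p : R2 R * R2 R => cmod (q (ofR4 p))).
Proof.
have [mr mi] := measurable_polyfun Q.
have := measurableT_comp measurable_cmod_cplx (measurable_fun_pair mr mi).
apply: eq_measurable_fun => p _ /=; rewrite /cplx /=.
by rewrite /q; case: (polyfun Q (ofR4 p)).
Qed.

Let qs_meas : measurable_fun setT (fun p : R2 R * R2 R => cmod (qs (ofR4 p))).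
Proof.
have ms : measurable_fun setT (fun p : R2 R * R2 R => (p.2, p.1)) by exact: measurable_fun_pair.
by have := measurableT_comp q_meas ms; apply: eq_measurable_fun.
Qed.

Let qE w b : q (w, b) = (P b).[w].
Proof. by rewrite horner_polysub hornerX hornerC. Qed.
Let qsE w b : qs (w, b) = (Ps b).[w].
Proof. by rewrite horner_polysub hornerX hornerC. Qed.

Let P_neq0 b : b != 0 -> P b != 0. Proof. by move=> /(polysub_neq0 Q_neq0 Q_hom)[]. Qed.
Let Ps_neq0 b : b != 0 -> Ps b != 0. Proof. by move=> /(polysub_neq0 Q_neq0 Q_hom)[]. Qed.

Let pos := horizontal_pos h_ge0 h_neq0 h_psh h_hom.
Let poss := horizontal_pos hs_ge0 hs_neq0 hs_psh hs_hom.

Let F := domain_integrand h q.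
Let Fs := domain_integrand hs qs.

Let FsE p : Fs (p.2, p.1) = F p. Proof. by []. Qed.

(** When the second coordinate vanishes, the definitions keep the first one fixed; this is the
    horizontal case for [hs], the function with exchanged coordinates. *)
Lemma P1_condition (p : P1 R) :
  ((multP1 Q p)%:R%:E > lelongP1 (logh h) p * (d + 2)%:R%:E - 1)%E =
  (let v := homcoord p in if v.2 != 0
   then (2 * d).+4%:R * lelong_nb (fun z => h (v.1 + z, v.2)) < 2 * (mup v.1 (P v.2))%:R + 2
   else (2 * d).+4%:R * lelong_nb (fun z => hs (v.2 + z, v.1)) < 2 * (mup v.2 (Ps v.1))%:R + 2).
Proof.
rewrite /multP1 /lelongP1; have := homcoord_neq0 p; case: (homcoord p) => a b /= ab0.
case: ifPn => [b0|/negPn/eqP b0].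
  by rewrite (lelong_horizontal h_ge0 h_neq0 h_psh h_hom)// lelong_conditionE.
have a0 : a != 0 by apply: contra ab0 => /eqP a0; rewrite a0 b0.
by rewrite [X in (X * _)%E](lelong_horizontal hs_ge0 hs_neq0 hs_psh hs_hom b a0) lelong_conditionE.
Qed.

Let F_meas : measurable_fun setT F.
Proof. exact: (measurable_domain_integrand h_hom (@usc_line R h h_ge0 h_psh) q_meas). Qed.
Let Fs_meas : measurable_fun setT Fs.
Proof. exact: (measurable_domain_integrand hs_hom (@usc_line R hs hs_ge0 hs_psh) qs_meas). Qed.

Lemma lelong_condition_of_integrable : (\int[mu2 \x mu2]_p (F p)%:E < +oo)%E ->
  forall p : P1 R, ((multP1 Q p)%:R%:E > lelongP1 (logh h) p * (d + 2)%:R%:E - 1)%E.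
Proof.
move=> I p; rewrite P1_condition; have := homcoord_neq0 p; case: (homcoord p) => a b /= ab0.
case: ifPn => [b0|/negPn/eqP b0]; rewrite ltNge; apply/negP => hnu.
  have := domain_integral_pinfty h_ge0 h_hom (@usc_line R h h_ge0 h_psh) (@submean_line R h h_ge0 h_psh)
    pos q_hom q_meas qE P_neq0 b0 hnu.
  by rewrite -/F => E; rewrite E in I.
have a0 : a != 0 by apply: contra ab0 => /eqP a0; rewrite a0 b0.
have := domain_integral_pinfty hs_ge0 hs_hom (@usc_line R hs hs_ge0 hs_psh)
  (@submean_line R hs hs_ge0 hs_psh) poss qs_hom qs_meas qsE Ps_neq0 a0 hnu.
rewrite -/Fs -integral_swap; last 2 first.
- exact/measurable_EFinP.
- by move=> x; rewrite lee_fin domain_integrand_ge0.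
by under eq_integral do rewrite FsE; move=> E; rewrite E in I.
Qed.

Lemma integrable_of_lelong_condition :
  (forall p : P1 R, ((multP1 Q p)%:R%:E > lelongP1 (logh h) p * (d + 2)%:R%:E - 1)%E) ->
  (\int[mu2 \x mu2]_p (F p)%:E < +oo)%E.
Proof.
move=> cond.
(* The condition at the single point [1 : 0] gives a neighbourhood of it; what remains of the
   projective line is the closed disc of radius 1 / r in the other chart. *)
have [r r0 Ir] : exists2 r : R, 0 < r &
    (\int[mu2]_(x in disc 0%R r) chart_integrand hs qs d x < +oo)%E.
  have v0 : ((1, 0) : C2 R) != 0 by rewrite xpair_eqE oner_eq0.
  have [p [c [c0 pE]]] := homcoord_class v0.
  have := cond p; rewrite P1_condition pE.
  have -> : c *: ((1, 0) : C2 R) = (c, 0).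
    by apply: (@congr2 _ _ _ pair); [rewrite [LHS]mulr1|rewrite [LHS]mulr0].
  rewrite /= eqxx /= => hnu.
  have := chart_integrable_near hs_ge0 hs_hom (@usc_line R hs hs_ge0 hs_psh)
    (@submean_line R hs hs_ge0 hs_psh) poss qs_hom qs_meas qsE Ps_neq0 c0 hnu.
  by rewrite mul0r.
have IK : (\int[mu2]_(x in [set x | (cmod (cplx x) <= r^-1)%R]) chart_integrand h q d x < +oo)%E.
  apply: integral_closed_disc_lty => [||a].
  - exact: (measurable_chart_integrand d h_ge0 (@usc_line R h h_ge0 h_psh) q_meas).
  - by move=> x; exact: chart_integrand_ge0.
  have v0 : ((a, 1) : C2 R) != 0 by rewrite xpair_eqE oner_eq0 andbF.
  have [p [c [c0 pE]]] := homcoord_class v0.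
  have := cond p; rewrite P1_condition pE.
  have -> : c *: ((a, 1) : C2 R) = (c * a, c).
    by apply: (@congr2 _ _ _ pair); last rewrite [LHS]mulr1.
  rewrite /= c0 => hnu.
  have := chart_integrable_near h_ge0 h_hom (@usc_line R h h_ge0 h_psh)
    (@submean_line R h h_ge0 h_psh) pos q_hom q_meas qE P_neq0 c0 hnu.
  by have -> : c * a / c = a by rewrite mulrC mulKf.
have mD : measurable (disc 0 r : set (R2 R)) by exact: measurable_disc.
have mK := measurable_closed_disc r^-1.
apply: (integral_two_charts r0 F_meas (domain_integrand_ge0 h q)).
  exact: (domain_slice_lty h_ge0 h_hom (@usc_line R h h_ge0 h_psh) q_hom q_meas mK IK).
exact: (domain_slice_lty hs_ge0 hs_hom (@usc_line R hs hs_ge0 hs_psh) qs_hom qs_meas mD Ir).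
Qed.

End criterion.

Theorem theorem11 (R : realType) (h : C2 R -> R)
    (h_ge0 : forall z, 0 <= h z)
    (h_neq0 : exists z, h z != 0)
    (h_psh : plurisubharmonic (logh h))
    (h_hom : homogeneous h)
    (d : nat) (Q : mpoly 2 R[i])
    (Q_neq0 : Q != 0)
    (Q_hom : Q \is ishomog1 d mdeg) :
  L2h (unit_domain h) (polyfun Q) <->
  (forall p : P1 R,
     ((multP1 Q p)%:R%:E > lelongP1 (logh h) p * (d + 2)%:R%:E - 1)%E).
Proof.
have E : (\int[@lebesgueR2 R \x @lebesgueR2 R]_(x in @ofR4 R @^-1` unit_domain h)
    ((cmod (polyfun Q (ofR4 x))) ^+ 2)%:E =
  \int[@lebesgueR2 R \x @lebesgueR2 R]_p (domain_integrand h (polyfun Q) p)%:E)%E.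
  rewrite integral_mkcond; apply: eq_integral => p _; rewrite patchE /domain_integrand.
  case: ifPn => [|]; rewrite ?inE ?notin_setE /unit_domain/= => hp.
    by rewrite hp mul1r.
  by rewrite (_ : _ < 1 = false) ?mul0r//; exact/negbTE/negP.
split=> [[[_ _ I] _]|cond].
  by apply: lelong_condition_of_integrable => //; rewrite -E.
(* Measurability and holomorphy hold for every polynomial; the condition concerns finiteness of the
   integral. *)
have [mr mi] := measurable_polyfun Q.
split; last by move=> z _; exact: differentiable_polyfun.
split; [exact: measurable_funTS|exact: measurable_funTS|].
by rewrite E; exact: integrable_of_lelong_condition cond.
Qed.
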